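(* Assume that the PDMP conditions, the ergodicity conditions and the model conditions of the context hold. Let $\sigma\ge 48(\psi_1+C_\lambda\psi_2)$, $\sigma'\ge 48 c_\lambda\psi_1$, $pen(m)=\frac{\sigma D_m}{n}+\frac{\sigma'}{n}$, and let $\hat\nu_{\hat m}$ be the corresponding adaptive estimator of the stationary density $\nu$. Then $$\mathbb{E}_{z_0}\left(\|\nu-\hat\nu_{\hat m}\|_{L^2(\mathcal I)}^2\right)\le \min_{m\in\mathcal M_n}\left(3\|\nu_m-\nu\|_{L^2(\mathcal I)}^2+4\,pen(m)\right)+\frac{c'}{n},$$ where $\mathcal M_n=\{m: D_m^2\le n\}$ and $c'$ does not depend on $n$ and is a function of $(V_\lambda,R,\gamma,\|\nu\|_{L^2(\mathcal I)})$ (and of the fixed quantities $\psi_1,\psi_2,z_0$).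
   Context: Notation: $\mathbb R^+=[0,\infty)$; $\mathcal I=[i_1,i_2]\subset(0,\infty)$ is a fixed compact interval. PDMP conditions. A piecewise deterministic Markov process (PDMP) on $\mathbb R^+$ has a flow $\phi$, a jump rate $\lambda$ and a transition kernel $Q$. (i) $\phi:\mathbb R^+\times\mathbb R^+\to\mathbb R^+$ is $C^1$, $\phi(\cdot,t)$ is a homeomorphism onto its image for each $t$, $\phi(\cdot,t+s)=\phi(\phi(\cdot,s),t)$, and for each $x$ the map $\phi_x:=\phi(x,\cdot)$ is an increasing $C^1$-diffeomorphism onto $[x,\infty)$ (so $\phi(x,0)=x$). (ii) $\lambda:\mathbb R^+\to\mathbb R^+$ is measurable and for every $x$ there is $\varepsilon'>0$ with $\int_0^{\varepsilon'}\lambda(\phi(x,s))ds<\infty$. (iii) $Q(x,\mathbb R^+\setminus\{x\})=1$ for all $x$. By the semigroup property, $(\phi_x^{-1})'(y)$ for $y\ge x$ does not depend on $x$; for $y<x$, $(\phi_x^{-1})'(y)$ denotes this common value. Jump chain. Start from a fixed $Z_0=z_0$. Given $Z_{k-1}=z$, the pre-jump location $Y_k$ satisfies $P(Y_k>y\mid Z_{k-1}=z)=\exp(-\int_z^y\lambda(u)(\phi_z^{-1})'(u)du)$ for $y\ge z$; given $Y_k=y$, the post-jump location $Z_k$ has law $Q(y,\cdot)$; $(Z_0,Y_1,Z_1,Y_2,Z_2,\dots)$ is Markov. $\mathcal P(z,dy)$ is the law of $Y_1$ given $Z_0=z$. $\mathbb E_{z_0}$, $\mathrm{Var}_{z_0}$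 are taken given $Z_0=z_0$. The observations are $Z_0,(Y_k,Z_k)_{1\le k\le n}$. Ergodicity conditions. (a) For all $x\le i_1$, $\int_0^{i_1}\lambda(y)(\phi_x^{-1})'(y)dy<\infty$, and $\sup_{[i_1,i_2]}\lambda<\infty$. (b) $(Y_k,Z_k)$ is positive recurrent and strongly ergodic; $\boldsymbol\nu,\mu,\rho,\xi$ denote the stationary laws of $Y_k$, $Z_k$, $(Y_k,Z_k)$, $(Z_k,Y_{k+1})$, so $\rho(dy,dz)=\boldsymbol\nu(dy)Q(y,dz)$, $\xi(dz,dy)=\mu(dz)\mathcal P(z,dy)$. (c) There are $V_\lambda:\mathbb R^+\to[1,\infty)$, $\gamma\in(0,1)$, $R>0$ such that for every $\psi:(\mathbb R^+)^2\to\mathbb R$ with $|\psi(y,z)|\le V_\lambda(z)$ for all $(y,z)$, and every integer $k$, $|\mathbb E(\psi(Y_k,Z_k)\mid Z_0=z_0)-\int\psi\,d\rho|\le R V_\lambda(z_0)\gamma^k$. By (a), $\boldsymbol\nu$ has a bounded Lebesgue density $\nu$ on $\mathcal I$. Constants. $G_\lambda(z)=\frac{R}{1-\gamma}(V_\lambda(z)+\int V_\lambda d\mu)$, $C_\lambda=\int G_\lambda d\mu=\frac{2R}{1-\gamma}\int V_\lambda d\mu$, and $c_\lambda$ is a constant depending only on $(\gamma,R,V_\lambda)$ (and $z_0$) such that for every bounded $s$ and every $n$: $\mathrm{Var}_{z_0}(\frac1n\sum_{k=1}^n s(Y_k,Z_k))\le\frac1n\int s^2d\rho+\frac{\|s\|_\infty}{n}\int|s(y,z)|G_\lambda(z)\rho(dy,dz)+\frac{c_\lambda\|s\|_\infty^2}{n^2}$.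 Model conditions. $(S_m)_{m\in\mathbb N}$ are linear subspaces of $L^2(\mathcal I)$ (functions on $\mathcal I$, set to $0$ outside). (1) $S_m$ is increasing in $m$ and has finite dimension $D_m$. (2) There is $\psi_1>0$ with $\|s\|_\infty^2\le\psi_1D_m\|s\|_{L^2}^2$ for all $m$, $s\in S_m$. (3) There is $\psi_2>0$ such that each $S_m$ has an orthonormal basis $(\varphi_l)_{1\le l\le D_m}$ with $\|\sum_l\|\varphi_l\|_\infty|\varphi_l|\|_\infty\le\psi_2D_m$. (4) There are $\mathbf r\in\mathbb N$, $C>0$ such that for all $\alpha\le\mathbf r$ and $s\in B^\alpha_{2,\infty}(\mathcal I)$, $\|s-s_m\|_{L^2}\le CD_m^{-\alpha}\|s\|_{B^\alpha_{2,\infty}}$, with $s_m$ the orthogonal projection of $s$ on $S_m$. Here $\|f\|_{B^\alpha_{2,\infty}}=\|f\|_{L^2}+\sup_{t>0}t^{-\alpha}\omega_{r+1}(f,t)_2$, $r=\lfloor\alpha\rfloor$, $\omega_r(f,t)_2=\sup_{0<h\le t}\|\sum_{k=0}^r(-1)^k\binom rk f(\cdot+kh)\|_{L^2}$, and $B^\alpha_{2,\infty}$ is the set of $f\in L^2$ with finite norm. Estimator. $\nu_m$ is the $L^2(\mathcal I)$-orthogonal projection of $\nu$ on $S_m$. With a basis as in (3), $\hat\nu_m=\sum_{l=1}^{D_m}\hat a_l\varphi_l$, $\hat a_l=\frac1n\sum_{k=1}^n\varphi_l(Y_k)$. Let $\gamma_n(s)=\|s\|_{L^2(\mathcal I)}^2-\frac2n\sum_{k=1}^ns(Y_k)$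 and $\hat m=\arg\min_{m\in\mathcal M_n}\{\gamma_n(\hat\nu_m)+pen(m)\}$; the adaptive estimator is $\hat\nu_{\hat m}$. *)

(* Defs.v *)
From HB Require Import structures.
From mathcomp Require Import all_boot all_order all_algebra.
From mathcomp Require Import all_classical all_reals all_analysis.

Set Implicit Arguments.
Unset Strict Implicit.
Unset Printing Implicit Defensive.

Import Order.TTheory GRing.Theory Num.Theory.
Import numFieldNormedType.Exports.

Local Open Scope classical_set_scope.
Local Open Scope ring_scope.

(* The state space [0, +oo[ is a subset of R: functions, kernels and measures
   are given on R, and only their restriction to Rplus is ever constrained. *)
Definition Rplus (R : realType) : set R := `[0, +oo[%classic.
Arguments Rplus : clear implicits.

Section flow.
Variable R : realType.
Implicit Types (phi : R -> R -> R) (f : R -> R).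

(* C^1 up to the boundary: the derivatives in the interior extend
   continuously to the closed domain. *)
Definition C1_halfline (a : R) f := exists f' : R -> R,
  [/\ {within `[a, +oo[, continuous f}, {within `[a, +oo[, continuous f'} &
      forall x : R, a < x -> is_derive x 1 f (f' x)].

Definition C1_quadrant phi := exists phix phit : R * R -> R,
  [/\ {within Rplus R `*` Rplus R, continuous (fun w : R * R => phi w.1 w.2)},
      {within Rplus R `*` Rplus R, continuous phix},
      {within Rplus R `*` Rplus R, continuous phit} &
      forall x t : R, 0 < x -> 0 < t ->
        is_derive x 1 (phi ^~ t) (phix (x, t)) /\
        is_derive t 1 (phi x) (phit (x, t))].

(* phi_x^{-1} : [x, +oo[ -> [0, +oo[ *)
Definition flow_inv phi (x y : R) : R :=
  xget 0 [set t | 0 <= t /\ phi x t = y].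

(* (phi_x^{-1})'(y), extended to y <= x by the common value, read off
   phi_0^{-1}. The two-sided derivative at x = y = 0 is meaningless, but
   the function is only used under a Lebesgue integral. *)
Definition flow_inv' phi (x y : R) : R :=
  if x < y then derive1 (flow_inv phi x) y else derive1 (flow_inv phi 0) y.

Definition homeo_onto_image (D : set R) f :=
  {within D, continuous f} /\
  exists g : R -> R, {within f @` D, continuous g} /\ {in D, cancel f g}.

Record flow_conditions phi : Prop := {
  flow_ge0 : forall x t : R, 0 <= x -> 0 <= t -> 0 <= phi x t ;
  flow_C1 : C1_quadrant phi ;
  flow_homeo : forall t : R, 0 <= t -> homeo_onto_image (Rplus R) (phi ^~ t) ;
  flow_semigroup : forall x t s : R, 0 <= x -> 0 <= t -> 0 <= s ->
    phi x (t + s) = phi (phi x s) t ;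
  flow_increasing : forall x : R, 0 <= x ->
    {in Rplus R &, {homo phi x : s t / s < t}} ;
  flow_image : forall x : R, 0 <= x -> phi x @` Rplus R = `[x, +oo[%classic ;
  flow_C1_time : forall x : R, 0 <= x -> C1_halfline 0 (phi x) ;
  flow_inv_C1 : forall x : R, 0 <= x -> C1_halfline x (flow_inv phi x) }.

Record rate_conditions phi (lam : R -> R) : Prop := {
  rate_measurable : measurable_fun (Rplus R) lam ;
  rate_ge0 : forall x : R, 0 <= x -> 0 <= lam x ;
  rate_locally_integrable : forall x : R, 0 <= x -> exists2 e : R, 0 < e &
    (\int[lebesgue_measure]_(s in `[0%R, e]) (lam (phi x s))%:E < +oo)%E }.

Definition jump_conditions (Q : R.-pker R ~> R) :=
  forall x : R, 0 <= x -> Q x (Rplus R `\ x) = 1%E.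

Definition pdmp_conditions phi lam Q :=
  [/\ flow_conditions phi, rate_conditions phi lam & jump_conditions Q].

End flow.

Section jump_chain.
Variable R : realType.
Implicit Types (phi : R -> R -> R) (lam : R -> R) (PP Q : R.-pker R ~> R).

(* PP is the kernel P(z, dy): on z >= 0 the tail determines the probability
   measure PP z. *)
Definition prejump_kernel phi lam PP := forall z y : R, 0 <= z -> z <= y ->
  PP z `]y, +oo[%classic =
  expeR (- \int[lebesgue_measure]_(u in `[z, y])
             (lam u * flow_inv' phi z u)%:E)%E.

(* law of Z_k given Z_0 = z *)
Fixpoint postjump_law PP Q (k : nat) : R.-spker R ~> R :=
  match k with
  | 0 => kdirac (@measurable_id _ R setT)
  | k.+1 => mkcomp_noparam (mkcomp_noparam (postjump_law PP Q k) PP) Q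
  end.

(* law of (Y_k, Z_k) given Z_0 = z, for k >= 1 *)
Definition jump_law PP Q (k : nat) (z : R) : {measure set (R * R) -> \bar R} :=
  mkproduct (mkcomp_noparam (postjump_law PP Q k.-1) PP) (kernel.kernel_snd Q) z.

(* sigma(Z_0, ..., Z_k, Y_1, ..., Y_j) *)
Definition history (T : Type) (Y Z : nat -> T -> R) (k j : nat) : set (set T) :=
  <<s [set A | exists i (B : set R), measurable B /\
        ((i <= k)%N /\ A = Z i @^-1` B \/ (0 < i <= j)%N /\ A = Y i @^-1` B)] >>.

(* Y 0 plays no role. *)
Record jump_chain PP Q (z0 : R) (d : measure_display) (T : measurableType d)
    (P : probability T R) (Y Z : nat -> {RV P >-> R}) : Prop := {
  chain_start : forall w, Z 0 w = z0 ;
  chain_prejump : forall k A B, history Y Z k k A -> measurable B ->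
    P (A `&` Y k.+1 @^-1` B) = (\int[P]_(w in A) PP (Z k w) B)%E ;
  chain_postjump : forall k A B, history Y Z k k.+1 A -> measurable B ->
    P (A `&` Z k.+1 @^-1` B) = (\int[P]_(w in A) Q (Y k.+1 w) B)%E }.

End jump_chain.

Section ergodicity.
Variable R : realType.
Implicit Types (phi : R -> R -> R) (lam : R -> R) (PP Q : R.-pker R ~> R).
Implicit Types (rho : probability (R * R)%type R) (bnu mu : probability R R).

(* rho is invariant for the chain (Y_k, Z_k), whose transitions only depend on
   the second coordinate; bnu and mu are the marginals of rho. *)
Record stationary_laws PP Q rho bnu mu : Prop := {
  rho_support : rho (Rplus R `*` Rplus R) = 1%E ;
  rho_invariant : forall A : set (R * R), measurable A ->
    rho A = (\int[rho]_w jump_law PP Q 1 w.2 A)%E ;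
  rho_fst : forall B : set R, measurable B -> bnu B = rho (B `*` setT) ;
  rho_snd : forall B : set R, measurable B -> mu B = rho (setT `*` B) }.

(* Recurrence in the sense of infinite expected occupation time of every
   non-negligible set from every starting point; positivity is the existence of
   the invariant probability measure rho. *)
Definition recurrent PP Q rho := forall (z : R) (A : set (R * R)),
  0 <= z -> measurable A -> (0 < rho A)%E ->
  (\sum_(1 <= k <oo) jump_law PP Q k z A = +oo)%E.

(* convergence to equilibrium in total variation from every starting point *)
Definition strongly_ergodic PP Q rho := forall z : R, 0 <= z ->
  ereal_sup [set `|jump_law PP Q k z A - rho A|%E | A in measurable]
    @[k --> \oo] --> 0%E.

Definition exponentially_ergodic PP Q rho (V : R -> R) (gamma Rc : R) :=
  forall (z : R) (psi : R * R -> R) (k : nat), 0 <= z -> (0 < k)%N ->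
  measurable_fun setT psi ->
  (forall w : R * R, 0 <= w.1 -> 0 <= w.2 -> `|psi w| <= V w.2) ->
  (`|\int[jump_law PP Q k z]_w (psi w)%:E - \int[rho]_w (psi w)%:E|
     <= (Rc * V z * gamma ^+ k)%:E)%E.

Record ergodicity_conditions (i1 i2 : R) phi lam PP Q rho bnu mu
    (V : R -> R) (gamma Rc : R) : Prop := {
  rate_integral_lty : forall x : R, 0 <= x -> x <= i1 ->
    (\int[lebesgue_measure]_(y in `[0%R, i1])
       (lam y * flow_inv' phi x y)%:E < +oo)%E ;
  rate_bounded : has_ubound (lam @` `[i1, i2]) ;
  has_stationary_laws : stationary_laws PP Q rho bnu mu ;
  is_recurrent : recurrent PP Q rho ;
  is_strongly_ergodic : strongly_ergodic PP Q rho ;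
  V_measurable : measurable_fun setT V ;
  V_ge1 : forall z : R, 0 <= z -> 1 <= V z ;
  gamma_gt0 : 0 < gamma ;
  gamma_lt1 : gamma < 1 ;
  Rc_gt0 : 0 < Rc ;
  is_exponentially_ergodic : exponentially_ergodic PP Q rho V gamma Rc }.

Definition stationary_density (i1 i2 : R) bnu (nu : R -> R) :=
  [/\ measurable_fun setT nu, forall x : R, 0 <= nu x,
      forall x : R, x \notin `[i1, i2] -> nu x = 0 &
      forall A : set R, measurable A -> A `<=` `[i1, i2] ->
        bnu A = (\int[lebesgue_measure]_(x in A) (nu x)%:E)%E].

Definition G_lambda mu (V : R -> R) (gamma Rc z : R) : R :=
  Rc / (1 - gamma) * (V z + \int[mu]_u V u).

Definition C_lambda mu (V : R -> R) (gamma Rc : R) : R :=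
  \int[mu]_z G_lambda mu V gamma Rc z.

Definition sup_norm (T : Type) (s : T -> R) : R := sup (range (fun w => `|s w|)).

Definition variance_bound rho mu (V : R -> R) (gamma Rc c : R)
    (d : measure_display) (T : measurableType d) (P : probability T R)
    (Y Z : nat -> T -> R) :=
  forall (s : R * R -> R) (n : nat), measurable_fun setT s ->
  has_ubound (range (fun w => `|s w|)) -> (0 < n)%N ->
  (variance P (fun t => n%:R^-1 * \sum_(1 <= k < n.+1) s (Y k t, Z k t))%R <=
   (n%:R^-1 * (\int[rho]_w (s w) ^+ 2)
    + sup_norm s / n%:R * (\int[rho]_w (`|s w| * G_lambda mu V gamma Rc w.2))
    + c * sup_norm s ^+ 2 / n%:R ^+ 2)%:E)%E.

End ergodicity.

Section models.
Variables (R : realType) (i1 i2 : R).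
Implicit Types (f g s : R -> R) (S : set (R -> R)).

Definition leb_itv : {measure set (measurableTypeR R) -> \bar R} :=
  mrestr (@lebesgue_measure R) (measurable_itv `[i1, i2]).

Definition norm2 f : \bar R := 'N[leb_itv]_2%:E[EFin \o f]%E.
(* the essential supremum of |f| *)
Definition normoo f : \bar R := 'N[leb_itv]_+oo[EFin \o f]%E.
Definition inner f g : R := \int[leb_itv]_x (f x * g x).

(* Elements of L^2 are represented by functions on R that vanish outside the
   interval; a linear subspace of L^2 is the set of all representatives of its
   elements. *)
Definition L2 : set (R -> R) := [set f : R -> R | [/\ measurable_fun setT f,
  forall x : R, x \notin `[i1, i2] -> f x = 0 & (norm2 f < +oo)%E]].

Definition L2_subspace S :=
  [/\ S `<=` L2, S (fun=> 0),
      forall (a : R) f g, S f -> S g -> S (fun x => a * f x + g x) &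
      forall f g, S f -> L2 g -> {ae leb_itv, forall x, f x = g x} -> S g].

Definition orthonormal_basis S (N : nat) (b : 'I_N -> R -> R) :=
  [/\ forall l, S (b l),
      forall l l', inner (b l) (b l') = (l == l')%:R &
      forall f, S f -> exists c : 'I_N -> R,
        {ae leb_itv, forall x, f x = \sum_(l < N) c l * b l x}].

Definition orthogonal_projection S f g :=
  S g /\ forall h, S h -> inner (fun x => f x - g x) h = 0.

(* f is extended by 0, so that f(. + kh) is defined on the interval. *)
Definition modulus (r : nat) f (t : R) : \bar R :=
  ereal_sup [set norm2 (fun x => \sum_(k < r.+1)
                    (-1) ^+ k * 'C(r, k)%:R * f (x + k%:R * h))
            | h in [set h | 0 < h /\ h <= t]].

Definition besov_norm (alpha : R) f : \bar R :=
  (norm2 f + ereal_sup [set (t `^ (- alpha))%:E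
                            * modulus (Num.truncn alpha).+1 f t
                       | t in [set t : R | (0 < t)%R]])%E.

Record model_conditions (S : nat -> set (R -> R)) (D : nat -> nat)
    (b : forall m, 'I_(D m) -> R -> R) (psi1 psi2 : R) (r : nat) (C : R)
    : Prop := {
  model_subspace : forall m, L2_subspace (S m) ;
  model_increasing : forall m m', (m <= m')%N -> S m `<=` S m' ;
  psi1_gt0 : 0 < psi1 ;
  model_normoo : forall m s, S m s ->
    (normoo s ^+ 2 <= (psi1 * (D m)%:R)%:E * norm2 s ^+ 2)%E ;
  psi2_gt0 : 0 < psi2 ;
  model_basis : forall m, orthonormal_basis (S m) (b m) ;
  model_basis_normoo : forall m,
    ('N[leb_itv]_+oo[(fun x =>
          \sum_(l < D m) normoo (b m l) * `|b m l x|%:E)%E]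
       <= (psi2 * (D m)%:R)%:E)%E ;
  C_gt0 : 0 < C ;
  model_approx : forall (alpha : R) s m sm, 0 < alpha -> alpha <= r%:R ->
    L2 s -> (besov_norm alpha s < +oo)%E -> (0 < D m)%N ->
    orthogonal_projection (S m) s sm ->
    (norm2 (fun x => s x - sm x)%R
       <= (C * (D m)%:R `^ (- alpha))%:E * besov_norm alpha s)%E }.

End models.

Section estimator.
Variables (R : realType) (i1 i2 : R) (D : nat -> nat).
Variables (b : forall m, 'I_(D m) -> R -> R) (n : nat).
Implicit Types (y : nat -> R) (m : nat).

(* y k is the observed value of Y_k, for 1 <= k <= n *)
Definition nu_hat y m : R -> R := fun x =>
  \sum_(l < D m) (n%:R^-1 * \sum_(1 <= k < n.+1) b l (y k)) * b l x.

Definition contrast y (s : R -> R) : R :=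
  fine (norm2 i1 i2 s) ^+ 2 - 2 / n%:R * \sum_(1 <= k < n.+1) s (y k).

Definition pen (sigma sigma' : R) m : R :=
  sigma * (D m)%:R / n%:R + sigma' / n%:R.

Definition collection : set nat := [set m | (D m ^ 2 <= n)%N].

Definition is_argmin (sigma sigma' : R) y (mhat : nat) :=
  collection mhat /\ forall m, collection m ->
    contrast y (nu_hat y mhat) + pen sigma sigma' mhat <=
    contrast y (nu_hat y m) + pen sigma sigma' m.

End estimator.

(* Main.v *)
(** The contrast of a projection estimator is minus its squared norm. Since the
    models are nested, the minimality of mhat gives, pointwise,
      |nu - hat nu_mhat|^2 <= 3 |nu_m - nu|^2 + 2 pen m - 2 pen mhat + 8 X_M
    with M = max (m, mhat), where X_M is the squared norm of the centered
    empirical coefficients on S_M. As X_M only depends on the dimension D_M, it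
    remains to sum over the dimensions the bound
      E (X_M - 12 A D_M / n)_+ <= C / (n D_M^2),  A = psi1 + C_lambda psi2.

    For this concentration inequality, the observations are cut into blocks of
    length q of order n^(1/4), split into two classes so that the chain mixes
    between two blocks of a class. With S the partial sum over a class, the
    exponential moment of theta sqrt (|S|^2 + c) is bounded block after block by
    a second order expansion. Its coefficients are the trace of the stationary
    covariances, of order A D, and their operator norm, of smaller order because
    a unit vector s of S_M has integral at most |nu| under nu. Blocks preceded
    by a state where V is large are discarded by Markov's inequality. *)

Require Import Defs.
From HB Require Import structures.
From mathcomp Require Import all_boot all_order all_algebra.
From mathcomp Require Import all_classical all_reals all_analysis.
From mathcomp Require Import measurable_realfun ess_sup_inf ring lra zify.

Set Implicit Arguments.
Unset Strict Implicit.
Unset Printing Implicit Defensive.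

Import Order.TTheory GRing.Theory Num.Theory.
Import numFieldNormedType.Exports.

Local Open Scope classical_set_scope.
Local Open Scope ring_scope.

(** * Integration and disintegration *)

(** Two obstacles shape the proof. First, [c'] may depend on [V] but not on the stationary law,
    hence not on the stationary mean of [V], although [C_lambda] contains it. All estimates are
    therefore uniform in this mean: if it is large compared with [n], the threshold exceeds every
    possible value of the deviation; otherwise it costs one power of [n], paid by mixing, and it
    also enlarges the exponent. Second, the bases are known up to null sets, while the estimator
    evaluates them at the observations: the law of [Y_k] from a fixed starting point has to be
    dominated by Lebesgue measure on the interval, so that one common null set can be avoided.
    Origin of 48 and 4: in one class of blocks the squared norm has mean at most about [n A D] and
    is cut at [3 n A D]; the two classes give [2 (3 + 3) n A D / n^2 = 12 A D / n]. Then
    [8 * 12 = 2 * 48] is worth two penalties, which either cancel [- 2 pen mhat] or turn [2 pen m]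
    into [4 pen m]. Dimensions are summed rather than models because infinitely many models may
    share a dimension. *)

Section disintegration.
Context d d' (X : measurableType d) (Y : measurableType d') (R : realType).
Variables (l : {measure set X -> \bar R}) (k : X -> {measure set Y -> \bar R}).
Variable m : {measure set Y -> \bar R}.
Hypothesis mk : forall U : set Y, measurable U -> measurable_fun [set: X] (k ^~ U).
Hypothesis mE : (forall U : set Y, measurable U -> m U = \int[l]_x k x U)%E.
Local Open Scope ereal_scope.

Import HBNNSimple.

Let disintegration_nnsfun (f : {nnsfun Y >-> R}) :
  \int[m]_z (f z)%:E = \int[l]_x (\int[k x]_z (f z)%:E).
Proof.
under [in LHS]eq_integral do rewrite fimfunE -fsumEFin//.
rewrite ge0_integral_fsum//; last 2 first.
  - by move=> r; exact/measurable_EFinP/measurableT_comp.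
  - by move=> r z _; rewrite EFinM nnfun_muleindic_ge0.
under [in RHS]eq_integral.
  move=> y _.
  under eq_integral.
    by move=> z _; rewrite fimfunE -fsumEFin//; over.
  rewrite /= ge0_integral_fsum//; last 2 first.
    - by move=> r; exact/measurable_EFinP/measurableT_comp.
    - by move=> r z _; rewrite EFinM nnfun_muleindic_ge0.
  under eq_fsbigr.
    move=> r _.
    rewrite (integralZl_indic _ (fun r => f @^-1` [set r]))//; last first.
      by move=> r0; rewrite preimage_nnfun0.
    rewrite integral_indic// setIT.
    over.
  over.
rewrite /= ge0_integral_fsum//; last 2 first.
  - by move=> r; apply: measurable_funeM; exact: mk.
  - move=> n y _.
    have := mulemu_ge0 (fun n => f @^-1` [set n]).
    by apply; exact: preimage_nnfun0.
apply: eq_fsbigr => r _.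
rewrite (integralZl_indic _ (fun r => f @^-1` [set r]))//; last first.
  exact: preimage_nnfun0.
rewrite /= integral_indic// setIT mE//.
have [r0|r0] := leP 0%R r.
  by rewrite ge0_integralZl//; exact: mk.
rewrite integral0_eq ?mule0.
  by rewrite integral0_eq// => y _; rewrite preimage_nnfun0// measure0 mule0.
by move=> y _; rewrite preimage_nnfun0// measure0.
Qed.

Lemma ge0_integral_disintegration (f : Y -> \bar R) :
  measurable_fun setT f -> (forall y, 0 <= f y) ->
  \int[m]_y f y = \int[l]_x (\int[k x]_y f y).
Proof.
move=> mf f0.
pose f_ := nnsfun_approx measurableT mf.
transitivity (\int[m]_z (lim ((f_ n z)%:E @[n --> \oo]))).
  by apply/eq_integral => z _; apply/esym/cvg_lim => //=; exact: cvg_nnsfun_approx.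
rewrite monotone_convergence//; last 3 first.
  by move=> n; exact/measurable_EFinP.
  by move=> n z _; rewrite lee_fin.
  by move=> z _ a b ab; rewrite lee_fin; exact/lefP/nd_nnsfun_approx.
rewrite (_ : (fun _ => _) =
    (fun n => \int[l]_y (\int[k y]_z (f_ n z)%:E)))//; last first.
  by apply/funext => n; rewrite disintegration_nnsfun.
transitivity (\int[l]_y lim ((\int[k y]_z (f_ n z)%:E) @[n --> \oo])).
  rewrite -monotone_convergence//; last 3 first.
  - move=> n; apply: measurable_fun_integral_kernel => //.
    + by move=> z; rewrite lee_fin.
    + exact/measurable_EFinP.
  - by move=> n y _; apply: integral_ge0 => // z _; rewrite lee_fin.
  - move=> y _ a b ab; apply: ge0_le_integral => //.
    + by move=> z _; rewrite lee_fin.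
    + exact/measurable_EFinP.
    + exact/measurable_EFinP.
    + by move=> z _; rewrite lee_fin; exact/lefP/nd_nnsfun_approx.
apply: eq_integral => y _; rewrite -monotone_convergence//; last 3 first.
  - by move=> n; exact/measurable_EFinP.
  - by move=> n z _; rewrite lee_fin.
  - by move=> z _ a b ab; rewrite lee_fin; exact/lefP/nd_nnsfun_approx.
by apply: eq_integral => z _; apply/cvg_lim => //; exact: cvg_nnsfun_approx.
Qed.

End disintegration.

Section restriction_density.
Context d (X : measurableType d) (R : realType).
Variable m : {measure set X -> \bar R}.
Local Open Scope ereal_scope.

(** [m'] is the mixture under [m] of the Dirac masses at [phi x] with weights [f x], so this is a
    disintegration. The map [phi] lets one formula serve for densities, for restrictions and for the
    passage to a coarser sigma-algebra. *)
Lemma ge0_integral_density d' (Y : measurableType d') (phi : X -> Y)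
    (m' : {measure set Y -> \bar R}) (f : X -> R) (g : Y -> \bar R) :
  measurable_fun setT phi -> measurable_fun setT f -> (forall x, 0 <= f x)%R ->
  (forall A, measurable A ->
    m' A = \int[m]_x ((f x)%:E * (\1_A (phi x))%:E)) ->
  measurable_fun setT g -> (forall y, 0 <= g y) ->
  \int[m']_y g y = \int[m]_x ((f x)%:E * g (phi x)).
Proof.
move=> mphi mf f0 m'E mg g0.
pose k x : {measure set Y -> \bar R} := mscale (NngNum (f0 x)) (dirac (phi x)).
rewrite (@ge0_integral_disintegration _ _ _ _ _ m k m') //; last first.
  move=> U mU; rewrite /k /mscale/=.
  apply: emeasurable_funM; first exact/measurable_EFinP.
  by under eq_fun do rewrite /dirac; apply/measurable_EFinP; apply: measurableT_comp.
by apply: eq_integral => x _; rewrite ge0_integral_mscale//= integral_dirac// diracT mul1e.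
Qed.

Lemma ge0_integral_mrestr (D : set X) (mD : measurable D) (g : X -> \bar R) :
  measurable_fun setT g -> (forall y, 0 <= g y) ->
  \int[mrestr m mD]_y g y = \int[m]_(x in D) g x.
Proof.
move=> mg g0.
rewrite (@ge0_integral_density _ _ id (mrestr m mD) (\1_D) g) //.
  rewrite [RHS]integral_mkcond; apply: eq_integral => x _.
  by rewrite patchE indicE; case: ifPn => _; rewrite ?mul1e ?mul0e.
move=> A mA; transitivity (m (A `&` D)) => //.
rewrite -[A `&` D]setIT.
rewrite -(integral_indic m measurableT); last exact: measurableI.
by apply: eq_integral => x _; rewrite -EFinM indicI mulrC.
Qed.

End restriction_density.
Section weighted_measure.
Context d (X : measurableType d) (R : realType).
Variables (m : {measure set X -> \bar R}) (f : X -> R).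
Hypotheses (mf : measurable_fun setT f) (f0 : forall x, 0 <= f x).
Local Open Scope ereal_scope.

(** The two proofs are arguments so that the measure structure can be inferred from the term alone,
    as in [weighted P mFT F0]. *)
Definition weighted (_ : measurable_fun setT f) (_ : forall x, (0 <= f x)%R)
  (A : set X) : \bar R := \int[m]_(x in A) (f x)%:E.

Let weighted0 : weighted mf f0 set0 = 0.
Proof. by rewrite /weighted integral_set0. Qed.

Let weighted_ge0 A : 0 <= weighted mf f0 A.
Proof. by apply: integral_ge0 => x _; rewrite lee_fin. Qed.

Let weighted_sigma_additive : semi_sigma_additive (weighted mf f0).
Proof.
move=> F mF tF mUF; rewrite [X in _ --> X]/weighted ge0_integral_bigcup//.
- apply: is_cvg_ereal_nneg_natsum => n _ /=.
  by apply: integral_ge0 => x _; rewrite lee_fin.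
- exact/measurable_EFinP/measurable_funTS.
- by move=> x _; rewrite lee_fin.
Qed.

HB.instance Definition _ := isMeasure.Build _ _ _ (weighted mf f0)
  weighted0 weighted_ge0 weighted_sigma_additive.

Lemma ge0_integral_weighted (g : X -> \bar R) :
  measurable_fun setT g -> (forall x, 0 <= g x) ->
  \int[weighted mf f0]_x g x = \int[m]_x ((f x)%:E * g x).
Proof.
move=> mg g0; apply: (@ge0_integral_density _ _ _ _ _ _ id) => // A mA.
transitivity (\int[m]_(x in A) (f x)%:E) => //.
rewrite [LHS]integral_mkcond; apply: eq_integral => x _.
by rewrite patchE indicE; case: ifPn => _; rewrite ?mule1 ?mule0.
Qed.

End weighted_measure.

(** * Bounded measurable functions *)

Section bounded_measurable.
Context d (X : measurableType d) (R : realType).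
Implicit Types f g : X -> R.

(** Such functions are integrable for every finite measure and stable under all the operations
    below, so one predicate discharges the integrability conditions. Only [V] escapes it and is
    treated by [integrable]. *)
Definition bmeas f := measurable_fun setT f /\ exists M, forall x, `|f x| <= M.

Lemma bmeas_cst c : bmeas (cst c).
Proof. by split; [exact: measurable_cst | exists `|c| => x]. Qed.

Lemma bmeasD f g : bmeas f -> bmeas g -> bmeas (fun x => f x + g x).
Proof.
move=> [mf [M fM]] [mg [N gN]]; split; first exact: measurable_funD.
by exists (M + N) => x; rewrite (le_trans (ler_normD _ _))// lerD.
Qed.

Lemma bmeasM f g : bmeas f -> bmeas g -> bmeas (fun x => f x * g x).
Proof.
move=> [mf [M fM]] [mg [N gN]]; split; first exact: measurable_funM.
by exists (M * N) => x; rewrite normrM ler_pM.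
Qed.

Lemma bmeasZ c f : bmeas f -> bmeas (fun x => c * f x).
Proof. by move=> bf; apply: bmeasM => //; exact: bmeas_cst. Qed.

Lemma bmeasN f : bmeas f -> bmeas (fun x => - f x).
Proof.
by move=> [mf [M fM]]; split; [exact: measurableT_comp | exists M => x; rewrite normrN].
Qed.

Lemma bmeasB f g : bmeas f -> bmeas g -> bmeas (fun x => f x - g x).
Proof. by move=> bf bg; apply: bmeasD => //; exact: bmeasN. Qed.

Lemma bmeas_sum (I : Type) (r : seq I) (F : I -> X -> R) :
  (forall i, bmeas (F i)) -> bmeas (fun x => \sum_(i <- r) F i x).
Proof.
move=> bF; elim: r => [|i r ih].
  by under eq_fun do rewrite big_nil; exact: bmeas_cst.
by under eq_fun do rewrite big_cons; exact: bmeasD.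
Qed.

Lemma bmeas_indic A : measurable A -> bmeas (\1_A : X -> R).
Proof.
move=> mA; split; first exact: measurable_indic.
by exists 1 => x; rewrite indicE; case: (_ \in _); rewrite ?normr1 ?normr0.
Qed.

Lemma bmeas_norm f : bmeas f -> bmeas (fun x => `|f x|).
Proof.
move=> [mf [M fM]]; split; first exact: measurableT_comp.
by exists M => x; rewrite normr_id.
Qed.

Lemma bmeas_expR f : bmeas f -> bmeas (fun x => expR (f x)).
Proof.
move=> [mf [M fM]]; split; first exact: measurableT_comp.
exists (expR M) => x; rewrite ger0_norm ?expR_ge0// ler_expR.
by rewrite (le_trans (ler_norm _)).
Qed.

Lemma bmeas_sqrt f : bmeas f -> bmeas (fun x => Num.sqrt (f x)).
Proof.
move=> [mf [M fM]]; split.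
  by apply: measurableT_comp => //; apply: continuous_measurable_fun => ?; exact: sqrt_continuous.
exists (Num.sqrt M) => x; rewrite ger0_norm ?sqrtr_ge0// ler_wsqrtr//.
by rewrite (le_trans (ler_norm _)).
Qed.

Section integral.
Variable m : {measure set X -> \bar R}.
Hypothesis finm : (m setT < +oo)%E.

Lemma bmeas_integrable f : bmeas f -> m.-integrable setT (EFin \o f).
Proof.
move=> [mf [M fM]]; apply: measurable_bounded_integrable => //.
exists M; split; first exact: num_real.
by move=> x Mx y _ /=; rewrite (le_trans (fM y))// ltW.
Qed.

End integral.
End bounded_measurable.
Arguments bmeas_cst {d X R}.
#[global] Hint Extern 0 (bmeas _) => solve [exact: bmeas_cst] : core.

(** * Conditional laws given a sub-sigma-algebra *)

Section sub_sigma_algebra.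
Context d (T : measurableType d) (R : realType) (G : set (set T)).
Hypothesis Gm : <<s G>> `<=` @measurable _ T.
Let TG := g_sigma_algebraType G.

Lemma sub_measurable_fun d' (Y : measurableType d') (f : T -> Y) :
  measurable_fun (setT : set TG) f -> measurable_fun (setT : set T) f.
Proof. by move=> mf _ B mB; apply: Gm; exact: mf. Qed.

Lemma sub_bmeas (f : T -> R) : @bmeas _ TG R f -> @bmeas _ T R f.
Proof. by move=> [mf bf]; split => //; exact: sub_measurable_fun. Qed.

End sub_sigma_algebra.

Section conditional_law.
Context d (T : measurableType d) (R : realType) (P : probability T R).
Variables (G : set (set T)) (K : R.-pker R ~> R) (U W : T -> R).
Hypotheses (Gm : <<s G>> `<=` @measurable _ T).
Hypotheses (mU : measurable_fun setT U) (mW : measurable_fun setT W).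
Hypothesis UW : (forall A B, <<s G>> A -> measurable B ->
  P (A `&` W @^-1` B) = \int[P]_(w in A) K (U w) B)%E.
Let TG := g_sigma_algebraType G.

Let mK B : measurable B -> measurable_fun setT (fun w => K (U w) B).
Proof. by move=> mB; exact: measurableT_comp (measurable_kernel K _ mB) mU. Qed.

Let K_fin u B : measurable B -> K u B \is a fin_num.
Proof.
move=> mB; rewrite ge0_fin_numE//; apply: (@le_lt_trans _ _ (K u setT)).
  by apply: le_measure => //; rewrite inE.
by rewrite prob_kernel ltry.
Qed.

Lemma ge0_conditional_law (F : T -> R) (h : R -> \bar R) :
  measurable_fun (setT : set TG) F -> (forall w, 0 <= F w) ->
  measurable_fun setT h -> (forall x, 0 <= h x)%E ->
  (\int[P]_w ((F w)%:E * h (W w)) =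
   \int[P]_w ((F w)%:E * \int[K (U w)]_y h y))%E.
Proof.
move=> mF F0 mh h0.
have mFT : measurable_fun (setT : set T) F by exact: sub_measurable_fun mF.
have mi : measurable_fun (setT : set T) (id : T -> TG).
  by move=> _ B mB; rewrite setTI; exact: Gm.
transitivity (\int[weighted P mFT F0]_w h (W w))%E.
  rewrite ge0_integral_weighted//; exact: measurableT_comp.
transitivity (\int[weighted P mFT F0]_w \int[K (U w)]_y h y)%E; last first.
  rewrite ge0_integral_weighted//.
    by apply: measurable_fun_integral_kernel => //.
  by move=> w; apply: integral_ge0.
transitivity (\int[pushforward (weighted P mFT F0) W]_y h y)%E.
  by rewrite ge0_integral_pushforward//= ?preimage_setT//.
apply: (ge0_integral_disintegration (k := fun w => K (U w))) => // B mB.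
have mWB : measurable (W @^-1` B) by rewrite -[X in measurable X]setTI; exact: mW.
transitivity (\int[mrestr P mWB]_w (F w)%:E)%E.
  by rewrite ge0_integral_mrestr//; exact/measurable_EFinP.
rewrite ge0_integral_weighted//; last exact: mK.
have mFE : measurable_fun (setT : set TG) (EFin \o F) by exact/measurable_EFinP.
(* The identity onto [TG] restricts the measure to the coarser sigma-algebra, where alone [UW]
   describes it. *)
transitivity (\int[pushforward (mrestr P mWB) (id : T -> TG)]_w (F w)%:E)%E.
  rewrite ge0_integral_pushforward//= ?preimage_setT//.
  by move=> x _; rewrite lee_fin.
have K0 w : 0 <= fine (K (U w) B) by rewrite fine_ge0.
rewrite (ge0_integral_density (m := P) mi _ K0 _ mFE)//.
- by apply: eq_integral => w _; rewrite fineK ?K_fin// muleC.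
- by apply: measurableT_comp => //; exact: mK.
- move=> A mA; transitivity (P (A `&` W @^-1` B)) => //.
  rewrite UW// [LHS]integral_mkcond; apply: eq_integral => w _.
  rewrite patchE indicE fineK ?K_fin//.
  by case: ifPn => _; rewrite ?mule1 ?mule0.
Qed.

End conditional_law.
Section Rintegral_bounded.
Context d (X : measurableType d) (R : realType) (m : {measure set X -> \bar R}).
Hypothesis finm : (m setT < +oo)%E.
Implicit Types f g : X -> R.

Lemma bRintegralD f g : bmeas f -> bmeas g ->
  \int[m]_x (f x + g x) = \int[m]_x f x + \int[m]_x g x.
Proof. by move=> bf bg; rewrite RintegralD//; exact: bmeas_integrable. Qed.

Lemma bRintegralB f g : bmeas f -> bmeas g ->
  \int[m]_x (f x - g x) = \int[m]_x f x - \int[m]_x g x.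
Proof. by move=> bf bg; rewrite RintegralB//; exact: bmeas_integrable. Qed.

Lemma bRintegralZ c f : bmeas f -> \int[m]_x (c * f x) = c * \int[m]_x f x.
Proof. by move=> bf; rewrite RintegralZl//; exact: bmeas_integrable. Qed.

Lemma bRintegral_sum (I : Type) (r : seq I) (F : I -> X -> R) :
  (forall i, bmeas (F i)) ->
  \int[m]_x (\sum_(i <- r) F i x) = \sum_(i <- r) \int[m]_x F i x.
Proof.
move=> bF; elim: r => [|i r ih].
  by under eq_Rintegral do rewrite big_nil; rewrite big_nil Rintegral_cst ?mul0r.
under eq_Rintegral do rewrite big_cons.
by rewrite big_cons bRintegralD ?ih//; exact: bmeas_sum.
Qed.

Lemma le_bRintegral f g : bmeas f -> bmeas g -> (forall x, f x <= g x) ->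
  \int[m]_x f x <= \int[m]_x g x.
Proof. by move=> bf bg fg; apply: le_Rintegral => //; exact: bmeas_integrable. Qed.

Lemma bRintegral_norm f : bmeas f -> `|\int[m]_x f x| <= \int[m]_x `|f x|.
Proof. by move=> bf; apply: le_normr_Rintegral => //; exact: bmeas_integrable. Qed.

Lemma bRintegral_EFin f : bmeas f -> ((\int[m]_x f x)%:E = \int[m]_x (f x)%:E)%E.
Proof.
move=> bf; rewrite /Rintegral fineK//; apply: integrable_fin_num => //.
exact: bmeas_integrable.
Qed.

End Rintegral_bounded.

Lemma probability_lty d (X : measurableType d) (R : realType)
  (P : probability X R) : (P setT < +oo)%E.
Proof. by rewrite (le_lt_trans (probability_le1 P measurableT)) ?ltry. Qed.
#[global] Hint Extern 0 (is_true (_ [set: _] < +oo)%E) =>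
  solve [exact: probability_lty] : core.

Lemma pkernel_lty d d' (X : measurableType d) (Y : measurableType d')
  (R : realType) (K : R.-pker X ~> Y) x : (K x setT < +oo)%E.
Proof. by rewrite prob_kernel ltry. Qed.

Lemma bRintegral_cst d (X : measurableType d) (R : realType)
  (P : probability X R) c : \int[P]_x c = c.
Proof.
rewrite Rintegral_cst// -[RHS]mulr1; congr (_ * _).
by rewrite -[RHS]/(fine (1%E : \bar R)); congr fine; exact: probability_setT.
Qed.

Section kernel_Rintegral.
Context d d' (X : measurableType d) (Y : measurableType d') (R : realType).
Variable K : X -> {measure set Y -> \bar R}.
Hypothesis mK : forall B : set Y, measurable B -> measurable_fun [set: X] (K ^~ B).
Hypothesis K1 : forall x, (K x setT <= 1)%E.

Let finK x : (K x setT < +oo)%E.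
Proof. by rewrite (le_lt_trans (K1 x)) ?ltry. Qed.

Lemma kernel_Rintegral_le (h : Y -> R) M x : measurable_fun setT h ->
  (forall y, `|h y| <= M) -> `|\int[K x]_y h y| <= M.
Proof.
move=> mh hM; have M0 : 0 <= M by rewrite (le_trans _ (hM point)).
have bh : bmeas h by split => //; exists M.
rewrite (le_trans (bRintegral_norm (finK x) bh))//.
rewrite (le_trans (le_bRintegral (finK x) (bmeas_norm bh) (bmeas_cst M) hM))//.
rewrite Rintegral_cst// ler_piMr// -(@lee_fin R) fineK//.
by rewrite ge0_fin_numE.
Qed.

Lemma bmeas_kernel_Rintegral (h : Y -> R) : bmeas h ->
  bmeas (fun x => \int[K x]_y h y).
Proof.
move=> bh; have [mh [M hM]] := bh; split; last first.
  by exists M => x; exact: kernel_Rintegral_le.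
have -> : (fun x => \int[K x]_y h y) =
    (fun x => fine (\int[K x]_y (h y + M)%:E) - M * fine (K x setT)).
  have bhM : bmeas (fun y => h y + M) by exact: (bmeasD bh (bmeas_cst M)).
  apply/funext => x; rewrite -(bRintegral_EFin (finK x))//.
  by rewrite (bRintegralD (finK x) bh (bmeas_cst M)) Rintegral_cst// addrK.
apply: measurable_funB; last first.
  by apply: measurable_funM => //; apply: measurableT_comp => //; exact: mK.
apply: measurableT_comp => //; apply: measurable_fun_integral_kernel => //.
- by move=> y; rewrite lee_fin -lerBlDr sub0r lerNl (le_trans (ler_norm _))// normrN.
- by apply/measurable_EFinP; exact: measurable_funD.
Qed.

End kernel_Rintegral.

Section conditional_law_bounded.
Context d (T : measurableType d) (R : realType) (P : probability T R).
Variables (G : set (set T)) (K : R.-pker R ~> R) (U W : T -> R).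
Hypotheses (Gm : <<s G>> `<=` @measurable _ T).
Hypotheses (mU : measurable_fun setT U) (mW : measurable_fun setT W).
Hypothesis UW : (forall A B, <<s G>> A -> measurable B ->
  P (A `&` W @^-1` B) = \int[P]_(w in A) K (U w) B)%E.
Let TG := g_sigma_algebraType G.

Let K1 u : (K u setT <= 1)%E. Proof. by rewrite prob_kernel lexx. Qed.

Let bK (h : R -> R) : bmeas h -> bmeas (fun w => \int[K (U w)]_y h y).
Proof.
move=> bh; have [mk [M kM]] := @bmeas_kernel_Rintegral _ _ _ _ _ _ (measurable_kernel K) K1 _ bh.
by split; [exact: measurableT_comp mk mU | exists M => w; exact: kM].
Qed.

Let bW (h : R -> R) : bmeas h -> bmeas (fun w => h (W w)).
Proof.
by move=> [mh [M hM]]; split; [exact: measurableT_comp | exists M => w; exact: hM].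
Qed.

Let ge0_conditional_law_bounded F (h : R -> R) : @bmeas _ TG R F -> bmeas h ->
  (forall w, 0 <= F w) -> (forall x, 0 <= h x) ->
  \int[P]_w (F w * h (W w)) = \int[P]_w (F w * \int[K (U w)]_y h y).
Proof.
move=> bF bh F0 h0; have bFT := sub_bmeas Gm bF.
apply: EFin_inj; rewrite !bRintegral_EFin//; last 2 first.
  by apply: bmeasM => //; exact: bK.
  by apply: bmeasM => //; exact: bW.
under eq_integral do rewrite EFinM.
have mh : measurable_fun setT (EFin \o h) by apply/measurable_EFinP; case: bh.
have h0' x : (0 <= (EFin \o h) x)%E by rewrite lee_fin.
rewrite (ge0_conditional_law Gm mU mW UW bF.1 F0 mh h0').
apply: eq_integral => w _; rewrite EFinM bRintegral_EFin//.
exact: pkernel_lty.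
Qed.

(** Signs are removed by adding constants, first to [h] with [F] nonnegative, then to [F]; the
    identity for the constant is subtracted afterwards. *)
Lemma conditional_law F (h : R -> R) : @bmeas _ TG R F -> bmeas h ->
  \int[P]_w (F w * h (W w)) = \int[P]_w (F w * \int[K (U w)]_y h y).
Proof.
have shift (f : T -> R) (M : R) : (forall x : T, `|f x| <= M) -> forall x, 0 <= f x + M.
  by move=> fM x; rewrite -lerBlDr sub0r lerNl (le_trans (ler_norm _))// normrN.
have ge0 F' : @bmeas _ TG R F' -> (forall w, 0 <= F' w) -> bmeas h ->
    \int[P]_w (F' w * h (W w)) = \int[P]_w (F' w * \int[K (U w)]_y h y).
  move=> bF F0 bh; have [_ [M hM]] := bh; have bFT := sub_bmeas Gm bF.
  have hM0 x : 0 <= h x + M.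
    by rewrite -lerBlDr sub0r lerNl (le_trans (ler_norm _))// normrN.
  have := ge0_conditional_law_bounded bF (bmeasD bh (bmeas_cst M)) F0 hM0.
  under eq_Rintegral do rewrite mulrDr.
  rewrite bRintegralD//=; last 2 first.
    by apply: bmeasM => //; exact: bW.
    by apply: bmeasM => //.
  under [X in _ = X -> _]eq_Rintegral => w _.
    rewrite bRintegralD//; last exact: pkernel_lty.
    rewrite Rintegral_cst// prob_kernel mulr1 mulrDr; over.
  rewrite bRintegralD//; last 2 first.
    by apply: bmeasM => //; exact: bK.
    by apply: bmeasM => //.
  exact: addIr.
move=> bF bh; have [_ [M FM]] := bF; have bFT := sub_bmeas Gm bF.
have M0 : 0 <= M by rewrite (le_trans _ (FM point)).
have e := ge0 (fun=> M) (bmeas_cst _) (fun=> M0) bh.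
have := ge0 _ (bmeasD bF (bmeas_cst M)) (shift _ _ FM) bh.
under eq_Rintegral do rewrite mulrDl.
under [X in _ = X -> _]eq_Rintegral do rewrite mulrDl.
rewrite !bRintegralD//; try by do ?[apply: bmeasM => //|exact: bW|exact: bK].
by rewrite /= e; exact: addIr.
Qed.

End conditional_law_bounded.

(** * The jump chain *)

Section disintegration_bounded.
Context d d' (X : measurableType d) (Y : measurableType d') (R : realType).
Variables (l : {measure set X -> \bar R}) (k : X -> {measure set Y -> \bar R}).
Variable m : {measure set Y -> \bar R}.
Hypothesis mk : forall U : set Y, measurable U -> measurable_fun [set: X] (k ^~ U).
Hypothesis k1 : forall x, (k x setT <= 1)%E.
Hypothesis l1 : (l setT <= 1)%E.
Hypothesis mE : (forall U : set Y, measurable U -> m U = \int[l]_x k x U)%E.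

Let finl : (l setT < +oo)%E. Proof. by rewrite (le_lt_trans l1) ?ltry. Qed.

Let fink x : (k x setT < +oo)%E.
Proof. by rewrite (le_lt_trans (k1 x)) ?ltry. Qed.

Lemma disintegration_le1 : (m setT <= 1)%E.
Proof.
rewrite mE//; apply: le_trans l1; rewrite -[leRHS]mul1e -integral_cst//.
by apply: ge0_le_integral => //; exact: mk.
Qed.

Let finm : (m setT < +oo)%E.
Proof. by rewrite (le_lt_trans disintegration_le1) ?ltry. Qed.

Let ge0_bRintegral_disintegration f : bmeas f -> (forall y, 0 <= f y) ->
  \int[m]_y f y = \int[l]_x \int[k x]_y f y.
Proof.
move=> bf f0; apply: EFin_inj; rewrite !bRintegral_EFin//; last first.
  exact: bmeas_kernel_Rintegral.
rewrite (ge0_integral_disintegration mk mE)//.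
- by apply: eq_integral => x _; rewrite bRintegral_EFin.
- by apply/measurable_EFinP; case: bf.
Qed.

Lemma bRintegral_disintegration f : bmeas f ->
  \int[m]_y f y = \int[l]_x \int[k x]_y f y.
Proof.
move=> bf; have [_ [M fM]] := bf; have M0 : 0 <= M by rewrite (le_trans _ (fM point)).
have := @ge0_bRintegral_disintegration (fun=> M) (bmeas_cst _) (fun=> M0).
have fM0 y : 0 <= f y + M.
  by rewrite -lerBlDr sub0r lerNl (le_trans (ler_norm _))// normrN.
have := ge0_bRintegral_disintegration (bmeasD bf (bmeas_cst M)) fM0.
rewrite bRintegralD//; under [X in _ = X -> _]eq_Rintegral do rewrite bRintegralD//.
rewrite bRintegralD//; try exact: bmeas_kernel_Rintegral.
by move=> + e; rewrite /= e; exact: addIr.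
Qed.

End disintegration_bounded.

Section chain_kernels.
Context (R : realType).
Implicit Types (PP Q : R.-pker R ~> R) (f a h : R -> R).

Lemma spkernel_le1 (K : R.-spker R ~> R) x : (K x setT <= 1)%E.
Proof. exact: sprob_kernel_le1. Qed.

Lemma bRintegral_mkcomp (K L : R.-spker R ~> R) z h : bmeas h ->
  \int[mkcomp_noparam K L z]_y h y = \int[K z]_x \int[L x]_y h y.
Proof.
apply: bRintegral_disintegration => //.
- by move=> U mU; exact: measurable_kernel.
- by move=> x; exact: spkernel_le1.
- exact: spkernel_le1.
Qed.

Definition kint (K : R.-spker R ~> R) h z := \int[K z]_y h y.

Lemma bmeas_kint (K : R.-spker R ~> R) h : bmeas h -> bmeas (kint K h).
Proof.
apply: bmeas_kernel_Rintegral; last by move=> x; exact: spkernel_le1.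
by move=> U mU; exact: measurable_kernel.
Qed.

Lemma bmeas_pkint (K : R.-pker R ~> R) h : bmeas h ->
  bmeas (fun z => \int[K z]_y h y).
Proof. exact: bmeas_kint. Qed.

Lemma bmeas_fst d1 d2 (X1 : measurableType d1) (X2 : measurableType d2) (h : X1 -> R) :
  bmeas h -> bmeas (fun w : X1 * X2 => h w.1).
Proof.
by move=> [mh [M hM]]; split; [exact: measurableT_comp | exists M => w; exact: hM].
Qed.

Lemma bmeas_snd d1 d2 (X1 : measurableType d1) (X2 : measurableType d2) (h : X2 -> R) :
  bmeas h -> bmeas (fun w : X1 * X2 => h w.2).
Proof.
by move=> [mh [M hM]]; split; [exact: measurableT_comp | exists M => w; exact: hM].
Qed.

Let jump_section Q (U : set (R * R)) z y : measurable U ->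
  pushforward (Q y) (pair y) U =
  kernel.intker_indic (kernel.kernel_snd Q) U (z : R, y).
Proof.
move=> mU; rewrite kernel.intker_indicE//.
by transitivity (Q y (pair y @^-1` U)) => //; rewrite xsectionE.
Qed.

(** The product kernel is read as the mixture over [y] of the laws of [(y, u)] with [u] distributed
    as [Q y]. Product functions suffice for all later uses. *)
Lemma bRintegral_jump_law PP Q (i : nat) z f a : bmeas f -> bmeas a ->
  \int[jump_law PP Q i z]_w (f w.1 * a w.2) =
  \int[postjump_law PP Q i.-1 z]_x \int[PP x]_y (f y * \int[Q y]_u a u).
Proof.
move=> bf ba; pose mpair (y : R) := pair1_measurable y : measurable_fun setT (pair y : R -> R * R).
have bfa := bmeasM bf (bmeas_pkint Q ba).
have bfa2 : bmeas (fun w : R * R => f w.1 * a w.2).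
  by apply: bmeasM; [exact: bmeas_fst | exact: bmeas_snd].
rewrite -bRintegral_mkcomp//.
rewrite (@bRintegral_disintegration _ _ _ _ _
  (mkcomp_noparam (postjump_law PP Q i.-1) PP z)
  (fun y => pushforward (Q y) (pair y : R -> R * R)) (jump_law PP Q i z)).
- apply: eq_Rintegral => y _; rewrite -bRintegralZ//; last exact: pkernel_lty.
  congr fine; rewrite integral_pushforward//.
    by apply/measurable_EFinP; case: bfa2.
  rewrite preimage_setT.
  exact: (bmeas_integrable (pkernel_lty Q y) (bmeasZ (f y) ba)).
- move=> U mU; rewrite [X in measurable_fun _ X](_ : _ = fun x =>
      kernel.intker_indic (kernel.kernel_snd Q) U (0 : R, x)); last first.
    by apply/funext => x; exact: jump_section.
  apply: (measurableT_comp (f := kernel.intker_indic (kernel.kernel_snd Q) U)).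
    exact: kernel.measurable_intker_indic.
  exact: pair1_measurable.
- by move=> x; exact: (spkernel_le1 Q x).
- exact: spkernel_le1.
- move=> U mU; transitivity (\int[mkcomp_noparam (postjump_law PP Q i.-1) PP z]_y
    kernel.intker_indic (kernel.kernel_snd Q) U (z, y))%E => //.
  by apply: eq_integral => y _; rewrite -(jump_section Q z y mU).
- exact: bfa2.
Qed.

End chain_kernels.

Section history.
Context (R : realType) (d : measure_display) (T : measurableType d).
Variables (P : probability T R) (Y Z : nat -> {RV P >-> R}).

(** The generating class of [history], named so that [g_sigma_algebraType] can turn the past of the
    chain into a measurable type. *)
Definition history_gen (k j : nat) : set (set T) :=
  [set A | exists i (B : set R), measurable B /\
    ((i <= k)%N /\ A = Z i @^-1` B \/ (0 < i <= j)%N /\ A = Y i @^-1` B)].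

Local Notation TH k j := (g_sigma_algebraType (history_gen k j)).

Lemma history_measurable k j : <<s history_gen k j >> `<=` @measurable _ T.
Proof.
apply: smallest_sub; first exact: sigma_algebra_measurable.
by move=> _ [i [B [mB [[_ ->]|[_ ->]]]]]; exact: measurable_funPTI.
Qed.

Lemma history_mono k k' j j' : (k <= k')%N -> (j <= j')%N ->
  <<s history_gen k j >> `<=` <<s history_gen k' j' >>.
Proof.
move=> kk jj; apply: sub_sigma_algebra2 => A [i [B [mB H]]].
exists i, B; split => //; case: H => [[ik ->]|[/andP[i0 ij] ->]]; [left|right].
  by rewrite (leq_trans ik kk).
by rewrite i0 (leq_trans ij jj).
Qed.

Lemma history_bmeas k k' j j' (F : T -> R) : (k <= k')%N -> (j <= j')%N ->
  @bmeas _ (TH k j) R F -> @bmeas _ (TH k' j') R F.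
Proof.
move=> kk jj [mF bF]; split => // _ B mB.
exact: (history_mono kk jj (mF measurableT B mB)).
Qed.

Lemma history_Y k j i : (0 < i <= j)%N -> measurable_fun (setT : set (TH k j)) (Y i).
Proof.
move=> ij _ B mB; rewrite setTI; apply: sub_sigma_algebra.
by exists i, B; split => //; right.
Qed.

End history.
Notation TH Y Z k j := (g_sigma_algebraType (history_gen Y Z k j)).

Lemma bmeas_comp d d' (X : measurableType d) (Y : measurableType d') (R : realType)
  (f : Y -> R) (u : X -> Y) : bmeas f -> measurable_fun setT u -> bmeas (fun x => f (u x)).
Proof.
by move=> [mf [M fM]] mu; split; [exact: measurableT_comp | exists M => x; exact: fM].
Qed.

Section chain.
Context (R : realType) (PP Q : R.-pker R ~> R) (z0 : R).
Context (d : measure_display) (T : measurableType d) (P : probability T R).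
Variables (Y Z : nat -> {RV P >-> R}).
Hypothesis chain : jump_chain PP Q z0 Y Z.
Implicit Types (F : T -> R) (f a h : R -> R).

(** Two conditionings: [Z_(k+1)] is integrated out given the past including [Y_(k+1)], then
    [Y_(k+1)] given the past up to [Z_k]. *)
Lemma chain_step k F f a : @bmeas _ (TH Y Z k k) R F -> bmeas f -> bmeas a ->
  \int[P]_w (F w * (f (Y k.+1 w) * a (Z k.+1 w))) =
  \int[P]_w (F w * \int[PP (Z k w)]_y (f y * \int[Q y]_u a u)).
Proof.
move=> bF bf ba; have bF' := history_bmeas (leqnn k) (leqnSn k) bF.
have mY := @history_Y _ _ _ _ Y Z k k.+1 k.+1 (leqnn _).
have bFf : @bmeas _ (TH Y Z k k.+1) R (fun w => F w * f (Y k.+1 w)).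
  by apply: bmeasM => //; exact: bmeas_comp mY.
under eq_Rintegral do rewrite mulrA.
rewrite (@conditional_law _ _ _ P (history_gen Y Z k k.+1) Q (Y k.+1) (Z k.+1)) //; last 2 first.
- exact: history_measurable.
- by move=> A B hA mB; exact: chain_postjump chain _ _ _ hA mB.
under eq_Rintegral do rewrite -mulrA.
rewrite (@conditional_law _ _ _ P (history_gen Y Z k k) PP (Z k) (Y k.+1) _ _ _ _ F (fun y => f y * \int[Q y]_u a u))//.
- exact: history_measurable.
- by move=> A B hA mB; exact: chain_prejump chain _ _ _ hA mB.
- by apply: bmeasM => //; exact: bmeas_pkint.
Qed.

Lemma chain_law j i F h : @bmeas _ (TH Y Z j j) R F -> bmeas h ->
  \int[P]_w (F w * h (Z (j + i)%N w)) =
  \int[P]_w (F w * \int[postjump_law PP Q i (Z j w)]_z h z).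
Proof.
move=> bF; elim: i h => [|i ih] h bh.
  rewrite addn0; apply: eq_Rintegral => w _; congr (_ * _).
  rewrite /Rintegral integral_dirac//; last by apply/measurable_EFinP; case: bh.
  by rewrite diracT mul1e.
have bF' : @bmeas _ (TH Y Z (j + i) (j + i)) R F.
  by apply: history_bmeas bF; exact: leq_addr.
have bPQ : bmeas (fun z => \int[PP z]_y \int[Q y]_u h u).
  by apply: bmeas_pkint; exact: bmeas_pkint.
rewrite addnS; under eq_Rintegral do rewrite -[h _]mul1r.
rewrite (chain_step bF' (bmeas_cst 1) bh).
transitivity (\int[P]_w (F w * \int[PP (Z (j + i)%N w)]_y \int[Q y]_u h u)).
  by under eq_Rintegral do under [X in _ * X]eq_Rintegral do rewrite mul1r.
rewrite (ih (fun z => \int[PP z]_y \int[Q y]_u h u))//.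
apply: eq_Rintegral => w _; congr (_ * _).
rewrite /= !bRintegral_mkcomp//.
exact: (bmeas_pkint Q).
Qed.

Lemma chain_jump j i F f a : (0 < i)%N -> @bmeas _ (TH Y Z j j) R F ->
  bmeas f -> bmeas a ->
  \int[P]_w (F w * (f (Y (j + i)%N w) * a (Z (j + i)%N w))) =
  \int[P]_w (F w * \int[jump_law PP Q i (Z j w)]_x (f x.1 * a x.2)).
Proof.
case: i => // i _ bF bf ba.
have bF' : @bmeas _ (TH Y Z (j + i) (j + i)) R F.
  by apply: history_bmeas bF; exact: leq_addr.
rewrite addnS (chain_step bF' bf ba).
have bh : bmeas (fun z => \int[PP z]_y (f y * \int[Q y]_u a u)).
  by apply: bmeas_pkint; apply: bmeasM => //; exact: bmeas_pkint.
rewrite (chain_law _ bF bh); apply: eq_Rintegral => w _.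
by rewrite bRintegral_jump_law.
Qed.

End chain.

Section jump_mean.
Context (R : realType) (PP Q : R.-pker R ~> R).

Lemma jump_law_le1 i z : (jump_law PP Q i z setT <= 1)%E.
Proof.
apply: (@le_trans _ _ (\int[mkcomp_noparam (postjump_law PP Q i.-1) PP z]_y
    kernel.intker_indic (kernel.kernel_snd Q) setT (z, y))%E) => //.
apply: le_trans (spkernel_le1 (mkcomp_noparam (postjump_law PP Q i.-1) PP) z).
rewrite -[leRHS]mul1e -integral_cst//; apply: ge0_le_integral => //.
- by move=> y _; rewrite kernel.intker_indicE.
- apply: (measurableT_comp (f := kernel.intker_indic (kernel.kernel_snd Q) setT)).
    exact: kernel.measurable_intker_indic.
  exact: pair1_measurable.
- move=> y _; rewrite kernel.intker_indicE//; apply: le_trans (spkernel_le1 Q y).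
  by apply: le_measure => //; rewrite inE//; exact: measurable_xsection.
Qed.

Lemma jump_law_lty i z : (jump_law PP Q i z setT < +oo)%E.
Proof. by rewrite (le_lt_trans (jump_law_le1 _ _)) ?ltry. Qed.

(** The expectation of [g (Y_i)] given [Z_0 = z], for [i >= 1]. Since [jump_law] uses [i.-1], index
    0 repeats index 1, which is why [stat_cov] treats lag 0 apart. *)
Definition jump_mean i (g : R -> R) z := \int[jump_law PP Q i z]_x g x.1.

Lemma jump_meanE i g z : jump_mean i g z = \int[jump_law PP Q i z]_x (g x.1 * cst 1 x.2).
Proof. by apply: eq_Rintegral => x _; rewrite mulr1. Qed.

Lemma bmeas_jump_mean i g : bmeas g -> bmeas (jump_mean i g).
Proof.
move=> bg; rewrite (_ : jump_mean i g = fun z => \int[postjump_law PP Q i.-1 z]_x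
  \int[PP x]_y (g y * \int[Q y]_u 1)); last first.
  by apply/funext => z; rewrite jump_meanE bRintegral_jump_law.
apply: bmeas_kint; apply: bmeas_pkint; apply: bmeasM => //.
exact: (bmeas_pkint Q (bmeas_cst 1)).
Qed.

Lemma jump_mean_le i (g : R -> R) K z : bmeas g -> (forall x, `|g x| <= K) ->
  `|jump_mean i g z| <= K.
Proof.
move=> bg gK; apply: (kernel_Rintegral_le (K := jump_law PP Q i)) => //.
- exact: jump_law_le1.
- by have [] : bmeas (fun x : R * R => g x.1) by exact: bmeas_fst.
Qed.

Lemma jump_meanD i f g z : bmeas f -> bmeas g ->
  jump_mean i (fun x => f x + g x) z = jump_mean i f z + jump_mean i g z.
Proof.
by move=> bf bg; rewrite /jump_mean bRintegralD//; [exact: jump_law_lty|exact: bmeas_fst..].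
Qed.

Lemma jump_meanZ i c f z : bmeas f ->
  jump_mean i (fun x => c * f x) z = c * jump_mean i f z.
Proof.
by move=> bf; rewrite /jump_mean bRintegralZ//; [exact: jump_law_lty|exact: bmeas_fst].
Qed.

Lemma jump_mean_sum i (I : Type) (r : seq I) (F : I -> R -> R) z :
  (forall k, bmeas (F k)) ->
  jump_mean i (fun x => \sum_(k <- r) F k x) z = \sum_(k <- r) jump_mean i (F k) z.
Proof.
by move=> bF; rewrite /jump_mean bRintegral_sum//; [exact: jump_law_lty|move=> k; exact: bmeas_fst].
Qed.

End jump_mean.

Section mixing.
Context (R : realType) (PP Q : R.-pker R ~> R) (rho : probability (R * R)%type R).
Variables (V : R -> R) (gamma Rc : R).
Hypotheses (Rc0 : 0 < Rc) (gamma0 : 0 < gamma).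
Hypothesis V1 : forall z, 0 <= z -> 1 <= V z.
Hypothesis ergo : exponentially_ergodic PP Q rho V gamma Rc.

Lemma jump_law_close i z psi K : (0 < i)%N -> 0 <= z -> 0 < K -> bmeas psi ->
  (forall w : R * R, 0 <= w.1 -> 0 <= w.2 -> `|psi w| <= K * V w.2) ->
  `|\int[jump_law PP Q i z]_w psi w - \int[rho]_w psi w| <= K * (Rc * V z * gamma ^+ i).
Proof.
move=> i0 z0 K0 bpsi psiK.
have bp := bmeasZ K^-1 bpsi.
have pV (w : R * R) : 0 <= w.1 -> 0 <= w.2 -> `|K^-1 * psi w| <= V w.2.
  move=> w1 w2; rewrite normrM gtr0_norm ?invr_gt0// mulrC ler_pdivrMr//.
  by rewrite mulrC psiK.
have := ergo z0 i0 bp.1 pV.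
rewrite -!bRintegral_EFin//; last exact: jump_law_lty.
rewrite -EFinB abse_EFin lee_fin !bRintegralZ//; last exact: jump_law_lty.
rewrite -mulrBr normrM gtr0_norm ?invr_gt0// mulrC ler_pdivrMr//.
by rewrite [_ * K]mulrC.
Qed.

Context (z0 : R) (d : measure_display) (T : measurableType d) (P : probability T R).
Variables (Y Z : nat -> {RV P >-> R}).
Hypothesis chain : jump_chain PP Q z0 Y Z.
Implicit Types (F : T -> R) (f a h : R -> R).

Section past.
Variables (j : nat) (L : R) (F : T -> R).
Hypothesis bF : @bmeas _ (TH Y Z j j) R F.
Hypothesis F_good : forall w, F w != 0 -> 0 <= Z j w /\ V (Z j w) <= L.

Let bFT : @bmeas _ T R F.
Proof. exact: sub_bmeas (@history_measurable _ _ _ P Y Z j j) _ bF. Qed.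

(** The ergodic bound carries the factor [V (Z_j)], which is not bounded. As [F] vanishes unless
    [Z_j >= 0] and [V (Z_j) <= L], the factor can be replaced by [L] under the integral. *)
Lemma chain_mixing i f a K : (0 < i)%N -> 0 < K -> bmeas f -> bmeas a ->
  (forall x y, `|f x * a y| <= K) ->
  `|\int[P]_w (F w * (f (Y (j + i)%N w) * a (Z (j + i)%N w))) -
    \int[P]_w F w * \int[rho]_x (f x.1 * a x.2)| <=
  K * (Rc * L * gamma ^+ i) * \int[P]_w `|F w|.
Proof.
move=> i0 K0 bf ba faK; rewrite (chain_jump chain)//.
set J := fun w => _; set r := \int[rho]_x _.
have bfa : bmeas (fun x : R * R => f x.1 * a x.2).
  by apply: bmeasM; [exact: bmeas_fst|exact: bmeas_snd].
have bJ0 : bmeas (fun z => \int[jump_law PP Q i z]_x (f x.1 * a x.2)).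
  rewrite [X in bmeas X](_ : _ = fun z => \int[postjump_law PP Q i.-1 z]_x
    \int[PP x]_y (f y * \int[Q y]_u a u)); last first.
    by apply/funext => z; rewrite bRintegral_jump_law.
  apply: bmeas_kint; apply: bmeas_pkint; apply: bmeasM => //.
  exact: bmeas_pkint.
have bJ : bmeas (fun w => \int[jump_law PP Q i (Z j w)]_x (f x.1 * a x.2)).
  exact: (bmeas_comp bJ0).
rewrite mulrC -bRintegralZ// -bRintegralB//; last 2 first.
- exact: bmeasM.
- exact: bmeasM.
apply: le_trans (bRintegral_norm _ _) _ => //.
  by apply: bmeasB; exact: bmeasM.
rewrite -bRintegralZ//; last exact: bmeas_norm.
apply: le_bRintegral => //.
- by apply: bmeas_norm; apply: bmeasB; exact: bmeasM.
- by apply: bmeasM => //; exact: bmeas_norm.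
move=> w; rewrite [r * _]mulrC -mulrBr normrM [leRHS]mulrC.
have [->|/F_good[Zge0 VL]] := eqVneq (F w) 0; first by rewrite normr0 !mul0r.
rewrite ler_wpM2l//.
apply: (le_trans (jump_law_close i0 Zge0 K0 bfa _)).
  move=> x x1 x2; rewrite (le_trans (faK _ _))//.
  by rewrite ler_peMr ?V1// ltW.
rewrite ler_pM2l// ler_wpM2r ?exprn_ge0 ?(ltW gamma0)//.
by rewrite ler_pM2l.
Qed.

Lemma chain_mixing1 i f (K : R) : (0 < i)%N -> 0 < K -> bmeas f -> (forall x, `|f x| <= K) ->
  `|\int[P]_w (F w * f (Y (j + i)%N w)) - \int[P]_w F w * \int[rho]_x f x.1| <=
  K * (Rc * L * gamma ^+ i) * \int[P]_w `|F w|.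
Proof.
move=> i0 K0 bf fK.
have f1 (x y : R) : `|f x * 1| <= K by rewrite mulr1.
have := chain_mixing i0 K0 bf (bmeas_cst 1) f1.
by under eq_Rintegral do rewrite mulr1; under [X in _ - _ * X]eq_Rintegral do rewrite mulr1.
Qed.

(** The stationary mean of [f (Y_k) * g (Y_(k+i))], obtained by conditioning on [(Y_k, Z_k)], whose
    law is [rho]. It is a covariance as soon as [f] or [g] is centered. *)
Definition stat_cov i f g : R := \int[rho]_x
  (f x.1 * (if i is 0 then g x.1 else jump_mean PP Q i g x.2)).

(** Conditioning at time [j + i] replaces the later factor by its conditional mean, a function of
    [Z_(j+i)] bounded by [K]; the product then depends on one time only and [chain_mixing]
    applies. *)
Lemma chain_mixing2 i i' f g K : (0 < i)%N -> 0 < K -> bmeas f -> bmeas g ->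
  (forall x, `|f x| <= K) -> (forall x, `|g x| <= K) ->
  `|\int[P]_w (F w * (f (Y (j + i)%N w) * g (Y (j + i + i')%N w))) -
    \int[P]_w F w * stat_cov i' f g| <=
  K ^+ 2 * (Rc * L * gamma ^+ i) * \int[P]_w `|F w|.
Proof.
move=> i0 K0 bf bg fK gK; have K20 : 0 < K ^+ 2 by rewrite exprn_gt0.
case: i' => [|i'].
  rewrite addn0; apply: (chain_mixing1 i0 K20 (bmeasM bf bg)) => x.
  by rewrite normrM expr2 ler_pM.
have ba := bmeas_jump_mean PP Q i'.+1 bg.
have fa x y : `|f x * jump_mean PP Q i'.+1 g y| <= K ^+ 2.
  by rewrite normrM expr2 ler_pM// jump_mean_le.
have := chain_mixing i0 K20 bf ba fa.
set u := \int[P]_w (F w * (f _ * jump_mean _ _ _ _ _)).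
suff -> : \int[P]_w (F w * (f (Y (j + i)%N w) * g (Y (j + i + i'.+1)%N w))) = u by [].
have bFf : @bmeas _ (TH Y Z (j + i) (j + i)) R (fun w => F w * f (Y (j + i)%N w)).
  apply: bmeasM; first by apply: history_bmeas bF; exact: leq_addr.
  apply: bmeas_comp => //; apply: history_Y.
  by rewrite leqnn addn_gt0 i0 orbT.
have := chain_jump chain (ltn0Sn i') bFf bg (bmeas_cst 1).
under eq_Rintegral do rewrite mulr1 -mulrA.
move=> ->; apply: eq_Rintegral => w _.
by rewrite -mulrA jump_meanE.
Qed.

End past.
End mixing.

(** * Stationary covariances *)

(** [postjump_law] is typed as a sub-probability kernel only; its total mass 1 is recovered by
    induction from [PP] and [Q]. *)
Lemma jump_mean_cst (R : realType) (PP Q : R.-pker R ~> R) i c z :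
  jump_mean PP Q i (fun=> c) z = c.
Proof.
have one (K : R.-pker R ~> R) x a : \int[K x]_y a = a.
  by rewrite Rintegral_cst// prob_kernel mulr1.
have post k x : \int[postjump_law PP Q k x]_y c = c.
  elim: k x => [|k ih] x.
    by rewrite /Rintegral integral_dirac// diracT mul1e.
  rewrite /= !bRintegral_mkcomp//; last exact: (bmeas_pkint Q).
  by under eq_Rintegral do under eq_Rintegral do rewrite one; under eq_Rintegral do rewrite one.
rewrite jump_meanE bRintegral_jump_law//.
under eq_Rintegral do under eq_Rintegral do rewrite one mulr1.
by under eq_Rintegral do rewrite one.
Qed.

Lemma Rintegral_sum d (X : measurableType d) (R : realType)
    (m : {measure set X -> \bar R}) (I : Type) (r : seq I) (F : I -> X -> R) :
  (forall i, m.-integrable setT (EFin \o F i)) ->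
  \int[m]_x (\sum_(i <- r) F i x) = \sum_(i <- r) \int[m]_x F i x.
Proof.
move=> iF; have iS s : m.-integrable setT (EFin \o (fun x => \sum_(i <- s) F i x)).
  elim: s => [|i s ih].
    rewrite (_ : _ \o _ = cst 0%E); first exact: integrable0.
    by apply/funext => x /=; rewrite big_nil.
  rewrite (_ : _ \o _ = (EFin \o F i) \+ (EFin \o (fun x => \sum_(i <- s) F i x))).
    exact: integrableD.
  by apply/funext => x /=; rewrite big_cons EFinD.
elim: r => [|i r ih].
  by under eq_Rintegral do rewrite big_nil; rewrite big_nil Rintegral_cst ?mul0r.
under eq_Rintegral do rewrite big_cons.
by rewrite big_cons RintegralD ?ih.
Qed.

Lemma cauchy_schwarz_sum (R : realFieldType) (I : finType) (u v : I -> R) a :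
  0 < a -> \sum_i u i ^+ 2 <= 1 -> \sum_i v i ^+ 2 <= a ^+ 2 ->
  `|\sum_i u i * v i| <= a.
Proof.
move=> a0 u1 v1; have key (e : R) : e ^+ 2 = 1 -> e * \sum_i u i * v i <= a.
  move=> e1; suff : 2 * (a * (e * \sum_i u i * v i)) <= a ^+ 2 * \sum_i u i ^+ 2 + \sum_i v i ^+ 2.
    have : a ^+ 2 * \sum_i u i ^+ 2 <= a ^+ 2 by rewrite ler_piMr ?sqr_ge0.
    by move=> h1 h2; rewrite -(ler_pM2l a0) -expr2; lra.
  rewrite !mulr_sumr -big_split/=; apply: ler_sum => i _.
  have := sqr_ge0 (a * u i - e * v i); rewrite sqrrB !exprMn e1.
  by rewrite -mulrnAr; lra.
rewrite ler_norml; have := key 1 (expr1n _ _); have := key (-1) (etrans (sqrrN 1) (expr1n _ 2)).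
by rewrite mul1r; lra.
Qed.

Section stationary_covariance.
Context (R : realType) (PP Q : R.-pker R ~> R) (rho : probability (R * R)%type R).
Variables (V : R -> R) (gamma Rc : R).
Hypotheses (Rc0 : 0 < Rc) (gamma0 : 0 < gamma).
Hypothesis mV : measurable_fun setT V.
Hypothesis V1 : forall z, 0 <= z -> 1 <= V z.
Hypothesis ergo : exponentially_ergodic PP Q rho V gamma Rc.
Hypothesis rho_supp : rho (Rplus R `*` Rplus R) = 1%E.
Hypothesis iV : rho.-integrable setT (fun x => (V x.2)%:E).
Let M := \int[rho]_x V x.2.

Let quad_ae : {ae rho, forall x, 0 <= x.2}.
Proof.
have mQ : measurable (Rplus R `*` Rplus R) by apply: measurableX; exact: measurable_itv.
exists (~` (Rplus R `*` Rplus R)); split; first exact: measurableC.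
  by rewrite [LHS](probability_setC rho mQ) rho_supp subee.
move=> [y z] /= zn; apply: contra_not zn => -[_].
by rewrite /Rplus/= in_itv/= andbT.
Qed.

(** [V] is at least 1, and the ergodic bound available, only for nonnegative states, a set of full
    [rho] measure. Multiplying by this indicator makes the inequalities hold at every point, as
    monotonicity of the integral is used in that form. *)
Let pos (x : R * R) : R := (0 <= x.2)%R%:R.

Let mpos : measurable_fun setT pos.
Proof.
rewrite (_ : pos = \1_(setT `*` Rplus R)).
  by apply: measurable_indic; apply: measurableX => //; exact: measurable_itv.
apply/funext => -[y z]; rewrite /pos indicE /=; congr (nat_of_bool _)%:R.
by apply/idP/idP; rewrite inE /= /Rplus/= in_itv/= andbT => // -[].
Qed.

Let pos01 x : 0 <= pos x <= 1.
Proof. by rewrite /pos; case: (0 <= x.2); rewrite /= ?lexx ?ler01. Qed.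

Let bpos : bmeas pos.
Proof. by split => //; exists 1 => x; rewrite ger0_norm; case/andP: (pos01 x). Qed.

Lemma Rintegral_pos f : measurable_fun setT f ->
  \int[rho]_x f x = \int[rho]_x (f x * pos x).
Proof.
move=> mf; congr fine; apply: ae_eq_integral => //.
- exact/measurable_EFinP.
- by apply/measurable_EFinP; exact: measurable_funM.
by apply: filterS quad_ae => x x2 _; rewrite /pos x2 mulr1.
Qed.

Lemma le_Rintegral_pos f g : rho.-integrable setT (EFin \o f) ->
  rho.-integrable setT (EFin \o g) -> (forall x, 0 <= x.2 -> f x <= g x) ->
  \int[rho]_x f x <= \int[rho]_x g x.
Proof.
move=> fi gi fg.
have ipos h : rho.-integrable setT (EFin \o h) ->
    rho.-integrable setT (EFin \o (fun x => h x * pos x)).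
  move=> hi; apply: (le_integrable measurableT _ _ hi).
    apply/measurable_EFinP; apply: measurable_funM => //.
    by apply/measurable_EFinP; case/integrableP: hi.
  move=> x _ /=; rewrite lee_fin normrM ler_piMr//.
  by rewrite ger0_norm; case/andP: (pos01 x).
have mE h : rho.-integrable setT (EFin \o h) -> measurable_fun setT h.
  by move=> hi; apply/measurable_EFinP; case/integrableP: hi.
rewrite (Rintegral_pos (mE _ fi)) (Rintegral_pos (mE _ gi)).
apply: le_Rintegral => //; [exact: ipos|exact: ipos|].
move=> x _; rewrite /pos; case: (boolP (0 <= x.2)) => x2; rewrite ?mulr0// !mulr1.
exact: fg.
Qed.

Let iVpos : rho.-integrable setT (fun x => (V x.2 * pos x)%:E).
Proof.
apply: (le_integrable measurableT _ _ iV).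
  apply/measurable_EFinP; apply: measurable_funM => //.
  exact: measurableT_comp.
move=> x _ /=; rewrite lee_fin normrM ler_piMr//.
by rewrite ger0_norm; case/andP: (pos01 x).
Qed.

Let Vpos_ge0 x : 0 <= V x.2 * pos x.
Proof.
rewrite /pos; case: (boolP (0 <= x.2)) => x2; rewrite ?mulr0// mulr1.
by rewrite (le_trans _ (V1 x2)).
Qed.

Let ME : M = \int[rho]_x (V x.2 * pos x).
Proof. by apply: Rintegral_pos; exact: measurableT_comp. Qed.

Lemma V_mean_ge1 : 1 <= M.
Proof.
have one : \int[rho]_x pos x = 1.
  rewrite -[RHS](bRintegral_cst rho 1) [RHS]Rintegral_pos//.
  by apply: eq_Rintegral => x _; rewrite mul1r.
rewrite ME -one; apply: le_Rintegral => //; first exact: bmeas_integrable.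
move=> x _; rewrite /pos; case: (boolP (0 <= x.2)) => x2; rewrite ?mulr0// mulr1.
exact: V1.
Qed.

Variables (D : nat) (f : 'I_D -> R -> R) (A : 'I_D -> R) (psi1 psi2 nn : R).
Hypothesis bf : forall l, bmeas (f l).
Hypothesis D0 : (0 < D)%N.
Hypotheses (psi10 : 0 < psi1) (nn0 : 0 <= nn).
Hypothesis f_sq : forall y, \sum_l f l y ^+ 2 <= psi1 * D%:R.
Hypothesis A0 : forall l, 0 < A l.
Hypothesis fA : forall l y, `|f l y| <= A l.
Hypothesis f_A : forall y, \sum_l A l * `|f l y| <= psi2 * D%:R.
Hypothesis f_L1 : forall u : 'I_D -> R, \sum_l u l ^+ 2 <= 1 ->
  \int[rho]_x `|\sum_l u l * f l x.1| <= nn.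

Definition centered l y := f l y - \int[rho]_x f l x.1.

Let c l := \int[rho]_x f l x.1.
Let K := Num.sqrt (psi1 * D%:R).

Let K0 : 0 < K. Proof. by rewrite sqrtr_gt0 mulr_gt0// ltr0n. Qed.
Let K2 : K ^+ 2 = psi1 * D%:R.
Proof. by rewrite sqr_sqrtr// mulr_ge0// ltW. Qed.

Let bf1 l : bmeas (fun x : R * R => f l x.1). Proof. exact: bmeas_fst. Qed.

Lemma bmeas_centered l : bmeas (centered l).
Proof. exact: bmeasB. Qed.

Lemma Rintegral_centered l : \int[rho]_x centered l x.1 = 0.
Proof.
rewrite (bRintegralB (probability_lty rho) (bf1 l) (bmeas_cst _)).
by rewrite bRintegral_cst subrr.
Qed.

Let bsq l : bmeas (fun x : R * R => f l x.1 ^+ 2).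
Proof. by under eq_fun do rewrite expr2; exact: bmeasM. Qed.

Let variance_le (g : R * R -> R) : bmeas g ->
  \int[rho]_x (g x - \int[rho]_x g x) ^+ 2 <= \int[rho]_x g x ^+ 2.
Proof.
move=> bg; set e := \int[rho]_x g x.
have bg2 : bmeas (fun x => g x ^+ 2) by under eq_fun do rewrite expr2; exact: bmeasM.
have -> : \int[rho]_x (g x - e) ^+ 2 = \int[rho]_x (g x ^+ 2 - (2 * e) * g x + e ^+ 2).
  by apply: eq_Rintegral => x _; ring.
rewrite bRintegralD//; last by apply: bmeasB => //; exact: bmeasZ.
rewrite bRintegralB//; last exact: bmeasZ.
rewrite bRintegralZ// bRintegral_cst -/e.
by have := sqr_ge0 e; lra.
Qed.

Let c_sq : \sum_l c l ^+ 2 <= psi1 * D%:R.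
Proof.
apply: (@le_trans _ _ (\sum_l \int[rho]_x f l x.1 ^+ 2)).
  apply: ler_sum => l _; rewrite -subr_ge0.
  have -> : \int[rho]_x f l x.1 ^+ 2 - c l ^+ 2 = \int[rho]_x (f l x.1 - c l) ^+ 2.
    have -> : \int[rho]_x (f l x.1 - c l) ^+ 2 =
        \int[rho]_x (f l x.1 ^+ 2 - (2 * c l) * f l x.1 + c l ^+ 2).
      by apply: eq_Rintegral => x _; ring.
    rewrite bRintegralD//; last by apply: bmeasB => //; exact: bmeasZ.
    rewrite bRintegralB//; last exact: bmeasZ.
    rewrite bRintegralZ// bRintegral_cst -/(c l); ring.
  by apply: Rintegral_ge0 => x _; exact: sqr_ge0.
rewrite -bRintegral_sum// -[leRHS](bRintegral_cst rho).
by apply: le_bRintegral => //; exact: bmeas_sum.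
Qed.

Lemma centered_sq y : \sum_l centered l y ^+ 2 <= (2 * K) ^+ 2.
Proof.
rewrite exprMn K2; apply: (@le_trans _ _ (\sum_l (2 * f l y ^+ 2 + 2 * c l ^+ 2))).
  apply: ler_sum => l _; rewrite /centered -/(c l).
  by have := sqr_ge0 (f l y + c l); rewrite !sqrrD sqrrN mulrN; lra.
rewrite big_split/= -!mulr_sumr; have := f_sq y; have := c_sq; lra.
Qed.

Let c_A : \sum_l A l * `|c l| <= psi2 * D%:R.
Proof.
have bn l : bmeas (fun x : R * R => `|f l x.1|) by exact: bmeas_norm.
apply: (@le_trans _ _ (\sum_l A l * \int[rho]_x `|f l x.1|)).
  by apply: ler_sum => l _; rewrite ler_pM2l// bRintegral_norm.
under eq_bigr do rewrite -bRintegralZ//.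
rewrite -bRintegral_sum//; last by move=> l; exact: bmeasZ.
rewrite -[leRHS](bRintegral_cst rho).
apply: le_bRintegral => //.
by apply: bmeas_sum => l; exact: bmeasZ.
Qed.

Let centered_A y : \sum_l A l * `|centered l y| <= 2 * (psi2 * D%:R).
Proof.
apply: (@le_trans _ _ (\sum_l (A l * `|f l y| + A l * `|c l|))).
  by apply: ler_sum => l _; rewrite -mulrDr ler_pM2l// ler_normB.
by rewrite big_split/=; have := f_A y; have := c_A; lra.
Qed.

Let jump_mean_close (i : nat) (g : R -> R) k z : (0 < i)%N -> 0 < k -> bmeas g ->
  (forall y, `|g y| <= k) -> 0 <= z ->
  `|jump_mean PP Q i g z - \int[rho]_x g x.1| <= k * (Rc * V z * gamma ^+ i).
Proof.
move=> i0 k0 bg gk z0; apply: (jump_law_close ergo i0 z0 k0).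
  exact: bmeas_fst.
by move=> w w1 w2; rewrite (le_trans (gk _))// ler_peMr ?V1// ltW.
Qed.

Let jump_mean_centered i (g : R -> R) e z : bmeas g ->
  jump_mean PP Q i (fun y => g y - e) z = jump_mean PP Q i g z - e.
Proof.
by move=> bg; rewrite (jump_meanD PP Q i z bg (bmeas_cst (- e))) jump_mean_cst.
Qed.

(** The conditional mean of the centered [h] given [Z_0] is at most [k * Rc * V (Z_0) * gamma ^+ i];
    it is integrated against [g]. Keeping [g] inside the integral lets the callers sum over a basis
    before bounding. *)
Let cov_mix i (g h : R -> R) k : (0 < i)%N -> 0 < k -> bmeas g -> bmeas h ->
  (forall y, `|h y| <= k) ->
  `|stat_cov PP Q rho i g (fun y => h y - \int[rho]_x h x.1)| <=
  k * (Rc * gamma ^+ i) * \int[rho]_x (`|g x.1| * (V x.2 * pos x)).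
Proof.
move=> i0 k0 bg bh hk; case: i i0 => // i _.
set e := \int[rho]_x h x.1.
have bh' : bmeas (fun y => h y - e) by exact: bmeasB.
have bJ := bmeas_jump_mean PP Q i.+1 bh'.
have bgJ : bmeas (fun x : R * R => g x.1 * jump_mean PP Q i.+1 (fun y => h y - e) x.2).
  by apply: bmeasM; [exact: bmeas_fst|exact: bmeas_snd].
have igV : rho.-integrable setT (fun x => (`|g x.1| * (V x.2 * pos x))%:E).
  have [_ [G gG]] := bg.
  apply: (le_integrable measurableT _ _ (integrableZl measurableT G iVpos)).
    apply/measurable_EFinP; apply: measurable_funM.
      by case: (bmeas_norm (bmeas_fst R bg)).
    by apply: measurable_funM => //; exact: measurableT_comp.
  move=> x _ /=; rewrite lee_fin !normrM normr_id -normrM.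
  by rewrite ler_wpM2r// (le_trans (gG _))// ler_norm.
rewrite /stat_cov Rintegral_pos; last by case: bgJ.
apply: le_trans (bRintegral_norm _ _) _ => //; first exact: bmeasM.
rewrite -RintegralZl//; apply: le_Rintegral => //.
- by apply: bmeas_integrable => //; apply: bmeas_norm; exact: bmeasM.
- exact: (integrableZl measurableT (k * (Rc * gamma ^+ i.+1)) igV).
move=> x _; rewrite !normrM -mulrA [leRHS]mulrCA ler_wpM2l//.
rewrite /pos; case: (boolP (0 <= x.2)) => x2; rewrite ?normr0 ?mulr0// normr1 !mulr1.
rewrite jump_mean_centered//.
apply: le_trans (jump_mean_close (ltn0Sn i) k0 bh hk x2) _.
by rewrite -/e -!mulrA [V _ * _]mulrC.
Qed.

(** For a positive lag each term is estimated with its own bound [A l], so that the sum over [l]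
    meets the localization property [f_A] and stays of order [D]; the common bound [K] would give a
    larger power of [D]. *)
Lemma stat_cov_trace i : \sum_l stat_cov PP Q rho i (centered l) (centered l) <=
  if i is 0 then psi1 * D%:R else 2 * (psi2 * D%:R) * (Rc * gamma ^+ i) * M.
Proof.
case: i => [|i].
  apply: (@le_trans _ _ (\sum_l \int[rho]_x f l x.1 ^+ 2)).
    by apply: ler_sum => l _; rewrite /stat_cov; apply: variance_le.
  rewrite -bRintegral_sum// -[leRHS](bRintegral_cst rho).
  by apply: le_bRintegral => //; exact: bmeas_sum.
have iaV a (g : R -> R) : bmeas g ->
    rho.-integrable setT (fun x => (a * (`|g x.1| * (V x.2 * pos x)))%:E).
  move=> bg; have [_ [G gG]] := bg.
  apply: (le_integrable measurableT _ _ (integrableZl measurableT (a * G) iVpos)).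
    apply/measurable_EFinP; do 2 apply: measurable_funM => //.
      by case: (bmeas_norm (bmeas_fst R bg)).
    by apply: measurable_funM => //; exact: measurableT_comp.
  move=> x _ /=; rewrite lee_fin !normrM normr_id -!mulrA ler_wpM2l//.
  by rewrite ler_wpM2r ?mulr_ge0// (le_trans (gG _))// ler_norm.
have rg0 : 0 <= Rc * gamma ^+ i.+1 by apply: mulr_ge0; [exact: ltW|apply: exprn_ge0; exact: ltW].
apply: (@le_trans _ _ (\sum_l Rc * gamma ^+ i.+1 *
    \int[rho]_x (A l * (`|centered l x.1| * (V x.2 * pos x))))).
  apply: ler_sum => l _; apply: le_trans (ler_norm _) _.
  apply: le_trans (cov_mix (ltn0Sn i) (A0 l) (bmeas_centered l) (bf l) (fA l)) _.
  rewrite RintegralZl//; first by rewrite -[leLHS]mulrA [leLHS]mulrCA lexx.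
  have := iaV 1 _ (bmeas_centered l).
  by under eq_fun do rewrite mul1r.
rewrite -mulr_sumr -Rintegral_sum; last first.
  by move=> l; exact: (iaV (A l) _ (bmeas_centered l)).
rewrite [leRHS](_ : _ = Rc * gamma ^+ i.+1 * (2 * (psi2 * D%:R) * M)); last by ring.
rewrite ler_wpM2l// ME -RintegralZl//; apply: le_Rintegral => //.
- apply: (le_integrable measurableT _ _ (integrableZl measurableT (2 * (psi2 * D%:R)) iVpos)).
    apply/measurable_EFinP; apply: measurable_sum => l.
    apply: measurable_funM => //; apply: measurable_funM.
      by case: (bmeas_norm (bmeas_fst R (bmeas_centered l))).
    by apply: measurable_funM => //; exact: measurableT_comp.
  move=> x _ /=; rewrite lee_fin.
  under eq_bigr do rewrite mulrA.
  rewrite -mulr_suml !normrM ler_wpM2r ?mulr_ge0//.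
  rewrite ger0_norm; last by apply: sumr_ge0 => l _; rewrite mulr_ge0// ltW.
  by apply: le_trans (centered_A _) _; rewrite -!normrM; exact: ler_norm.
- exact: (integrableZl measurableT (2 * (psi2 * D%:R)) iVpos).
move=> x _; under eq_bigr do rewrite mulrA.
by rewrite -mulr_suml ler_wpM2r.
Qed.

Let fu_bound (u : 'I_D -> R) y : \sum_l u l ^+ 2 <= 1 -> `|\sum_l u l * f l y| <= K.
Proof. by move=> u1; apply: cauchy_schwarz_sum => //; rewrite K2. Qed.

Let stat_cov_bilinear i (u : 'I_D -> R) :
  \sum_l \sum_l' u l * u l' * stat_cov PP Q rho i (centered l) (centered l') =
  stat_cov PP Q rho i (fun y => \sum_l u l * centered l y)
    (fun y => \sum_l u l * centered l y).
Proof.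
pose J g (x : R * R) := if i is 0 then g x.1 else jump_mean PP Q i g x.2.
have bJ g : bmeas g -> bmeas (J g).
  move=> bg; rewrite /J; case: {J} i => [|i]; first exact: bmeas_fst.
  by apply: bmeas_snd; exact: bmeas_jump_mean.
have Jlin x : J (fun y => \sum_l u l * centered l y) x = \sum_l u l * J (centered l) x.
  rewrite /J; case: {J bJ} i => [//|i].
  rewrite jump_mean_sum; last by move=> l; apply: bmeasZ; exact: bmeas_centered.
  by apply: eq_bigr => l _; rewrite jump_meanZ//; exact: bmeas_centered.
have bb l l' : bmeas (fun x : R * R => centered l x.1 * J (centered l') x).
  by apply: bmeasM; [exact/bmeas_fst/bmeas_centered|exact/bJ/bmeas_centered].
rewrite [RHS](_ : _ = \int[rho]_x (\sum_l \sum_l'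
    (u l * u l') * (centered l x.1 * J (centered l') x))).
  rewrite bRintegral_sum//; last first.
    by move=> l; apply: bmeas_sum => l'; exact: bmeasZ.
  apply: eq_bigr => l _; rewrite bRintegral_sum//; last by move=> l'; exact: bmeasZ.
  by apply: eq_bigr => l' _; rewrite bRintegralZ.
apply: eq_Rintegral => x _; rewrite -/(J _ x) Jlin big_distrl/=.
apply: eq_bigr => l _; rewrite mulr_sumr; apply: eq_bigr => l' _; ring.
Qed.

(** A unit combination has sup norm at most [K], of order [sqrt D], but mean absolute value at most
    [nn]. At a positive lag, mixing gives decay with a factor of order [D], and the trivial bound a
    factor of order [sqrt D] without decay; their geometric mean is summable in the lag and of order
    [D^(3/4)]. *)
Lemma stat_cov_weak i (u : 'I_D -> R) : \sum_l u l ^+ 2 <= 1 ->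
  \sum_l \sum_l' u l * u l' * stat_cov PP Q rho i (centered l) (centered l') <=
  if i is 0 then K * nn
  else Num.sqrt (8 * nn * Rc * M * K ^+ 3) * Num.sqrt gamma ^+ i.
Proof.
move=> u1; rewrite stat_cov_bilinear.
pose s y := \sum_l u l * f l y.
have bs : bmeas s by apply: bmeas_sum => l; exact: bmeasZ.
have sK y : `|s y| <= K by exact: fu_bound.
pose e := \int[rho]_x s x.1.
have bs1 : bmeas (fun x : R * R => s x.1) by exact: bmeas_fst.
have s1 : \int[rho]_x `|s x.1| <= nn by exact: f_L1.
have eK : `|e| <= K.
  apply: le_trans (bRintegral_norm _ bs1) _ => //; rewrite -[leRHS](bRintegral_cst rho).
  by apply: le_bRintegral => //; exact: bmeas_norm.
have en : `|e| <= nn by apply: le_trans (bRintegral_norm _ bs1) _.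
have E : (fun y => \sum_l u l * centered l y) = (fun y => s y - e).
  apply/funext => y; rewrite /s /e /centered.
  rewrite bRintegral_sum; [|by []|by move=> l; exact: bmeasZ].
  rewrite -sumrB; apply: eq_bigr => l _.
  by rewrite bRintegralZ// mulrBr.
rewrite E; have bse : bmeas (fun y => s y - e) by exact: bmeasB.
have bse1 : bmeas (fun x : R * R => s x.1 - e) by exact: bmeasB.
case: i => [|i].
  apply: (@le_trans _ _ (\int[rho]_x s x.1 ^+ 2)).
    by rewrite /stat_cov; exact: variance_le.
  apply: (@le_trans _ _ (\int[rho]_x (K * `|s x.1|))).
    apply: le_bRintegral => //.
    - by under eq_fun do rewrite expr2; exact: bmeasM.
    - by apply: bmeasZ; exact: bmeas_norm.
    - by move=> x; rewrite -real_normK ?num_real// expr2 ler_wpM2r.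
  by rewrite bRintegralZ//; [rewrite ler_pM2l|exact: bmeas_norm].
have h1 := cov_mix (ltn0Sn i) K0 bse bs sK; rewrite -/e in h1.
set S := stat_cov _ _ _ _ _ _ in h1 *.
have rg0 : 0 <= Rc * gamma ^+ i.+1 by apply: mulr_ge0; [exact: ltW|apply: exprn_ge0; exact: ltW].
have M0 : 0 <= M by rewrite (le_trans _ V_mean_ge1).
have b1 : `|S| <= 2 * K ^+ 2 * (Rc * gamma ^+ i.+1) * M.
  apply: le_trans h1 _.
  rewrite [leRHS](_ : _ = K * (Rc * gamma ^+ i.+1) * (2 * K * M)); last by ring.
  rewrite ler_wpM2l//; first by rewrite mulr_ge0// ltW.
  rewrite ME -RintegralZl//; apply: le_Rintegral => //.
  - apply: (le_integrable measurableT _ _ (integrableZl measurableT (2 * K) iVpos)).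
      apply/measurable_EFinP; apply: measurable_funM.
        by case: (bmeas_norm bse1).
      by apply: measurable_funM => //; exact: measurableT_comp.
    move=> x _ /=; rewrite lee_fin !normrM normr_id -normrM ler_wpM2r//.
    rewrite (le_trans (ler_normB _ _))//.
    by have := sK x.1; have := eK; have := ler_norm K; rewrite normr_nat; lra.
  - exact: (integrableZl measurableT (2 * K) iVpos).
  move=> x _; rewrite ler_wpM2r// (le_trans (ler_normB _ _))//.
  by have := sK x.1; have := eK; lra.
have b2 : `|S| <= 4 * K * nn.
  have bJ := bmeas_jump_mean PP Q i.+1 bse.
  have bgJ : bmeas (fun x : R * R => (s x.1 - e) * jump_mean PP Q i.+1 (fun y => s y - e) x.2).
    by apply: (bmeasM bse1); exact: (bmeas_snd R bJ).
  apply: le_trans (bRintegral_norm _ bgJ) _ => //.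
  have seK y : `|s y - e| <= 2 * K.
    by rewrite (le_trans (ler_normB _ _))//; have := sK y; have := eK; lra.
  apply: (@le_trans _ _ (\int[rho]_x (2 * K * (`|s x.1| + `|e|)))).
    apply: le_bRintegral => //; first exact: bmeas_norm.
      by apply: bmeasZ; apply: bmeasD => //; exact: bmeas_norm.
    move=> x; rewrite normrM mulrC ler_pM//; last exact: ler_normB.
    exact: jump_mean_le.
  rewrite bRintegralZ//; last by apply: bmeasD => //; exact: bmeas_norm.
  rewrite bRintegralD//; last exact: bmeas_norm.
  rewrite bRintegral_cst.
  rewrite [leRHS](_ : _ = 2 * K * (2 * nn)); last by ring.
  rewrite ler_pM2l ?mulr_gt0//; lra.
apply: le_trans (ler_norm _) _.
have t0 : 0 <= Num.sqrt (8 * nn * Rc * M * K ^+ 3) * Num.sqrt gamma ^+ i.+1.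
  by apply: mulr_ge0; [exact: sqrtr_ge0|apply: exprn_ge0; exact: sqrtr_ge0].
(* [`|S|] is at most the geometric mean of the bound through mixing and of the trivial one *)
rewrite -(@ler_pXn2r _ 2)//.
rewrite exprMn -exprM mulnC exprM !sqr_sqrtr ?(ltW gamma0)//; last first.
  by rewrite !mulr_ge0 ?exprn_ge0 ?(ltW Rc0) ?(ltW K0).
apply: (@le_trans _ _ ((2 * K ^+ 2 * (Rc * gamma ^+ i.+1) * M) * (4 * K * nn))).
  by rewrite expr2 ler_pM.
by rewrite le_eqVlt; apply/orP; left; apply/eqP; ring.
Qed.

End stationary_covariance.

(** * Exponential moments of block sums *)

Section smoothed_norm.
Variables (R : realType) (I : finType).
Implicit Types (S B : I -> R) (c beta theta : R).

(** From [exp (-y) >= 1 - y], so that [exp y <= 1 / (1 - y)]. The bound is one-sided: [y] may be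
    very negative. *)
Lemma expR_le_quad (y : R) : y <= 2^-1 -> expR y <= 1 + y + 2 * y ^+ 2.
Proof.
move=> y2; have y1 : 0 < 1 - y by lra.
have : expR y <= (1 - y)^-1.
  rewrite -[expR y]invrK lef_pV2 ?posrE ?invr_gt0 ?expR_gt0// -expRN.
  by have := expR_ge1Dx (- y).
move/le_trans; apply; rewrite -div1r ler_pdivrMr//.
suff : 0 <= y ^+ 2 * (1 - 2 * y) by lra.
by rewrite mulr_ge0 ?sqr_ge0//; lra.
Qed.

(** Adding [c] removes the singularity of the Euclidean norm at 0 and bounds its curvature by
    [1 / sqrt c]. *)
Definition smooth_norm c S : R := Num.sqrt (\sum_i S i ^+ 2 + c).

Lemma smooth_norm_sq c S : 0 <= c -> smooth_norm c S ^+ 2 = \sum_i S i ^+ 2 + c.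
Proof. by move=> c0; rewrite sqr_sqrtr// addr_ge0// sumr_ge0// => i _; exact: sqr_ge0. Qed.

Lemma smooth_norm_ge c S : 0 < c -> Num.sqrt c <= smooth_norm c S.
Proof. by move=> c0; rewrite ler_wsqrtr// lerDr sumr_ge0// => i _; exact: sqr_ge0. Qed.

Lemma smooth_norm_gt0 c S : 0 < c -> 0 < smooth_norm c S.
Proof. by move=> c0; rewrite (lt_le_trans _ (smooth_norm_ge S c0))// sqrtr_gt0. Qed.

(* the gradient of [smooth_norm c] at [S] *)
Definition smooth_dir c S i : R := S i / smooth_norm c S.

Lemma smooth_dir_sum c S : 0 < c -> \sum_i smooth_dir c S i ^+ 2 <= 1.
Proof.
move=> c0; under eq_bigr do rewrite expr_div_n.
rewrite -mulr_suml ler_pdivrMr ?mul1r ?exprn_gt0 ?smooth_norm_gt0//.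
by rewrite (smooth_norm_sq _ (ltW c0)) lerDl ltW.
Qed.

Lemma smooth_dir_le1 c S i : 0 < c -> `|smooth_dir c S i| <= 1.
Proof.
move=> c0; rewrite -(@ler_pXn2r _ 2)// ?nnegrE// expr1n real_normK ?num_real//.
apply: le_trans (smooth_dir_sum S c0).
by rewrite (bigD1 i)//= lerDl sumr_ge0// => k _; exact: sqr_ge0.
Qed.

(* concavity of the square root *)
Lemma smooth_normD c S B : 0 < c -> smooth_norm c (fun i => S i + B i) <=
  smooth_norm c S + \sum_i smooth_dir c S i * B i
    + (\sum_i B i ^+ 2) / (2 * Num.sqrt c).
Proof.
move=> c0; set x := smooth_norm c S; set b2 := \sum_i B i ^+ 2.
have x0 : 0 < x by exact: smooth_norm_gt0.
have sc0 : 0 < Num.sqrt c by rewrite sqrtr_gt0.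
have b20 : 0 <= b2 by rewrite sumr_ge0// => i _; exact: sqr_ge0.
set y := \sum_i smooth_dir c S i * B i.
have yE : \sum_i S i * B i = x * y.
  rewrite mulr_sumr; apply: eq_bigr => i _; rewrite /smooth_dir -/x.
  by rewrite mulrA mulrCA mulfV ?mulr1// gt_eqF.
have E2 : smooth_norm c (fun i => S i + B i) ^+ 2 = x ^+ 2 + 2 * x * y + b2.
  rewrite !(smooth_norm_sq _ (ltW c0)) -mulrA -yE mulr_sumr /b2.
  under eq_bigr do rewrite sqrrD; rewrite !big_split/=.
  by rewrite -mulr_sumr; ring.
apply: (@le_trans _ _ (x + y + b2 / (2 * x))); last first.
  rewrite lerD2l ler_wpM2l// lef_pV2 ?posrE ?mulr_gt0//.
  by rewrite ler_pM2l// smooth_norm_ge.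
have z0 := smooth_norm_gt0 (fun i => S i + B i) c0.
move: E2 z0; set z := smooth_norm _ _ => E2 z0.
have -> : x + y + b2 / (2 * x) = (z ^+ 2 + x ^+ 2) / (2 * x).
  by rewrite E2; field; rewrite gt_eqF.
rewrite ler_pdivlMr ?mulr_gt0//.
by have := sqr_ge0 (z - x); rewrite sqrrB; lra.
Qed.

(** The expansion isolates three quantities whose conditional means are under control for a block
    [B]: a linear form, nearly centered; [|B|^2], governed by the trace of the covariances; the
    square of a linear form with coefficients of norm at most 1, governed by their operator norm.
    The square of the curvature term is absorbed in [|B|^2] because [|B| <= beta]. *)
Lemma expR_smooth_normD c theta beta S B : 0 < c -> 0 <= theta -> 0 < beta ->
  \sum_i B i ^+ 2 <= beta ^+ 2 ->
  theta * (beta + beta ^+ 2 / (2 * Num.sqrt c)) <= 2^-1 ->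
  expR (theta * (smooth_norm c (fun i => S i + B i) - smooth_norm c S)) <=
  1 + theta * \sum_i smooth_dir c S i * B i
    + (theta / (2 * Num.sqrt c) + theta ^+ 2 * beta ^+ 2 / c) * \sum_i B i ^+ 2
    + 4 * theta ^+ 2 * (\sum_i smooth_dir c S i * B i) ^+ 2.
Proof.
move=> c0 th0 be0 Bbe thbe.
have sc0 : 0 < Num.sqrt c by rewrite sqrtr_gt0.
have := smooth_normD S B c0; have := smooth_dir_sum S c0.
set u := \sum_i smooth_dir c S i * B i; set b2 := \sum_i B i ^+ 2 in Bbe *.
set u2 := \sum_i _ => u21 zle.
have b20 : 0 <= b2 by rewrite sumr_ge0// => i _; exact: sqr_ge0.
have ule : u <= beta.
  suff : 2 * (beta * u) <= beta ^+ 2 * u2 + b2.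
    have : beta ^+ 2 * u2 <= beta ^+ 2 by rewrite ler_piMr ?sqr_ge0.
    by move=> h1 h2; rewrite -(ler_pM2l be0) -expr2; lra.
  rewrite /u /u2 /b2 !mulr_sumr -big_split/=; apply: ler_sum => i _.
  have := sqr_ge0 (beta * smooth_dir c S i - B i); rewrite sqrrB exprMn.
  by rewrite -mulrnAr; lra.
set w := b2 / (2 * Num.sqrt c).
have w0 : 0 <= w by rewrite divr_ge0// mulr_ge0// ltW.
have wle : w <= beta ^+ 2 / (2 * Num.sqrt c).
  by rewrite ler_wpM2r// invr_ge0 mulr_ge0// ltW.
apply: (@le_trans _ _ (expR (theta * (u + w)))).
  by rewrite ler_expR ler_wpM2l// lerBlDl addrA.
apply: le_trans (expR_le_quad _) _.
  by apply: le_trans thbe; rewrite ler_wpM2l// lerD.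
have w2 : 4 * w ^+ 2 <= beta ^+ 2 / c * b2.
  have -> : w ^+ 2 = b2 ^+ 2 / (4 * c).
    by rewrite expr_div_n exprMn (sqr_sqrtr (ltW c0)) -natrX.
  rewrite mulrA ler_pdivrMr ?mulr_gt0//.
  have -> : beta ^+ 2 / c * b2 * (4 * c) = 4 * (beta ^+ 2 * b2).
    by field; rewrite gt_eqF.
  suff : b2 ^+ 2 <= beta ^+ 2 * b2 by lra.
  by rewrite expr2 ler_wpM2r.
have th2 : 0 <= theta ^+ 2 by exact: sqr_ge0.
have := ler_wpM2l th2 w2; have := mulr_ge0 th2 (sqr_ge0 (u - w)).
have -> : (theta / (2 * Num.sqrt c) + theta ^+ 2 * beta ^+ 2 / c) * b2 =
  theta * w + theta ^+ 2 * (beta ^+ 2 / c * b2) by rewrite /w; field; rewrite !gt_eqF.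
lra.
Qed.

(** With [t = theta * (x - a)], the excess [x^2 - a^2 = 2 a (x - a) + (x - a)^2] is a quadratic
    polynomial in [t], and [t <= exp t], [t^2 <= 4 exp t] for positive [t]. *)
Lemma excess_le c theta a S : 0 < c -> 0 < theta -> 0 <= a ->
  Num.max 0 (\sum_i S i ^+ 2 - a ^+ 2) <=
  (2 * a / theta + 4 / theta ^+ 2) * expR (theta * (smooth_norm c S - a)).
Proof.
move=> c0 th0 a0; set x := smooth_norm c S.
have rhs0 : 0 <= (2 * a / theta + 4 / theta ^+ 2) * expR (theta * (x - a)).
  by rewrite mulr_ge0 ?expR_ge0// addr_ge0 ?divr_ge0 ?mulr_ge0 ?sqr_ge0 ?(ltW th0).
rewrite ge_max rhs0/=.
apply: (@le_trans _ _ (x ^+ 2 - a ^+ 2)).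
  by rewrite lerD2r (smooth_norm_sq _ (ltW c0)) lerDl ltW.
have x0 : 0 < x by exact: smooth_norm_gt0.
have [xa|ax] := leP x a.
  apply: le_trans rhs0; rewrite subr_le0.
  by rewrite ler_pXn2r ?nnegrE// ltW.
set e := expR _; set t := theta * (x - a).
have t0 : 0 < t by rewrite mulr_gt0// subr_gt0.
have e1 : t <= e by have := expR_ge1Dx t; rewrite -/e; lra.
have e2 : t ^+ 2 <= 4 * e.
  have -> : e = expR (t / 2) ^+ 2 by rewrite -expRM_natl -mulr_natl mulrC divfK.
  have := expR_ge1Dx (t / 2) => h.
  have : (t / 2) ^+ 2 <= expR (t / 2) ^+ 2.
    by rewrite ler_pXn2r ?nnegrE ?expR_ge0//; lra.
  by rewrite expr_div_n -natrX; lra.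
have -> : x ^+ 2 - a ^+ 2 = 2 * a / theta * t + t ^+ 2 / theta ^+ 2.
  by rewrite /t; field; rewrite gt_eqF.
rewrite [leRHS]mulrDl; apply: lerD.
  by rewrite ler_wpM2l// divr_ge0 ?mulr_ge0 ?(ltW th0).
by rewrite [leRHS]mulrAC ler_wpM2r// invr_ge0 sqr_ge0.
Qed.

End smoothed_norm.

(** The argument of [w] is the distance between [j] and [k]; each positive distance occurs at most
    twice. *)
Lemma sum_nat_dist (R : realType) (w : nat -> R) (W : R) (s t k : nat) :
  (forall i, 0 <= w i) -> (forall N, w 0 + 2 * \sum_(1 <= i < N.+1) w i <= W) ->
  \sum_(s <= j < t) w (maxn j k - minn j k)%N <= W.
Proof.
move=> w0 hW.
pose S N := \sum_(1 <= i < N.+1) w i.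
have Smono a b : (a <= b)%N -> S a <= S b.
  move=> ab; rewrite /S (@big_cat_nat _ _ _ a.+1 1 b.+1)//= lerDl.
  by rewrite sumr_ge0.
have below s' : (s' <= k)%N -> \sum_(s' <= j < k) w (k - j)%N <= S k.
  move=> s'k; rewrite big_nat_rev/= -{1}(add0n s') big_addn.
  rewrite big_mkord (eq_bigr (fun i : 'I__ => w i.+1)); last first.
    move=> i _; congr w; have := ltn_ord i; lia.
  rewrite -(big_mkord xpredT (fun i => w i.+1)) /S big_add1 /=.
  by rewrite (@big_cat_nat _ _ _ (k - s') 0 k) ?leq_subr//= lerDl sumr_ge0.
have above t' : (k <= t')%N -> \sum_(k.+1 <= j < t'.+1) w (j - k)%N <= S (t' - k)%N.
  move=> kt; rewrite -{1}(add1n k) big_addn.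
  rewrite /S subSn//=; apply: ler_sum_nat => i _.
  by rewrite addnK.
(* [k] may lie outside the range of summation; enlarging the range to contain it adds nonnegative
   terms. *)
pose t' := maxn t k.+1; pose s' := minn s k.
apply: (@le_trans _ _ (\sum_(s' <= j < t') w (maxn j k - minn j k)%N)).
  have [st|ts] := leqP s t; last first.
    by rewrite big_geq ?(ltnW ts)// sumr_ge0.
  rewrite (@big_cat_nat _ _ _ s s' t') ?geq_minl//=; last first.
    by rewrite (leq_trans st)// leq_maxl.
  rewrite (@big_cat_nat _ _ _ t s t') ?leq_maxl//=.
  by rewrite addrCA lerDl addr_ge0// sumr_ge0.
rewrite (@big_cat_nat _ _ _ k s' t') ?geq_minr//=; last first.
  by rewrite (leq_trans (leqnSn k))// leq_maxr.
rewrite (@big_ltn _ _ _ k t') ?leq_maxr//=.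
rewrite maxnn minnn subnn.
have -> : \sum_(s' <= j < k) w (maxn j k - minn j k)%N = \sum_(s' <= j < k) w (k - j)%N.
  rewrite !big_nat; apply: eq_bigr => j /andP[_ jk].
  by rewrite (maxn_idPr (ltnW jk)) (minn_idPl (ltnW jk)).
have -> : \sum_(k.+1 <= j < t') w (maxn j k - minn j k)%N =
    \sum_(k.+1 <= j < t') w (j - k)%N.
  rewrite !big_nat; apply: eq_bigr => j /andP[kj _].
  by rewrite (maxn_idPl (ltnW kj)) (minn_idPr (ltnW kj)).
have t'E : t' = (t'.-1).+1 by rewrite prednK// (leq_trans _ (leq_maxr _ _)).
have kt' : (k <= t'.-1)%N by rewrite -ltnS -t'E leq_maxr.
have := below s' (geq_minr _ _); have := above _ kt'; rewrite -t'E.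
have := hW (maxn k (t'.-1 - k)); rewrite -/(S _).
have := Smono _ _ (leq_maxl k (t'.-1 - k)); have := Smono _ _ (leq_maxr k (t'.-1 - k)).
lra.
Qed.

Lemma indic01 (T : Type) (R : numDomainType) (A : set T) w : 0 <= (\1_A w : R) <= 1.
Proof. by rewrite indicE; case: (w \in A); rewrite ?lexx ?ler01. Qed.

(** * Block recursion under abstract conditional mixing *)

Section block.
Context (R : realType) (d : measure_display) (T : measurableType d).
Variables (P : probability T R) (G : nat -> set (set T)).
Hypothesis Gm : forall k, <<s G k >> `<=` @measurable _ T.
Hypothesis Gmono : forall j k, (j <= k)%N -> <<s G j >> `<=` <<s G k >>.
Local Notation TG k := (g_sigma_algebraType (G k)).
Variables (D : nat) (X : nat -> 'I_D -> T -> R) (good : nat -> set T).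
Hypothesis bX : forall k l, (0 < k)%N -> @bmeas _ (TG k) R (X k l).
Variables (K del : R) (q : nat) (cov : nat -> 'I_D -> 'I_D -> R).
Hypotheses (K0 : 0 <= K) (del0 : 0 <= del) (q0 : (0 < q)%N).
Hypothesis mix1 : forall j k F, (j + q <= k)%N -> @bmeas _ (TG j) R F ->
  (forall w, F w != 0 -> good j w) -> forall l,
  `|\int[P]_w (F w * X k l w)| <= K * del * \int[P]_w `|F w|.
Hypothesis mix2 : forall j k i F, (j + q <= k)%N -> @bmeas _ (TG j) R F ->
  (forall w, F w != 0 -> good j w) -> forall l l',
  `|\int[P]_w (F w * (X k l w * X (k + i)%N l' w)) - \int[P]_w F w * cov i l l'| <=
  K ^+ 2 * del * \int[P]_w `|F w|.

Let bT j F : @bmeas _ (TG j) R F -> @bmeas _ T R F.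
Proof. exact: sub_bmeas. Qed.

Let bXT k l : (0 < k)%N -> @bmeas _ T R (X k l).
Proof. by move=> k0; apply: bT; exact: bX. Qed.

Section one_block.
Variables (j s t : nat) (F : T -> R).
Hypotheses (js : (j + q <= s)%N) (ts : (t <= s + q)%N).
Hypothesis bF : @bmeas _ (TG j) R F.
Hypothesis F0 : forall w, 0 <= F w.
Hypothesis Fgood : forall w, F w != 0 -> good j w.

Let EF := \int[P]_w F w.
Let EF0 : 0 <= EF. Proof. exact: Rintegral_ge0. Qed.

Definition block_sum l w := \sum_(s <= k < t) X k l w.

(** [bmeas_sum] asks for every index, while [X k] is controlled for positive [k] only; within the
    block the test is always true. *)
Let bXs k l : @bmeas _ T R (fun w => if (s <= k)%N then X k l w else 0).
Proof.
case sk: (s <= k)%N => //; apply: bXT.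
by rewrite (leq_trans _ (leq_trans js sk))// addn_gt0 q0 orbT.
Qed.

Let block_sumE l w :
  block_sum l w = \sum_(s <= k < t) if (s <= k)%N then X k l w else 0.
Proof. by rewrite /block_sum !big_nat; apply: eq_bigr => k /andP[->]. Qed.

Let bB l : @bmeas _ T R (block_sum l).
Proof.
rewrite (_ : block_sum l = fun w => \sum_(s <= k < t) if (s <= k)%N then X k l w else 0).
  exact: bmeas_sum.
by apply/funext => w; exact: block_sumE.
Qed.

Let bF_mul a : @bmeas _ (TG j) R a -> (forall w, `|a w| <= 1) ->
  @bmeas _ (TG j) R (fun w => F w * a w) /\
  \int[P]_w `|F w * a w| <= EF.
Proof.
move=> ba a1; have bFa := bmeasM bF ba; split => //.
apply: le_bRintegral => //; first by apply: bmeas_norm; exact: bT bFa.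
  exact: bT bF.
by move=> w; rewrite normrM ger0_norm// ler_piMr.
Qed.

Lemma block_linear (u : 'I_D -> T -> R) :
  (forall l, @bmeas _ (TG j) R (u l)) -> (forall l w, `|u l w| <= 1) ->
  `|\int[P]_w (F w * \sum_l u l w * block_sum l w)| <=
  D%:R * q%:R * (K * del) * EF.
Proof.
move=> bu u1.
have -> : \int[P]_w (F w * \sum_l u l w * block_sum l w) = \sum_l \sum_(s <= k < t)
    \int[P]_w (F w * u l w * if (s <= k)%N then X k l w else 0).
  under eq_Rintegral do rewrite mulr_sumr.
  rewrite bRintegral_sum//; last first.
    by move=> l; apply: bmeasM (bT bF) _; apply: bmeasM (bT (bu l)) _.
  apply: eq_bigr => l _; rewrite -bRintegral_sum//; last first.
    by move=> k; apply: bmeasM => //; apply: bmeasM; [exact: bT bF|exact: bT (bu l)].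
  by apply: eq_Rintegral => w _; rewrite block_sumE mulrA mulr_sumr.
apply: le_trans (ler_norm_sum _ _ _) _.
have -> : D%:R * q%:R * (K * del) * EF = \sum_(l < D) q%:R * (K * del * EF).
  by rewrite sumr_const card_ord -mulr_natl; ring.
apply: ler_sum => l _; apply: le_trans (ler_norm_sum _ _ _) _.
apply: (@le_trans _ _ (\sum_(s <= k < t) K * del * EF)); last first.
  rewrite sumr_const_nat -[leLHS]mulr_natl; apply: ler_wpM2r; first by rewrite !mulr_ge0.
  rewrite ler_nat.
  by rewrite leq_subLR.
rewrite big_nat [leRHS]big_nat; apply: ler_sum => k /andP[sk kt]; rewrite sk.
have [bFu leFu] := bF_mul (bu l) (u1 l).
apply: le_trans (mix1 (leq_trans js sk) bFu _ _) _.
  by move=> w; rewrite mulf_eq0 negb_or => /andP[/Fgood].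
by rewrite ler_wpM2l ?mulr_ge0.
Qed.

(** For each of the at most [q] indices [k] of the block, the covariances with all the others sum to
    at most [W], and replacing the products by covariances costs the last term. [mix2] knows the
    earlier factor first, so the pairs in reverse order are handled by the symmetry of [a]. *)
Lemma block_quadratic (a : 'I_D -> 'I_D -> T -> R) (wt : nat -> R) (W : R) :
  (forall l l', @bmeas _ (TG j) R (a l l')) -> (forall l l' w, `|a l l' w| <= 1) ->
  (forall l l' w, a l l' w = a l' l w) ->
  (forall i w, \sum_l \sum_l' a l l' w * cov i l l' <= wt i) ->
  (forall i, 0 <= wt i) -> (forall N, wt 0 + 2 * \sum_(1 <= i < N.+1) wt i <= W) ->
  \int[P]_w (F w * \sum_l \sum_l' a l l' w * (block_sum l w * block_sum l' w)) <=
  (q%:R * W + D%:R ^+ 2 * q%:R ^+ 2 * (K ^+ 2 * del)) * EF.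
Proof.
move=> ba a1 asym acov wt0 wtW.
pose Xs k l w := if (s <= k)%N then X k l w else 0.
have bFa l l' : @bmeas _ (TG j) R (fun w => F w * a l l' w) by exact: bmeasM.
have bterm l l' k k' :
    @bmeas _ T R (fun w => F w * a l l' w * (Xs k l w * Xs k' l' w)).
  by apply: bmeasM; [exact: bT (bFa l l')|apply: bmeasM; exact: bXs].
pose m k k' l l' := if (k <= k')%N then cov (k' - k) l l' else cov (k - k') l' l.
have -> : \int[P]_w (F w * \sum_l \sum_l' a l l' w * (block_sum l w * block_sum l' w)) =
    \sum_(s <= k < t) \sum_(s <= k' < t) \sum_l \sum_l'
      \int[P]_w (F w * a l l' w * (Xs k l w * Xs k' l' w)).
  transitivity (\int[P]_w \sum_(s <= k < t) \sum_(s <= k' < t) \sum_l \sum_l'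
      (F w * a l l' w * (Xs k l w * Xs k' l' w))); last first.
    rewrite bRintegral_sum//; last first.
      by move=> k; do 3 apply: bmeas_sum => ?.
    apply: eq_bigr => k _; rewrite bRintegral_sum//; last first.
      by move=> k'; do 2 apply: bmeas_sum => ?.
    apply: eq_bigr => k' _; rewrite bRintegral_sum//; last first.
      by move=> l; apply: bmeas_sum => ?.
    by apply: eq_bigr => l _; rewrite bRintegral_sum.
  apply: eq_Rintegral => w _.
  transitivity (\sum_l \sum_l' \sum_(s <= k < t) \sum_(s <= k' < t)
      F w * a l l' w * (Xs k l w * Xs k' l' w)).
    rewrite mulr_sumr; apply: eq_bigr => l _.
    rewrite mulr_sumr; apply: eq_bigr => l' _.
    rewrite !block_sumE mulrA big_distrl/= mulr_sumr.
    by apply: eq_bigr => k _; rewrite mulr_sumr mulr_sumr.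
  under eq_bigr do rewrite exchange_big/=.
  rewrite exchange_big/=; apply: eq_bigr => k _.
  under eq_bigr do rewrite exchange_big/=.
  by rewrite exchange_big.
have key k k' l l' : (s <= k)%N -> (s <= k')%N ->
    \int[P]_w (F w * a l l' w * (Xs k l w * Xs k' l' w)) <=
    \int[P]_w (F w * a l l' w) * m k k' l l' + K ^+ 2 * del * EF.
  move=> sk sk'; rewrite /Xs sk sk' /m.
  have [_ leFa] := bF_mul (ba l l') (a1 l l').
  have Fag w : F w * a l l' w != 0 -> good j w.
    by rewrite mulf_eq0 negb_or => /andP[/Fgood].
  rewrite -lerBlDl; apply: (@le_trans _ _ (K ^+ 2 * del * \int[P]_w `|F w * a l l' w|)); last first.
    by rewrite ler_wpM2l// mulr_ge0// exprn_ge0.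
  apply: le_trans (ler_norm _) _.
  have [kk'|k'k] := leqP k k'.
    by have := mix2 (k' - k) (leq_trans js sk) (bFa l l') Fag l l'; rewrite subnKC.
  have := mix2 (k - k') (leq_trans js sk') (bFa l l') Fag l' l.
  rewrite subnKC ?(ltnW k'k)//.
  by under eq_Rintegral do rewrite [X k' l' _ * _]mulrC.
have mb k k' : \sum_l \sum_l' \int[P]_w (F w * a l l' w) * m k k' l l' <=
    EF * wt (maxn k' k - minn k' k)%N.
  have -> : \sum_l \sum_l' \int[P]_w (F w * a l l' w) * m k k' l l' =
      \int[P]_w (F w * \sum_l \sum_l' a l l' w * m k k' l l').
    have bt l l' : @bmeas _ T R (fun w => m k k' l l' * (F w * a l l' w)).
      by apply: bmeasZ; exact: bT (bFa l l').
    transitivity (\int[P]_w \sum_l \sum_l' m k k' l l' * (F w * a l l' w)).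
      rewrite bRintegral_sum//; last by move=> l; exact: bmeas_sum.
      apply: eq_bigr => l _; rewrite bRintegral_sum//; apply: eq_bigr => l' _.
      by rewrite bRintegralZ// 1?mulrC//; exact: bT (bFa l l').
    apply: eq_Rintegral => w _; rewrite mulr_sumr; apply: eq_bigr => l _.
    by rewrite mulr_sumr; apply: eq_bigr => l' _; ring.
  rewrite mulrC -bRintegralZ//; last exact: bT bF.
  apply: le_bRintegral => //.
  - apply: bmeasM (bT bF) _; apply: bmeas_sum => l; apply: bmeas_sum => l'.
    by apply: bmeasM => //; exact: bT (ba l l').
  - by apply: bmeasZ; exact: bT bF.
  move=> w; rewrite mulrC ler_wpM2r// /m.
  have [kk'|k'k] := leqP k k'; first exact: acov.
  apply: le_trans (acov _ w); rewrite exchange_big/=.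
  by apply: ler_sum => l _; apply: ler_sum => l' _; rewrite asym.
apply: (@le_trans _ _ (\sum_(s <= k < t) \sum_(s <= k' < t)
    (EF * wt (maxn k' k - minn k' k)%N + D%:R ^+ 2 * (K ^+ 2 * del * EF)))).
  rewrite big_nat [leRHS]big_nat; apply: ler_sum => k /andP[sk _].
  rewrite big_nat [leRHS]big_nat; apply: ler_sum => k' /andP[sk' _].
  apply: (@le_trans _ _ (\sum_l \sum_l' (\int[P]_w (F w * a l l' w) * m k k' l l' + K ^+ 2 * del * EF))).
    by apply: ler_sum => l _; apply: ler_sum => l' _; exact: key.
  under eq_bigr do rewrite big_split/=.
  rewrite big_split/=; apply: lerD; first exact: mb.
  by rewrite !sumr_const !card_ord -mulrnA -[leLHS]mulr_natl natrM expr2 lexx.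
under eq_bigr do rewrite big_split/=.
rewrite big_split/= mulrDl; apply: lerD.
  apply: (@le_trans _ _ (\sum_(s <= k < t) EF * W)).
    by apply: ler_sum => k _; rewrite -mulr_sumr ler_wpM2l// sum_nat_dist.
  have W0 : 0 <= W.
    by apply: le_trans (wtW 0); rewrite big_geq// mulr0 addr0.
  rewrite sumr_const_nat -[leLHS]mulr_natl [EF * W]mulrC -[leRHS]mulrA.
  apply: ler_wpM2r; first exact: mulr_ge0.
  by rewrite ler_nat leq_subLR.
rewrite !sumr_const_nat -mulrnA -[leLHS]mulr_natl natrM -expr2.
rewrite [leRHS](_ : _ = q%:R ^+ 2 * (D%:R ^+ 2 * (K ^+ 2 * del * EF))); last by ring.
rewrite ler_wpM2r//.
  by rewrite !mulr_ge0// exprn_ge0.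
by rewrite -!natrX ler_nat leq_exp2r// leq_subLR.
Qed.

End one_block.

Section recursion.
Variables (Tr v beta0 c theta : R) (wtT wtV : nat -> R).
Hypotheses (wtT0 : forall i, 0 <= wtT i) (wtV0 : forall i, 0 <= wtV i).
Hypothesis wtT_sum : forall N, wtT 0 + 2 * \sum_(1 <= i < N.+1) wtT i <= Tr.
Hypothesis wtV_sum : forall N, wtV 0 + 2 * \sum_(1 <= i < N.+1) wtV i <= v.
Hypothesis cov_trace : forall i, \sum_l cov i l l <= wtT i.
Hypothesis cov_weak : forall i (u : 'I_D -> R), \sum_l u l ^+ 2 <= 1 ->
  \sum_l \sum_l' u l * u l' * cov i l l' <= wtV i.
Hypothesis beta0_gt0 : 0 < beta0.
Hypothesis Xbound : forall k w, (0 < k)%N -> \sum_l X k l w ^+ 2 <= beta0 ^+ 2.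
Hypotheses (c0 : 0 < c) (theta0 : 0 <= theta).

Let beta := q%:R * beta0.
Hypothesis theta_small : theta * (beta + beta ^+ 2 / (2 * Num.sqrt c)) <= 2^-1.

Let beta_gt0 : 0 < beta. Proof. by rewrite mulr_gt0// ltr0n. Qed.

Lemma block_sum_bound s t w : (0 < s)%N -> (t <= s + q)%N ->
  \sum_l block_sum s t l w ^+ 2 <= beta ^+ 2.
Proof.
move=> s0 ts; pose N2 k := \sum_l X k l w ^+ 2.
apply: (@le_trans _ _ (\sum_(s <= k < t) \sum_(s <= k' < t) 2^-1 * (N2 k + N2 k'))).
  have -> : \sum_l block_sum s t l w ^+ 2 = \sum_(s <= k < t) \sum_(s <= k' < t)
      \sum_l X k l w * X k' l w.
    under eq_bigr do rewrite expr2 /block_sum big_distrl/=.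
    rewrite exchange_big/=; apply: eq_bigr => k _.
    by under eq_bigr do rewrite mulr_sumr; rewrite exchange_big.
  apply: ler_sum => k _; apply: ler_sum => k' _.
  rewrite /N2 -big_split mulr_sumr; apply: ler_sum => l _ /=.
  by have := sqr_ge0 (X k l w - X k' l w); rewrite sqrrB; lra.
apply: (@le_trans _ _ (\sum_(s <= k < t) \sum_(s <= k' < t) beta0 ^+ 2)).
  rewrite big_nat [leRHS]big_nat; apply: ler_sum => k /andP[sk _].
  rewrite big_nat [leRHS]big_nat; apply: ler_sum => k' /andP[sk' _].
  have := Xbound w (leq_trans s0 sk); have := Xbound w (leq_trans s0 sk').
  by rewrite /N2; lra.
rewrite !sumr_const_nat -mulrnA -[leLHS]mulr_natl natrM -expr2 /beta exprMn.
apply: ler_wpM2r; first exact: sqr_ge0.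
by rewrite -!natrX ler_nat leq_exp2r// leq_subLR.
Qed.

Let err := D%:R ^+ 2 * q%:R ^+ 2 * (K ^+ 2 * del).

(** The growth of the exponential moment per block: one summand for each term of
    [expR_smooth_normD], in the same order. *)
Definition block_rate := theta * (D%:R * q%:R * (K * del))
  + (theta / (2 * Num.sqrt c) + theta ^+ 2 * beta ^+ 2 / c) * (q%:R * Tr + err)
  + 4 * theta ^+ 2 * (q%:R * v + err).

Let Tr0 : 0 <= Tr.
Proof. by apply: le_trans (wtT_sum 0); rewrite big_geq// mulr0 addr0. Qed.

Let v0 : 0 <= v.
Proof. by apply: le_trans (wtV_sum 0); rewrite big_geq// mulr0 addr0. Qed.

Let k1_ge0 : 0 <= theta / (2 * Num.sqrt c) + theta ^+ 2 * beta ^+ 2 / c.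
Proof.
apply: addr_ge0; apply: divr_ge0 => //; last exact: ltW.
by rewrite mulr_ge0 ?sqr_ge0.
Qed.

Lemma block_rate_ge0 : 0 <= block_rate.
Proof.
have err0 : 0 <= err by rewrite !mulr_ge0// exprn_ge0.
by rewrite /block_rate !addr_ge0// !mulr_ge0// ?sqr_ge0// addr_ge0// mulr_ge0.
Qed.

Let bsmooth j (S : 'I_D -> T -> R) : (forall l, @bmeas _ (TG j) R (S l)) ->
  @bmeas _ (TG j) R (fun w => smooth_norm c (S ^~ w)).
Proof.
move=> bS; apply: bmeas_sqrt; apply: bmeasD => //.
by apply: bmeas_sum => l; under eq_fun do rewrite expr2; exact: bmeasM.
Qed.

Let bdir j (S : 'I_D -> T -> R) l : (forall l, @bmeas _ (TG j) R (S l)) ->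
  @bmeas _ (TG j) R (fun w => smooth_dir c (S ^~ w) l).
Proof.
move=> bS; split; last by exists 1 => w; exact: smooth_dir_le1.
apply: measurable_funM; first by case: (bS l).
(* The norm is positive, so its inverse is a real power of it, which is measurable. *)
have -> : (fun w => (smooth_norm c (S ^~ w))^-1) =
    (fun w => smooth_norm c (S ^~ w) `^ (-1)).
  by apply/funext => w; rewrite powR_inv1// ltW// smooth_norm_gt0.
exact: (measurableT_comp (measurable_powR (-1)) (bsmooth bS).1).
Qed.

Lemma block_step j s t F (S : 'I_D -> T -> R) :
  (j + q <= s)%N -> (t <= s + q)%N -> @bmeas _ (TG j) R F ->
  (forall w, 0 <= F w) -> (forall w, F w != 0 -> good j w) ->
  (forall l, @bmeas _ (TG j) R (S l)) ->
  \int[P]_w (F w * expR (theta *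
     (smooth_norm c (fun l => S l w + block_sum s t l w) - smooth_norm c (S ^~ w))))
  <= (1 + block_rate) * \int[P]_w F w.
Proof.
move=> js ts bF F0 Fg bS; set EF := \int[P]_w F w.
have s0 : (0 < s)%N by rewrite (leq_trans _ js)// addn_gt0 q0 orbT.
pose u l w := smooth_dir c (S ^~ w) l.
have bu l : @bmeas _ (TG j) R (u l) by exact: bdir.
have u1 l w : `|u l w| <= 1 by exact: smooth_dir_le1.
have bX' k l : @bmeas _ T R (fun w => if (0 < k)%N then X k l w else 0).
  by case k0: (0 < k)%N => //; exact: bXT.
have bB l : @bmeas _ T R (block_sum s t l).
  rewrite (_ : block_sum s t l =
      fun w => \sum_(s <= k < t) if (0 < k)%N then X k l w else 0).
    exact: bmeas_sum.
  apply/funext => w; rewrite /block_sum !big_nat; apply: eq_bigr => k /andP[sk _].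
  by rewrite (leq_trans s0 sk).
pose A w := \sum_l u l w * block_sum s t l w.
pose Q (a : 'I_D -> 'I_D -> T -> R) w :=
  \sum_l \sum_l' a l l' w * (block_sum s t l w * block_sum s t l' w).
(* The two matrices given to [block_quadratic]: the identity produces [|B|^2], and the rank one
   matrix [a2] the square of the linear term. *)
pose a1 (l l' : 'I_D) (_ : T) : R := (l == l')%:R.
pose a2 l l' w := u l w * u l' w.
have ba1 l l' : @bmeas _ (TG j) R (a1 l l') by [].
have ba2 l l' : @bmeas _ (TG j) R (a2 l l') by exact: bmeasM.
have Q1E w : Q a1 w = \sum_l block_sum s t l w ^+ 2.
  apply: eq_bigr => l _; rewrite (bigD1 l)//= /a1 eqxx mul1r big1 ?addr0 ?expr2//.
  by move=> l' l'l; rewrite eq_sym (negbTE l'l) mul0r.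
have Q2E w : Q a2 w = A w ^+ 2.
  rewrite expr2 /A big_distrl/=; apply: eq_bigr => l _.
  by rewrite mulr_sumr; apply: eq_bigr => l' _; rewrite /a2; ring.
have bFT := bT bF.
have bA : @bmeas _ T R (fun w => F w * A w).
  by apply: bmeasM => //; apply: bmeas_sum => l; apply: bmeasM => //; exact: bT (bu l).
have bQ a : (forall l l', @bmeas _ (TG j) R (a l l')) -> @bmeas _ T R (fun w => F w * Q a w).
  move=> ba; apply: bmeasM => //; apply: bmeas_sum => l; apply: bmeas_sum => l'.
  by apply: bmeasM; [exact: bT (ba l l')|exact: bmeasM].
set k1 := theta / (2 * Num.sqrt c) + theta ^+ 2 * beta ^+ 2 / c.
set k2 := 4 * theta ^+ 2.
have k10 : 0 <= k1 by exact: k1_ge0.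
have k20 : 0 <= k2 by rewrite mulr_ge0 ?sqr_ge0.
have bR : @bmeas _ T R (fun w => F w + theta * (F w * A w) + k1 * (F w * Q a1 w)
    + k2 * (F w * Q a2 w)).
  by do !apply: bmeasD => //; apply: bmeasZ => //; exact: bQ.
apply: (@le_trans _ _ (\int[P]_w (F w + theta * (F w * A w) + k1 * (F w * Q a1 w)
    + k2 * (F w * Q a2 w)))).
  apply: le_bRintegral => //.
    apply: bmeasM => //; apply: bmeas_expR; apply: bmeasZ; apply: bmeasB.
      apply: bmeas_sqrt; apply: bmeasD => //; apply: bmeas_sum => l.
      have bSB : @bmeas _ T R (fun w => S l w + block_sum s t l w).
        by apply: bmeasD => //; exact: bT (bS l).
      by under eq_fun do rewrite expr2; exact: bmeasM.
    exact: (bT (bsmooth bS)).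
  move=> w; rewrite (_ : _ + _ + _ + _ =
      F w * (1 + theta * A w + k1 * Q a1 w + k2 * Q a2 w)); last by ring.
  rewrite ler_wpM2l// Q1E Q2E /A /u.
  apply: expR_smooth_normD => //.
  exact: block_sum_bound.
have i1 : @bmeas _ T R (fun w => theta * (F w * A w)) by exact: bmeasZ.
have i2 : @bmeas _ T R (fun w => k1 * (F w * Q a1 w)) by apply: bmeasZ; exact: bQ.
have i3 : @bmeas _ T R (fun w => k2 * (F w * Q a2 w)) by apply: bmeasZ; exact: bQ.
rewrite bRintegralD//; last by do !apply: bmeasD.
rewrite bRintegralD//; last by do !apply: bmeasD.
rewrite bRintegralD// !bRintegralZ//; last 2 first.
- exact: bQ.
- exact: bQ.
have hA := block_linear js ts bF F0 Fg bu u1.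
have hQ1 : \int[P]_w (F w * Q a1 w) <= (q%:R * Tr + err) * EF.
  apply: (block_quadratic js ts bF F0 Fg ba1 _ _ _ wtT0 wtT_sum).
  - by move=> l l' w; rewrite /a1; case: eqP; rewrite ?normr1 ?normr0.
  - by move=> l l' w; rewrite /a1 eq_sym.
  - move=> i w; apply: le_trans (cov_trace i); apply: ler_sum => l _.
    rewrite (bigD1 l)//= /a1 eqxx mul1r big1 ?addr0//.
    by move=> l' l'l; rewrite eq_sym (negbTE l'l) mul0r.
have hQ2 : \int[P]_w (F w * Q a2 w) <= (q%:R * v + err) * EF.
  apply: (block_quadratic js ts bF F0 Fg ba2 _ _ _ wtV0 wtV_sum).
  - by move=> l l' w; rewrite /a2 normrM mulr_ile1.
  - by move=> l l' w; rewrite /a2 mulrC.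
  - by move=> i w; apply: cov_weak; exact: smooth_dir_sum.
have hA' : theta * \int[P]_w (F w * A w) <= theta * (D%:R * q%:R * (K * del) * EF).
  by rewrite ler_wpM2l// (le_trans (ler_norm _)).
have := ler_wpM2l k10 hQ1; have := ler_wpM2l k20 hQ2.
rewrite /block_rate -/k1 -/k2 -/EF; lra.
Qed.

Variables (s t j : nat -> nat).
Hypothesis s_gt0 : (0 < s 0)%N.
Hypothesis ts_le : forall i, (t i <= s i + q)%N.
Hypothesis tj_le : forall i, (t i <= (j i).+1)%N.
Hypothesis js_le : forall i, (j i + q <= s i.+1)%N.
Hypothesis j_mono : forall i, (j i <= j i.+1)%N.
Hypothesis good_meas : forall i, <<s G (j i) >> (good (j i)).

Let s_gt0' i : (0 < s i)%N.
Proof. by case: i => // i; rewrite (leq_trans _ (js_le i))// addn_gt0 q0 orbT. Qed.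

Definition partial_sum i l w := \sum_(0 <= i' < i) block_sum (s i') (t i') l w.

(** The indicators keep the paths whose state was good at the end of every block so far; the last
    one is what permits the mixing estimates for the next block. *)
Definition tilted i w := (\prod_(0 <= i' < i) \1_(good (j i')) w)
  * expR (theta * smooth_norm c (partial_sum i ^~ w)).

Let bmono i i' F : (i <= i')%N -> @bmeas _ (TG (j i)) R F -> @bmeas _ (TG (j i')) R F.
Proof.
move=> ii' [mF bF]; split => // _ B mB.
have jj : (j i <= j i')%N by elim: i' ii' => [|i' ih]; rewrite leq_eqVlt => /predU1P[->//|]// /ih /leq_trans; exact.
exact: (Gmono jj (mF measurableT B mB)).
Qed.

Let bblock i l : @bmeas _ (TG (j i)) R (block_sum (s i) (t i) l).
Proof.
rewrite (_ : block_sum (s i) (t i) l = fun w =>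
    \sum_(s i <= k < t i) if (0 < k <= j i)%N then X k l w else 0); last first.
  apply/funext => w; rewrite /block_sum !big_nat; apply: eq_bigr => k /andP[sk kt].
  by rewrite (leq_trans (s_gt0' i) sk) -ltnS (leq_trans kt).
apply: bmeas_sum => k; case kj : (0 < k <= j i)%N => //.
case/andP: kj => k0 kj; have [mX bdX] := bX l k0; split => // _ B mB.
exact: (Gmono kj (mX measurableT B mB)).
Qed.

Let bpartial i l : @bmeas _ (TG (j i)) R (partial_sum i.+1 l).
Proof.
rewrite (_ : partial_sum i.+1 l = fun w =>
  \sum_(0 <= i' < i.+1) if (i' <= i)%N then block_sum (s i') (t i') l w else 0).
  by apply: bmeas_sum => i'; case ii' : (i' <= i)%N => //; exact: bmono (bblock i' l).
by apply/funext => w; rewrite /partial_sum !big_nat; apply: eq_bigr => i' /andP[_]; rewrite ltnS => ->.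
Qed.

Let bgood i : @bmeas _ (TG (j i)) R (\1_(good (j i))).
Proof. by apply: (@bmeas_indic _ (TG (j i)) R); exact: good_meas. Qed.

Let bprod i : @bmeas _ (TG (j i)) R (fun w => \prod_(0 <= i' < i.+1) \1_(good (j i')) w).
Proof.
elim: i => [|i ih]; first by under eq_fun do rewrite big_nat1; exact: bgood.
under eq_fun do rewrite big_nat_recr//=.
by apply: bmeasM => //; exact: bmono ih.
Qed.

Let btilted i : @bmeas _ (TG (j i)) R (tilted i.+1).
Proof.
apply: bmeasM => //; apply: bmeas_expR; apply: bmeasZ.
by apply: bsmooth => l; exact: bpartial.
Qed.

Let prod01 i w : 0 <= (\prod_(0 <= i' < i) \1_(good (j i')) w : R) <= 1.
Proof.
apply/andP; split; first by rewrite prodr_ge0// => i' _; rewrite indicE.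
by apply: prodr_ile1 => i' _; exact: indic01.
Qed.

Let tilted_ge0 i w : 0 <= tilted i w.
Proof. by rewrite mulr_ge0 ?expR_ge0//; case/andP: (prod01 i w). Qed.

(** The first block may start at time 1, with no gap before it, so it is bounded pointwise: from the
    sum 0 the smoothed norm is [sqrt c], and [theta_small] leaves [1/2]. Every further block
    multiplies the moment by at most [1 + block_rate]. *)
Lemma tilted_bound i :
  \int[P]_w tilted i.+1 w <= expR (theta * Num.sqrt c + 2^-1 + i%:R * block_rate).
Proof.
elim: i => [|i ih].
  rewrite mul0r addr0; set x := expR _.
  rewrite -[leRHS](bRintegral_cst P); apply: le_bRintegral => //.
    exact: bT (btilted 0).
  move=> w; rewrite /tilted.
  apply: (@le_trans _ _ (1 * expR (theta * smooth_norm c (partial_sum 1 ^~ w)))).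
    by rewrite ler_wpM2r ?expR_ge0//; case/andP: (prod01 1 w).
  rewrite mul1r ler_expR.
  have -> : partial_sum 1 ^~ w = fun l => 0 + block_sum (s 0) (t 0) l w.
    by apply/funext => l; rewrite /partial_sum big_nat1 add0r.
  have sn := smooth_normD (fun=> 0) (fun l => block_sum (s 0) (t 0) l w) c0.
  apply: (le_trans (ler_wpM2l theta0 sn)).
  rewrite [\sum_i smooth_dir _ _ _ * _]big1 ?addr0; last first.
    by move=> l _; rewrite /smooth_dir !mul0r.
  rewrite /smooth_norm big1 ?add0r; last by move=> l _; rewrite expr0n.
  rewrite mulrDr lerD2l; apply: le_trans theta_small.
  rewrite ler_wpM2l// ler_wpDl ?(ltW beta_gt0)//.
  rewrite ler_wpM2r ?invr_ge0 ?mulr_ge0//.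
  exact: block_sum_bound.
apply: (@le_trans _ _ ((1 + block_rate) * \int[P]_w tilted i.+1 w)); last first.
  apply: (@le_trans _ _ (expR block_rate * expR (theta * Num.sqrt c + 2^-1 + i%:R * block_rate))).
    by apply: ler_pM => //; [rewrite addr_ge0// block_rate_ge0|exact: Rintegral_ge0|exact: expR_ge1Dx].
  by rewrite -expRD ler_expR -natr1; lra.
have Fg w : tilted i.+1 w != 0 -> good (j i) w.
  rewrite /tilted big_nat_recr//= !mulf_eq0 !negb_or => /andP[/andP[_]] + _.
  by rewrite indicE; case: (boolP (w \in good (j i))); [rewrite inE|rewrite eqxx].
apply: le_trans (block_step (js_le i) (ts_le i.+1) (btilted i) (tilted_ge0 i.+1) Fg (bpartial i)).
apply: le_bRintegral => //.
- exact: bT (btilted i.+1).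
- apply: bmeasM; first exact: bT (btilted i).
  apply: bmeas_expR; apply: bmeasZ; apply: bmeasB; last first.
    by apply: (@bT (j i)); apply: bsmooth => l; exact: bpartial.
  apply: (@bT (j i.+1)); apply: bsmooth => l; apply: bmeasD; last exact: bblock.
  by apply: bmono (bpartial i l).
move=> w; rewrite /tilted [X in X * _ <= _]big_nat_recr//=.
rewrite -mulrA -mulrA ler_wpM2l//; first by case/andP: (prod01 i.+1 w).
rewrite -expRD mulrBr addrCA addrN addr0.
have -> : partial_sum i.+2 ^~ w =
    fun l => partial_sum i.+1 l w + block_sum (s i.+1) (t i.+1) l w.
  by apply/funext => l; rewrite /partial_sum big_nat_recr.
by rewrite ler_piMl ?expR_ge0//; case/andP: (indic01 R (good (j i.+1)) w).
Qed.

(** On paths whose indicators are all 1, [excess_le] compares the excess with [tilted]. On the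
    others the excess is at most [Bm], while the count [bad] of failures is at least 1. *)
Lemma partial_sum_excess i a Bm pb : 0 < theta -> 0 <= a ->
  (forall w, \sum_l partial_sum i.+1 l w ^+ 2 <= Bm) ->
  (forall i', \int[P]_w (1 - \1_(good (j i')) w) <= pb) ->
  \int[P]_w Num.max 0 (\sum_l partial_sum i.+1 l w ^+ 2 - a ^+ 2) <=
  (2 * a / theta + 4 / theta ^+ 2)
    * expR (theta * Num.sqrt c + 2^-1 + i%:R * block_rate - theta * a)
  + Bm * (i.+1%:R * pb).
Proof.
move=> th0 a0 hBm hpb.
have Bm0 : 0 <= Bm by rewrite (le_trans _ (hBm point))// sumr_ge0// => l _; exact: sqr_ge0.
set k := 2 * a / theta + 4 / theta ^+ 2.
have k0 : 0 <= k.
  by apply: addr_ge0; apply: divr_ge0; rewrite ?mulr_ge0 ?sqr_ge0 ?(ltW th0).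
pose bad w : R := \sum_(0 <= i' < i.+1) (1 - \1_(good (j i')) w).
have bad_ge0 i' w : 0 <= 1 - \1_(good (j i')) w :> R.
  by rewrite subr_ge0; case/andP: (indic01 R (good (j i')) w).
have bad0 w : 0 <= bad w by exact: sumr_ge0.
have bgood' i' : @bmeas _ T R (fun w => 1 - \1_(good (j i')) w).
  by apply: bmeasB => //; exact: bT (bgood i').
have bbad : @bmeas _ T R bad by exact: bmeas_sum.
have bti : @bmeas _ T R (tilted i.+1) by exact: bT (btilted i).
have bps : @bmeas _ T R (fun w => \sum_l partial_sum i.+1 l w ^+ 2).
  apply: bmeas_sum => l; have := bT (bpartial i l).
  by move=> bp; under eq_fun do rewrite expr2; exact: bmeasM.
apply: (@le_trans _ _ (\int[P]_w (k * expR (- (theta * a)) * tilted i.+1 w + Bm * bad w))).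
  apply: le_bRintegral => //.
  - split; first by apply: measurable_maxr => //; apply: measurable_funB => //; case: bps.
    exists Bm => w; rewrite ger0_norm ?le_max ?lexx// ge_max Bm0/=.
    by rewrite lerBlDr (le_trans (hBm w))// lerDl sqr_ge0.
  - by apply: bmeasD; exact: bmeasZ.
  move=> w; have [/forallP gw|] := boolP [forall i' : 'I_i.+1, w \in good (j i')].
    apply: ler_wpDr; first exact: mulr_ge0.
    apply: le_trans (excess_le _ c0 th0 a0) _; rewrite -/k /tilted.
    rewrite big_mkord big1 ?mul1r; last by move=> i' _; rewrite indicE gw.
    by rewrite mulrBr addrC expRD -mulrA.
  rewrite negb_forall => /existsP[i' wi'].
  apply: ler_wpDl; first by rewrite mulr_ge0 ?tilted_ge0// mulr_ge0 ?expR_ge0.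
  apply: (@le_trans _ _ Bm).
    rewrite ge_max Bm0/= lerBlDr (le_trans (hBm w))// lerDl sqr_ge0//.
  rewrite ler_peMr// /bad big_mkord (bigD1 i')//= indicE (negbTE wi') subr0.
  by rewrite lerDl sumr_ge0.
rewrite bRintegralD//; [|exact: bmeasZ|exact: bmeasZ].
rewrite !bRintegralZ//; apply: lerD.
  rewrite -mulrA ler_wpM2l// addrC expRD ler_wpM2l ?expR_ge0//.
  exact: tilted_bound.
rewrite ler_wpM2l// /bad bRintegral_sum//.
apply: le_trans (ler_sum _ (fun i' _ => hpb i')) _.
by rewrite sumr_const_nat subn0 -[leLHS]mulr_natl.
Qed.

End recursion.
End block.

(** * Density of the pre-jump kernel *)

Section flow_density.
Context (R : realType) (phi : R -> R -> R).
Hypothesis flow : flow_conditions phi.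

Let in_Rplus (x : R) : 0 <= x -> x \in Rplus R.
Proof. by move=> x0; rewrite inE /Rplus/= in_itv/= x0. Qed.

Lemma flow_invK x t : 0 <= x -> 0 <= t -> flow_inv phi x (phi x t) = t.
Proof.
move=> x0 t0; apply: xget_unique => //= s [s0 e].
have inc := flow_increasing flow x0.
by apply/eqP; case: ltgtP => // h; have := inc _ _ (in_Rplus _) (in_Rplus _) h;
  rewrite ?e ?ltxx => ->.
Qed.

Lemma flow_surj x y : 0 <= x -> x <= y -> exists2 t, 0 <= t & phi x t = y.
Proof.
move=> x0 xy; have : (phi x @` Rplus R) y.
  by rewrite (flow_image flow x0)/= in_itv/= xy.
by move=> [t]; rewrite /Rplus/= in_itv/= andbT => t0 <-; exists t.
Qed.

Lemma flow_inv_shift z y : 0 <= z -> z <= y ->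
  flow_inv phi 0 y = flow_inv phi z y + flow_inv phi 0 z.
Proof.
move=> z0 zy; have [s s0 sz] := flow_surj (lexx 0) z0.
have [t t0 ty] := flow_surj z0 zy.
rewrite -ty flow_invK// -sz flow_invK// -(flow_semigroup flow)//.
by rewrite flow_invK// addr_ge0.
Qed.

Lemma flow_inv_incr x y y' : 0 <= x -> x <= y -> y < y' ->
  flow_inv phi x y < flow_inv phi x y'.
Proof.
move=> x0 xy yy'; have [t t0 ty] := flow_surj x0 xy.
have [t' t'0 ty'] := flow_surj x0 (le_trans xy (ltW yy')).
move: yy'; rewrite -ty -ty' !flow_invK// => h; rewrite ltNge; apply/negP => t't.
move: h; rewrite ltNge => /negP; apply.
move: t't; rewrite le_eqVlt => /predU1P[->//|/(flow_increasing flow x0 (in_Rplus t'0) (in_Rplus t0))].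
exact: ltW.
Qed.

(** [h] is the derivative of [phi_0^{-1}]. Travel times add by the semigroup property, so near a
    point above [z] the inverse flow from [z] differs from [phi_0^{-1}] by a constant; continuity
    bounds [h] on compact intervals. *)
Lemma flow_inv_density : exists h : R -> R, [/\ measurable_fun (Rplus R) h,
  forall u, 0 < u -> 0 <= h u,
  forall a b, 0 < a -> a <= b -> exists C, forall u, a <= u <= b -> h u <= C &
  forall z u, 0 <= z -> 0 < u -> flow_inv' phi z u = h u].
Proof.
have [h [cinv ch dh]] := flow_inv_C1 flow (lexx 0).
exists h; split.
- by apply: subspace_continuous_measurable_fun => //; exact: measurable_itv.
- move=> u u0; have du := dh u u0; rewrite -(@derive_val _ _ _ _ _ _ _ du) -derive1E.
  apply: (@incr_derive1_ge0_itvy _ _ false 0).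
  + by move=> x; rewrite inE/= in_itv/= andbT => x0; have [] := dh x x0.
  + move=> x y; rewrite !in_itv/= !andbT => x0 y0 xy.
    by apply: flow_inv_incr => //; exact: ltW.
  + by rewrite in_itv/= u0.
- move=> a b a0 ab.
  have chab : {within `[a, b], continuous h}.
    apply: continuous_subspaceW ch => x /=; rewrite !in_itv/= => /andP[ax _].
    by rewrite andbT (le_trans (ltW a0)).
  have [c _ hc] := EVT_max ab chab.
  by exists (h c) => u uab; apply: hc; rewrite in_itv/=.
- move=> z u z0 u0; have du := dh u u0.
  have d0 : derive1 (flow_inv phi 0) u = h u.
    by rewrite derive1E; exact: (@derive_val _ _ _ _ _ _ _ du).
  rewrite /flow_inv'; case: ifPn => // zu; rewrite -d0 !derive1E.
  have -> : 'D_1 (flow_inv phi z) u = 'D_1 (fun y => flow_inv phi 0 y - flow_inv phi 0 z) u.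
    apply: near_eq_derive; near=> y.
    rewrite (@flow_inv_shift z y)// ?addrK//.
    by apply: ltW; near: y; exact: lt_nbhsr.
  have -> : (fun y => flow_inv phi 0 y - flow_inv phi 0 z) =
    flow_inv phi 0 - cst (flow_inv phi 0 z) by [].
  by rewrite deriveB// ?derive_cst ?subr0//; have [] := du.
Unshelve. all: by end_near. Qed.

End flow_density.

Section prejump_bound.
Context (R : realType) (phi : R -> R -> R) (lam : R -> R) (PP : R.-pker R ~> R).
Variables (i1 i2 : R).
Hypotheses (i1_gt0 : 0 < i1) (i12 : i1 <= i2).
Hypothesis flow : flow_conditions phi.
Hypothesis mlam : measurable_fun (Rplus R) lam.
Hypothesis lam0 : forall x : R, 0 <= x -> 0 <= lam x.
Hypothesis PPE : prejump_kernel phi lam PP.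
Hypothesis lamI : forall x : R, 0 <= x -> x <= i1 ->
  (\int[lebesgue_measure]_(y in `[0%R, i1])
     (lam y * flow_inv' phi x y)%:E < +oo)%E.
Hypothesis lam_bounded : has_ubound (lam @` `[i1, i2]).
Local Notation leb := (@lebesgue_measure R).

Section fixed_density.
Variables (h : R -> R) (C : R).
Hypothesis mh : measurable_fun (Rplus R) h.
Hypothesis h0 : forall u : R, 0 < u -> 0 <= h u.
Hypothesis hE : forall z u : R, 0 <= z -> 0 < u -> flow_inv' phi z u = h u.
Let g u := lam u * h u.
Hypothesis C0 : 0 <= C.
Hypothesis gC : forall u, i1 <= u <= i2 -> g u <= C.

Let g0 (u : R) : 0 < u -> 0 <= g u.
Proof. by move=> u0; rewrite mulr_ge0 ?h0 ?lam0// ltW. Qed.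

Let mg (z y : R) : 0 <= z -> measurable_fun `]z, y] (EFin \o g).
Proof.
move=> z0; apply/measurable_EFinP; apply: (@measurable_funS _ _ _ _ (Rplus R)).
- exact: measurable_itv.
- move=> u; rewrite /Rplus/= !in_itv/= andbT => /andP[zu _].
  by rewrite (le_trans z0)// ltW.
- exact: measurable_funM.
Qed.

(** The cumulated rate. The interval is open on the left because [h] represents [flow_inv'] at
    positive points only and [z] may be 0. *)
Let Lam (z y : R) : \bar R := (\int[leb]_(u in `]z, y]) (g u)%:E)%E.

Let Lam_ge0 (z y : R) : 0 <= z -> (0 <= Lam z y)%E.
Proof.
move=> z0; apply: integral_ge0 => u /=; rewrite in_itv/= => /andP[zu _].
by rewrite lee_fin g0// (le_lt_trans z0).
Qed.

Let LamE (z x y : R) : 0 <= z -> 0 <= x -> (Lam x y =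
  \int[leb]_(u in `[x, y]) (lam u * flow_inv' phi z u)%:E)%E.
Proof.
move=> z0 x0; have E (u : R) : u \in `]x, y]%classic ->
    (lam u * flow_inv' phi z u)%:E = (g u)%:E.
  by rewrite inE/= in_itv/= => /andP[xu _]; rewrite hE// (le_lt_trans x0).
rewrite -integral_itv_obnd_cbnd; first exact/esym/eq_integral.
apply: (@eq_measurable_fun _ _ _ _ _ (EFin \o g)); last exact: mg.
move=> u uxy.
by rewrite /= E.
Qed.

Let tail (z y : R) : 0 <= z -> z <= y -> PP z `]y, +oo[%classic = expeR (- Lam z y)%E.
Proof. by move=> z0 zy; rewrite PPE// (LamE _ z0 z0). Qed.

Let LamD (z x y : R) : 0 <= z -> z <= x -> x <= y -> (Lam z y = Lam z x + Lam x y)%E.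
Proof.
move=> z0 zx xy; rewrite /Lam -ge0_integral_setU//=; last 3 first.
- rewrite -itv_bndbnd_setU ?bnd_simp//; exact: mg.
- move=> u; rewrite !in_itv/= => -[/andP[zu _]|/andP[xu _]]; rewrite lee_fin g0//.
    exact: le_lt_trans zu.
  by rewrite (le_lt_trans (le_trans z0 zx)).
- rewrite disj_set2E; apply/eqP/seteqP; split => // u [] /=; rewrite !in_itv/=.
  by move=> /andP[_ ux] /andP[xu _]; have := lt_le_trans xu ux; rewrite ltxx.
by rewrite -itv_bndbnd_setU ?bnd_simp.
Qed.

Let Lam_le (x y : R) : i1 <= x -> x <= y -> y <= i2 -> (Lam x y <= (C * (y - x))%:E)%E.
Proof.
move=> ix xy yi; have x0 : 0 <= x by rewrite (le_trans _ ix)// ltW.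
apply: (@le_trans _ _ (\int[leb]_(u in `]x, y]) C%:E)%E).
  apply: ge0_le_integral => //.
  - move=> u /=; rewrite in_itv/= => /andP[xu _].
    by rewrite lee_fin g0// (le_lt_trans x0).
  - exact: mg.
  - move=> u /=; rewrite in_itv/= => /andP[xu uy]; rewrite lee_fin gC//.
    by rewrite (le_trans ix (ltW xu)) (le_trans uy).
rewrite integral_cst//= lebesgue_measure_itv/= lte_fin.
case: ifPn => [_|]; first by rewrite -EFinB -EFinM.
by rewrite mule0 lee_fin mulr_ge0// subr_ge0.
Qed.

Let Lam_id (z : R) : Lam z z = 0%E.
Proof. by rewrite /Lam set_itv_ge ?integral_set0// bnd_simp ltxx. Qed.

Let PP_fin (z : R) B : measurable B -> PP z B \is a fin_num.
Proof.
move=> mB; rewrite ge0_fin_numE//; apply: (@le_lt_trans _ _ (PP z setT)).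
  by apply: le_measure => //; rewrite inE.
by rewrite prob_kernel ltry.
Qed.

Let below (z : R) : 0 <= z -> PP z `]-oo, z]%classic = 0%E.
Proof.
move=> z0; have : PP z setT = 1%E by rewrite prob_kernel.
have -> : PP z setT = (PP z `]-oo, z]%classic + PP z `]z, +oo[%classic)%E.
  by rewrite -measureU// -setCitvl ?setICr ?setUv.
rewrite tail// Lam_id oppe0 expeR0 addeC => /(congr1 (fun x => x - 1)%E).
by rewrite addeAC subee// add0e.
Qed.

(** The mass is [exp (- Lam z x) * (1 - exp (- Lam x y))], and [1 - exp (- b) <= b]. Infinite values
    of [Lam] are treated apart. *)
Let PP_oc_gap (z x y : R) : 0 <= z -> z <= x -> x <= y ->
  (PP z `]x, y]%classic <= Lam x y)%E.
Proof.
move=> z0 zx xy; have x0 : 0 <= x by exact: le_trans zx.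
have : PP z `]x, +oo[%classic = (PP z `]x, y]%classic + PP z `]y, +oo[%classic)%E.
  rewrite -measureU//; last first.
    apply/seteqP; split => // u [] /=; rewrite !in_itv/= andbT.
    by move=> /andP[_ uy] yu; have := le_lt_trans uy yu; rewrite ltxx.
  by rewrite -itv_bndbnd_setU ?bnd_simp.
rewrite !tail//; last exact: le_trans xy.
rewrite (LamD z0 zx xy).
have p_fin := @PP_fin z `]x, y]%classic (measurable_itv _).
have := Lam_ge0 y x0; have := Lam_ge0 x z0.
move: p_fin; case: (PP z `]x, y]%classic) => // p _.
case: (Lam z x) => [a| |]//; last first.
  move=> _; case: (Lam x y) => [b| |]; [|by move=> *; exact: leey|by []].
  by rewrite /= !lee_fin adde0 => b0 [<-].
case: (Lam x y) => [b| |]; [|by move=> *; exact: leey|by []].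
rewrite /=.
rewrite !lee_fin => a0 b0 [] /eqP; rewrite -subr_eq => /eqP <-.
have -> : - (a + b) = - a + - b by rewrite opprD.
rewrite expRD -{1}[expR (- a)]mulr1 -mulrBr.
have e1 : expR (- a) <= 1 by rewrite -expR0 ler_expR oppr_le0.
have := expR_ge1Dx (- b) => eb.
have d0 : 0 <= 1 - expR (- b) by rewrite subr_ge0 -expR0 ler_expR oppr_le0.
apply: (@le_trans _ _ (1 - expR (- b))); last by lra.
by rewrite ler_piMl.
Qed.

Let PP_oc_le (z x y : R) : 0 <= z -> i1 <= x -> x <= y -> y <= i2 ->
  (PP z `]x, y]%classic <= (C * (y - x))%:E)%E.
Proof.
move=> z0 ix xy yi; have [zx|xz] := leP z x.
  exact: le_trans (PP_oc_gap z0 zx xy) (Lam_le ix xy yi).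
have [zy|yz] := leP z y; last first.
  apply: (@le_trans _ _ (PP z `]-oo, z]%classic)).
    apply: le_measure; rewrite ?inE//= => u /=; rewrite !in_itv/= => /andP[_ uy].
    by rewrite (le_trans uy)// ltW.
  by rewrite below// lee_fin mulr_ge0// subr_ge0.
apply: (@le_trans _ _ (PP z (`]-oo, z]%classic `|` `]z, y]%classic))).
  apply: le_measure; rewrite ?inE//=; first exact: measurableU.
  move=> u /=; rewrite !in_itv/= => /andP[_ uy].
  by have [uz|zu] := leP u z; [left|right]; rewrite /= ?in_itv/= ?zu ?uz.
apply: (@le_trans _ _ (PP z `]-oo, z]%classic + PP z `]z, y]%classic)%E).
  exact: measureU2.
rewrite below// add0e; apply: le_trans (PP_oc_gap z0 (lexx z) zy) _.
apply: le_trans (Lam_le (le_trans ix (ltW xz)) zy yi) _.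
by rewrite lee_fin ler_wpM2l// lerD2l lerN2 ltW.
Qed.

(** Half-open intervals inside the compact interval miss its left end. If [z < i1], the
    integrability of the rate makes [Lam z i1] finite, and it is the limit of [Lam z x] as [x]
    increases to [i1]; an atom at [i1] would keep [Lam z x] below [Lam z i1] by at least its
    mass. *)
Let PP_atom (z : R) : 0 <= z -> PP z [set i1] = 0%E.
Proof.
move=> z0; have [iz|zi] := leP i1 z.
  apply/eqP; rewrite eq_le measure_ge0 andbT -(below z0).
  by apply: le_measure; rewrite ?inE//= => u /= ->; rewrite in_itv/= iz.
have zi' := ltW zi.
have Lam_lty : (Lam z i1 < +oo)%E.
  apply: le_lt_trans (lamI z0 zi'); rewrite -(LamE _ z0)//.
  by rewrite (LamD _ z0 zi')// leeDr// Lam_ge0.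
pose x n : R := i1 - (i1 - z) / n.+1%:R.
have iz0 : 0 < i1 - z by rewrite subr_gt0.
have zx n : z <= x n.
  by rewrite /x lerBrDr addrC -lerBrDr ler_pdivrMr ?ltr0n// ler_peMr ?ler1n ?ltW.
have xi n : x n < i1 by rewrite /x ltrBlDr ltrDl divr_gt0// ltr0n.
have nd : nondecreasing_seq (fun n => `]z, x n]%classic : set R).
  apply/nondecreasing_seqP => n; rewrite subsetEset => u /=; rewrite !in_itv/=.
  move=> /andP[-> ux]/=; rewrite (le_trans ux)// /x lerD2l lerN2.
  by rewrite ler_wpM2l ?(ltW iz0)// lef_pV2 ?posrE ?ltr0n// ler_nat.
have := @ge0_nondecreasing_set_cvg_integral _ (measurableTypeR R) R (fun n => `]z, x n]%classic)
  (EFin \o g) leb nd (fun=> measurable_itv _) (fun n => @mg z (x n) z0) _.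
have -> : \bigcup_n `]z, x n]%classic = `]z, i1[%classic :> set R.
  apply/seteqP; split => [u [n _]|u] /=; rewrite !in_itv/=.
    by move=> /andP[-> ux]; rewrite (le_lt_trans ux).
  move=> /andP[zu ui]; exists (Num.truncn ((i1 - z) / (i1 - u))) => //=.
  rewrite in_itv/= zu/= /x lerBrDr addrC -lerBrDr ler_pdivrMr ?ltr0n// mulrC.
  by rewrite -ler_pdivrMr ?subr_gt0// ltW// truncnS_gt.
rewrite integral_itv_bndo_bndc; last first.
  apply: (@measurable_funS _ _ _ _ `]z, i1]%classic) => //; last exact: mg.
  by move=> u /=; rewrite !in_itv/= => /andP[-> /ltW].
move=> /(_ _)/cvg_lim => limE.
apply/eqP; rewrite eq_le measure_ge0 andbT leNgt; apply/negP => e0.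
have p_fin : PP z [set i1] \is a fin_num by exact: PP_fin.
have Li_fin : Lam z i1 \is a fin_num by rewrite ge0_fin_numE// Lam_ge0.
have step n : (Lam z (x n) <= Lam z i1 - PP z [set i1])%E.
  rewrite leeBrDr// (LamD z0 (zx n) (ltW (xi n))) leeD2l//.
  apply: le_trans (PP_oc_gap z0 (zx n) (ltW (xi n))).
  by apply: le_measure; rewrite ?inE//= => u /= ->; rewrite in_itv/= xi lexx.
have : (Lam z i1 <= Lam z i1 - PP z [set i1])%E.
  rewrite {1}/Lam -limE //; last first.
    move=> n u /=; rewrite in_itv/= => /andP[zu _].
    by rewrite lee_fin g0// (le_lt_trans z0).
  apply: lime_le; last exact: nearW.
  apply: ereal_nondecreasing_is_cvgn.
  apply: ge0_nondecreasing_set_nondecreasing_integral => //.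
    by move=> n; exact: mg.
  move=> n u /=; rewrite in_itv/= => /andP[zu _].
  by rewrite lee_fin g0// (le_lt_trans z0).
by apply/negP; rewrite -ltNge gte_subl.
Qed.

Hypothesis C_gt0 : 0 < C.

(** Lebesgue measure is the infimum of total lengths over countable covers by half-open intervals,
    so the bound on such intervals, cut to the compact interval, passes to every measurable set. *)
Lemma prejump_kernel_le_density (z : R) B : 0 <= z -> measurable B -> B `<=` `[i1, i2] ->
  (PP z B <= C%:E * leb B)%E.
Proof.
move=> z0 mB Bi.
have cover (F : nat -> set R) : (forall k, ocitv (F k)) -> B `<=` \bigcup_k F k ->
    (PP z B <= C%:E * \sum_(0 <= k <oo) wlength idfun (F k))%E.
  move=> oF BF; have mF k : measurable (F k : set R).
    by have [[a b] _ <-] := oF k.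
  have F0 k : (0 <= wlength idfun (F k))%E.
    by have [[a b] _ <-] := oF k; apply: wlength_itv_ge0.
  rewrite -nneseriesZl; last by move=> k _; exact: F0.
  have mFi k : measurable (F k `&` `]i1, i2]%classic) by exact: measurableI.
  have mU : measurable (\bigcup_k (F k `&` `]i1, i2]%classic)) by exact: bigcup_measurable.
  apply: (@le_trans _ _ (PP z ([set i1] `|` \bigcup_k (F k `&` `]i1, i2]%classic)))).
    apply: le_measure; rewrite ?inE//; first exact: measurableU.
    move=> u Bu; have := Bi u Bu; rewrite /= in_itv/= le_eqVlt => /andP[/predU1P[->|iu] ui].
      by left.
    by right; have [k _ Fku] := BF u Bu; exists k => //; split => //=; rewrite in_itv/= iu.
  apply: (@le_trans _ _ (PP z [set i1] +
      PP z (\bigcup_k (F k `&` `]i1, i2]%classic)))%E); first exact: measureU2.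
  rewrite PP_atom// add0e.
  apply: le_trans (measure_sigma_subadditive _ mFi mU (@subset_refl _ _)) _.
  apply: lee_nneseries => // k _; have [[a b] _ /= <-] := oF k.
  have -> : `]a, b]%classic `&` `]i1, i2]%classic = `]Num.max a i1, Num.min b i2]%classic :> set R.
    apply/seteqP; split => u /=; rewrite !in_itv/= gt_max le_min.
      by move=> [/andP[-> ->] /andP[-> ->]].
    by move=> /andP[/andP[-> ->] /andP[-> ->]].
  have [ab|ba] := leP (Num.max a i1) (Num.min b i2); last first.
    rewrite set_itv_ge; last by rewrite bnd_simp -leNgt ltW.
    by rewrite measure0 mule_ge0.
  apply: le_trans (PP_oc_le z0 _ ab _) _.
  - by rewrite le_max lexx orbT.
  - by rewrite ge_min lexx orbT.
  have ab' : a <= b.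
    have := ab; rewrite ge_max !le_min => /andP[/andP[]//].
  rewrite wlength_itv_bnd//= -EFinM lee_fin ler_wpM2l ?(ltW C_gt0)//.
  by rewrite lerB// ?ge_min ?le_max lexx.
rewrite -lee_pdivrMl//.
have -> : leb B = ereal_inf [set (\sum_(0 <= k <oo) wlength idfun (F k))%E
  | F in @measurable_cover _ (ocitv_type R) B] by [].
apply: le_ereal_inf_tmp => _ [F [oF BF] <-].
by rewrite lee_pdivrMl//; exact: cover.
Qed.

End fixed_density.
End prejump_bound.

(** * Concentration of the empirical coefficients *)

Lemma sum_vector_sq (R : realFieldType) (I : finType) (x : nat -> I -> R) (b : R) m n :
  (forall k, (m <= k < n)%N -> \sum_l x k l ^+ 2 <= b ^+ 2) ->
  \sum_l (\sum_(m <= k < n) x k l) ^+ 2 <= ((n - m)%:R * b) ^+ 2.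
Proof.
move=> xb; pose N2 k := \sum_l x k l ^+ 2.
apply: (@le_trans _ _ (\sum_(m <= k < n) \sum_(m <= k' < n) 2^-1 * (N2 k + N2 k'))).
  have -> : \sum_l (\sum_(m <= k < n) x k l) ^+ 2 = \sum_(m <= k < n) \sum_(m <= k' < n)
      \sum_l x k l * x k' l.
    under eq_bigr do rewrite expr2 big_distrl/=.
    rewrite exchange_big/=; apply: eq_bigr => k _.
    by under eq_bigr do rewrite mulr_sumr; rewrite exchange_big.
  apply: ler_sum => k _; apply: ler_sum => k' _.
  rewrite /N2 -big_split mulr_sumr; apply: ler_sum => l _ /=.
  by have := sqr_ge0 (x k l - x k' l); rewrite sqrrB; lra.
apply: (@le_trans _ _ (\sum_(m <= k < n) \sum_(m <= k' < n) b ^+ 2)).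
  rewrite big_nat [leRHS]big_nat; apply: ler_sum => k hk.
  rewrite big_nat [leRHS]big_nat; apply: ler_sum => k' hk'.
  by have := xb k hk; have := xb k' hk'; rewrite /N2; lra.
by rewrite !sumr_const_nat -mulrnA -[leLHS]mulr_natl natrM -expr2 exprMn.
Qed.

(** * Partition of the observations into blocks *)

Section block_partition.
Variables (n q : nat).
Hypothesis q0 : (0 < q)%N.

(* The blocks of index [2 * i + e] form the class of parity [e], so that two
   consecutive blocks of a class are separated by [q] indices. *)
Definition block_start e i := ((i.*2 + e) * q).+1.
Definition block_stop e i := (minn ((i.*2 + e).+1 * q) n).+1.
(** The end of the untruncated block, possibly beyond [n]: the chain exists at all times, and the
    gap to the next block of the class is the same for all blocks. *)
Definition block_time e i := ((i.*2 + e).+1 * q)%N.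
(** The number of pairs of blocks that cover [1, ..., n]; the last blocks may be truncated or
    empty. *)
Definition block_count := (n %/ q.*2).+1.

Lemma block_stop_le e i : (block_stop e i <= block_start e i + q)%N.
Proof. rewrite /block_stop /block_start; lia. Qed.

Lemma block_stop_time e i : (block_stop e i <= (block_time e i).+1)%N.
Proof. by rewrite /block_stop /block_time ltnS geq_minl. Qed.

Lemma block_time_start e i : (block_time e i + q <= block_start e i.+1)%N.
Proof. rewrite /block_time /block_start; lia. Qed.

Lemma block_time_mono e i : (block_time e i <= block_time e i.+1)%N.
Proof. rewrite /block_time; lia. Qed.

Lemma block_time_gt0 e i : (0 < block_time e i)%N.
Proof. by rewrite /block_time muln_gt0. Qed.

Lemma block_partition (R : nmodType) (x : nat -> R) :
  \sum_(1 <= k < n.+1) x k =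
  \sum_(0 <= i < block_count) \sum_(block_start 0 i <= k < block_stop 0 i) x k +
  \sum_(0 <= i < block_count) \sum_(block_start 1 i <= k < block_stop 1 i) x k.
Proof.
pose u b := (minn (b * q) n).+1.
have blk b : \sum_((b * q).+1 <= k < (minn (b.+1 * q) n).+1) x k =
    \sum_(u b <= k < u b.+1) x k.
  have [bn|nb] := leqP (b * q) n; first by rewrite /u (minn_idPl bn).
  rewrite !big_geq//; rewrite /u; lia.
have step N : \sum_(0 <= i < N) \sum_(block_start 0 i <= k < block_stop 0 i) x k +
    \sum_(0 <= i < N) \sum_(block_start 1 i <= k < block_stop 1 i) x k =
    \sum_(1 <= k < u N.*2) x k.
  elim: N => [|N ih]; first by rewrite /= !big_geq ?addr0// /u mul0n min0n.
  rewrite (big_nat_recr N)//= [X in _ + X](big_nat_recr N)//= addrACA ih /block_start /block_stop addn0 addn1 !blk.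
  rewrite -big_cat_nat; [|by rewrite /u; lia..].
  by rewrite -big_cat_nat//; rewrite /u; lia.
rewrite step; congr (\sum_(1 <= k < _) _); rewrite /u /block_count; congr _.+1.
apply/esym/minn_idPr.
have := ltn_ceil n (_ : (0 < q.*2)%N); rewrite double_gt0 q0 => /(_ isT).
by rewrite -!muln2; lia.
Qed.

End block_partition.

Section model_concentration.
Context (R : realType) (PP Q : R.-pker R ~> R) (rho : probability (R * R)%type R).
Variables (V : R -> R) (gamma Rc : R).
Hypotheses (Rc0 : 0 < Rc) (gamma0 : 0 < gamma) (gamma1 : gamma < 1).
Hypothesis mV : measurable_fun setT V.
Hypothesis V1 : forall z, 0 <= z -> 1 <= V z.
Hypothesis ergo : exponentially_ergodic PP Q rho V gamma Rc.
Hypothesis rho_supp : rho (Rplus R `*` Rplus R) = 1%E.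
Hypothesis iV : rho.-integrable setT (fun x => (V x.2)%:E).
Let M := \int[rho]_x V x.2.

Context (z0 : R) (d : measure_display) (T : measurableType d) (P : probability T R).
Variables (Y Z : nat -> {RV P >-> R}).
Hypothesis chain : jump_chain PP Q z0 Y Z.
Hypothesis z0_ge0 : 0 <= z0.

Definition good_set L j := [set w | 0 <= Z j w /\ V (Z j w) <= L].

Lemma good_set_measurable L j : <<s history_gen Y Z j j >> (good_set L j).
Proof.
rewrite (_ : good_set L j = Z j @^-1` (Rplus R `&` (V @^-1` `]-oo, L]%classic))).
  apply: sub_sigma_algebra; exists j, (Rplus R `&` (V @^-1` `]-oo, L]%classic)).
  split; last by left.
  by apply: measurableI; [exact: measurable_itv|rewrite -[X in measurable X]setTI; exact: mV].
by apply/seteqP; split => w /=; rewrite /good_set/Rplus/= !in_itv/= andbT.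
Qed.

(** Markov's inequality under the stationary law, plus the ergodic error. Ergodicity is applied to
    the bounded indicator [g], dominated by [V / L] on nonnegative states. *)
Lemma good_set_mass L j : 0 < L -> (0 < j)%N ->
  \int[P]_w (1 - \1_(good_set L j) w) <= (M + Rc * V z0) / L.
Proof.
move=> L0 j0; pose g (z : R) : R := 1 - \1_(Rplus R `&` (V @^-1` `]-oo, L]%classic)) z.
have bg : bmeas g.
  apply: bmeasB => //; apply: bmeas_indic; apply: measurableI; first exact: measurable_itv.
  by rewrite -[X in measurable X]setTI; exact: mV.
have g0 z : 0 <= g z by rewrite subr_ge0; case/andP: (indic01 R (Rplus R `&` (V @^-1` `]-oo, L]%classic)) z).
have gV z : 0 <= z -> g z <= L^-1 * V z.
  move=> zge0; rewrite /g indicE; case: (boolP (z \in _)) => zin.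
    by rewrite subrr mulr_ge0 ?invr_ge0 ?(ltW L0)// (le_trans _ (V1 zge0)).
  rewrite subr0 mulrC ler_pdivlMr// mul1r leNgt; apply: contra zin => VL.
  by rewrite inE; split; rewrite /Rplus/= in_itv/= ?zge0// ltW.
have -> : \int[P]_w (1 - \1_(good_set L j) w) = \int[jump_law PP Q j z0]_x g x.2.
  transitivity (\int[P]_w (cst 1 w * (cst 1 (Y (0 + j)%N w) * g (Z (0 + j)%N w)))).
    apply: eq_Rintegral => w _; rewrite /= !mul1r add0n /g !indicE.
    congr (_ - (nat_of_bool _)%:R); apply/idP/idP; rewrite !inE /good_set/Rplus/= !in_itv/= andbT.
      by case.
    by case.
  rewrite (chain_jump chain j0)//.
  rewrite -[RHS](bRintegral_cst P); apply: eq_Rintegral => w _.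
  by rewrite mul1r (chain_start chain); apply: eq_Rintegral => x _; rewrite mul1r.
have bg2 : bmeas (fun x : R * R => g x.2) by exact: bmeas_snd.
have Li0 : 0 < L^-1 by rewrite invr_gt0.
have gVn (w : R * R) : 0 <= w.1 -> 0 <= w.2 -> `|g w.2| <= L^-1 * V w.2.
  by move=> _ w2; rewrite ger0_norm// gV.
have := jump_law_close ergo j0 z0_ge0 Li0 bg2 gVn.
move=> /(le_trans (ler_norm _)); rewrite lerBlDr => /le_trans; apply.
rewrite [leRHS](_ : _ = L^-1 * (Rc * V z0) + L^-1 * M); last by ring.
apply: lerD.
  rewrite ler_pM2l// ler_piMr ?exprn_ile1 ?(ltW gamma0) ?(ltW gamma1)//.
  by rewrite mulr_ge0 ?(ltW Rc0)// (le_trans _ (V1 z0_ge0)).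
rewrite /M -RintegralZl//; apply: (le_Rintegral_pos rho_supp) => //.
- exact: bmeas_integrable.
- exact: (integrableZl measurableT L^-1 iV).
- by move=> x; exact: gV.
Qed.

End model_concentration.

Ltac nneg := solve [repeat first [assumption | apply: ltW; assumption | exact: ler0n | exact: ler01
  | exact: sqrtr_ge0 | apply: mulr_ge0 | apply: exprn_ge0 | rewrite invr_ge0 | apply: addr_ge0]].

(* Here [eta ^+ 2 = n], [al ^+ 2 = A], [m ^+ 2] is the stationary mean of [V], and [s ^+ 2 = n A D].
   The main terms of the exponent add up to [(7/10 + 5/7) theta s], which the threshold
   [a = 173/100 s < sqrt 3 s] exceeds by a margin that absorbs all the others. *)
Section exponent.
Variables (R : realType) (p al eta h m eps k1 k2 del : R) (D q i : nat).
Hypotheses (p0 : 0 < p) (p_al : p <= al) (al_k2 : al <= k2 * m) (m1 : 1 <= m).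
Hypotheses (h1 : 1 <= h) (h_eta : h ^+ 4 <= eta) (q0 : (0 < q)%N) (q_eta : q%:R ^+ 2 <= eta).
Hypotheses (k10 : 0 < k1) (eps0 : 0 < eps) (eps1 : eps <= 100^-1).
Hypothesis eps2 : eps * p * k2 <= 100^-1 * k1.
Hypotheses (iq : 2 * i%:R * q%:R <= eta ^+ 2) (del0 : 0 <= del) (DE : D%:R = h ^+ 4).

Let s := eta * al * h ^+ 2.
(** The main terms are [theta * (sqrt c + s^2 / (2 sqrt c))], minimal at [sqrt c = s / sqrt 2], with
    value [sqrt 2 * theta * s]; 7/10 approximates [1 / sqrt 2]. *)
Let c := (7/10 * s) ^+ 2.
(** This is [eps * s / (n * v)]: the term with the operator norm [v] then has order
    [eps * theta * s], while [theta * s] grows like [D^(1/4)], so that the exponential beats every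
    power of [D]. *)
Let theta := eps * al / (eta * k1 * h * m).
Let K := 2 * p * h ^+ 2.
Let v := k1 * h ^+ 3 * m.
Let Tr := 2 * al ^+ 2 * h ^+ 4.

Let h0 : 0 < h. Proof. exact: lt_le_trans ltr01 h1. Qed.
Let m0 : 0 < m. Proof. exact: lt_le_trans ltr01 m1. Qed.
Let al0 : 0 < al. Proof. exact: lt_le_trans p0 p_al. Qed.
Let eta1 : 1 <= eta. Proof. by apply: le_trans h_eta; rewrite exprn_ege1. Qed.
Let eta0 : 0 < eta. Proof. exact: lt_le_trans ltr01 eta1. Qed.
Let s0 : 0 < s. Proof. by rewrite !mulr_gt0// exprn_gt0. Qed.
Let q1 : 1 <= q%:R :> R. Proof. by rewrite ler1n. Qed.
Let q_le : q%:R <= eta. Proof. by apply: le_trans q_eta; rewrite ler_peMr// (le_trans ler01). Qed.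
Let theta0 : 0 < theta. Proof. by rewrite divr_gt0// !mulr_gt0. Qed.
Let K0 : 0 < K. Proof. by rewrite !mulr_gt0// exprn_gt0. Qed.
Let sqrtc : Num.sqrt c = 7/10 * s.
Proof. by rewrite sqrtr_sqr ger0_norm// mulr_ge0// ltW. Qed.

Let thetaK : theta * K <= 2/100 * h / eta.
Proof.
rewrite /theta /K ler_pdivlMr// (_ : _ * eta = 2 * (eps * p * al) * h / (k1 * m)); last first.
  by field; rewrite ?gt_eqF.
rewrite ler_pdivrMr ?mulr_gt0//.
have e0 : 0 <= eps * p by rewrite ltW// mulr_gt0.
have := ler_wpM2l e0 al_k2; have := ler_wpM2r (ltW m0) eps2.
rewrite -[2 * _ * h]mulrA [2/100 * h * _](_ : _ = 2 * (h * (100^-1 * k1 * m))); last by ring.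
move=> a1 a2; rewrite ler_pM2l// [_ * h]mulrC ler_pM2l//.
by apply: le_trans a2 _; apply: le_trans a1; rewrite mulrA.
Qed.

Let h_le : h <= eta. Proof. by apply: le_trans h_eta; rewrite ler_eXnr. Qed.

Let thetaK1 : theta * K <= 2/100.
Proof. by apply: le_trans thetaK _; rewrite ler_pdivrMr// ler_pM2l. Qed.

Let qh : q%:R * h <= eta.
Proof.
rewrite -(@ler_pXn2r _ 2) ?nnegrE ?mulr_ge0 ?(ltW h0) ?(ltW eta0)// exprMn.
rewrite [leRHS]expr2 ler_pM ?sqr_ge0//; apply: le_trans h_eta.
by rewrite ler_weXn2l.
Qed.

Let thetaB : theta * (q%:R * K) <= 2/100.
Proof.
rewrite mulrCA; apply: le_trans (ler_wpM2l _ thetaK) _; first exact: ler0n.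
rewrite mulrA ler_pdivrMr// [leLHS](_ : _ = 2/100 * (q%:R * h)); last by ring.
by rewrite ler_pM2l.
Qed.

Lemma theta_smallP : theta * (q%:R * K + (q%:R * K) ^+ 2 / (2 * Num.sqrt c)) <= 2^-1.
Proof.
have Bc : q%:R * K / (2 * Num.sqrt c) <= 2.
  rewrite sqrtc ler_pdivrMr ?mulr_gt0// /K /s.
  rewrite [leLHS](_ : _ = 2 * (q%:R * p * h ^+ 2)); last by ring.
  have qp : q%:R * p <= eta * al by rewrite ler_pM// ltW.
  have := ler_wpM2r (exprn_ge0 2 (ltW h0)) qp.
  have : 0 <= q%:R * p * h ^+ 2 by rewrite !mulr_ge0// ?exprn_ge0// ltW.
  lra.
rewrite (_ : _ * _ = theta * (q%:R * K) * (1 + q%:R * K / (2 * Num.sqrt c))); last by ring.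
have B0 : 0 <= q%:R * K / (2 * Num.sqrt c) by rewrite divr_ge0 ?mulr_ge0 ?sqrtr_ge0// ltW.
apply: (@le_trans _ _ (2/100 * 3)); last by lra.
apply: ler_pM => //; last by lra.
- by rewrite mulr_ge0 ?(ltW theta0)// mulr_ge0 ?(ltW K0).
- by rewrite addr_ge0.
Qed.

Lemma exponent_le :
  theta * Num.sqrt c + 2^-1 + i%:R * block_rate D K del q Tr v K c theta
    - theta * (173/100 * s) <=
  - (5^-1 * (eps * al ^+ 2 * h / (k1 * m))) + 2^-1 + eta ^+ 6 * del.
Proof.
have ds : theta * s = eps * al ^+ 2 * h / (k1 * m).
  by rewrite /theta /s; field; rewrite ?gt_eqF.
rewrite -ds /block_rate DE sqrtc; set t := theta * s.
have t0 : 0 <= t by rewrite mulr_ge0// ltW.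
have i0 : 0 <= i%:R :> R by [].
have tK0 : 0 <= theta * K by rewrite mulr_ge0// ltW.
have iq' : i%:R * q%:R <= eta ^+ 2 / 2.
  by rewrite ler_pdivlMr// mulrC mulrA.
have iq0 : 0 <= i%:R * q%:R :> R by rewrite mulr_ge0.
have D0 : 0 <= h ^+ 4 by rewrite exprn_ge0// ltW.
have e2 : 0 <= eta ^+ 2 / 2 by rewrite divr_ge0// exprn_ge0// ltW.
have Ks : K / s <= 2.
  rewrite ler_pdivrMr// /K /s -!mulrA ler_pM2l// mulrA ler_wpM2r ?exprn_ge0 ?(ltW h0)//.
  by rewrite -[leLHS]mul1r ler_pM// ltW.
have Ks0 : 0 <= K / s by rewrite divr_ge0// ltW.
have mono a b : (a <= b)%N -> eta ^+ a <= eta ^+ b by move=> ab; rewrite ler_weXn2l.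
have iqD : i%:R * q%:R * (h ^+ 4 * del) <= eta ^+ 3 / 2 * del.
  rewrite [leRHS](_ : _ = eta ^+ 2 / 2 * (eta * del)); last by ring.
  by apply: ler_pM => //; [exact: mulr_ge0|exact: ler_wpM2r].
have iqDD : i%:R * q%:R * (q%:R * (h ^+ 4) ^+ 2 * del) <= eta ^+ 5 / 2 * del.
  rewrite [leRHS](_ : _ = eta ^+ 2 / 2 * (eta * eta ^+ 2 * del)); last by ring.
  apply: ler_pM => //; first by nneg.
  apply: ler_wpM2r => //; apply: ler_pM => //; first by nneg.
  by rewrite ler_pXn2r ?nnegrE// ltW.
set w := i%:R * q%:R in iq' iq0 iqD iqDD.
set X := w * (h ^+ 4 * del) in iqD; set X' := w * (_ * del) in iqDD.
have X0 : 0 <= X by nneg.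
have X'0 : 0 <= X' by nneg.
have P1 : theta * K * X <= 2/100 * (eta ^+ 3 / 2 * del) by rewrite ler_pM.
have P4 : theta * K * (K / s) * X' <= 2/100 * 2 * (eta ^+ 5 / 2 * del).
  by apply: ler_pM; [nneg|nneg|exact: ler_pM|].
have P7 : (theta * K) ^+ 2 * X' <= (2/100) ^+ 2 * (eta ^+ 5 / 2 * del).
  by apply: ler_pM; [nneg|nneg| |] => //; rewrite ler_pXn2r ?nnegrE//; lra.
have tB0 : 0 <= theta * (q%:R * K) by nneg.
have P5 : (theta * (q%:R * K)) ^+ 2 * (K / s) ^+ 2 * X' <=
    (2/100) ^+ 2 * 2 ^+ 2 * (eta ^+ 5 / 2 * del).
  by apply: ler_pM; [nneg|nneg|apply: ler_pM; [nneg|nneg| |]|] => //; rewrite ler_pXn2r ?nnegrE//; lra.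
have en0 : eta != 0 by rewrite gt_eqF.
have wn : w / eta ^+ 2 <= 2^-1 by rewrite ler_pdivrMr ?exprn_gt0// mulrC.
have wn0 : 0 <= w / eta ^+ 2 by nneg.
have P2 : w / eta ^+ 2 * t <= 2^-1 * t by rewrite ler_wpM2r.
have ph0 : 0 <= theta * (q%:R * p * h ^+ 2) by nneg.
have qps : theta * (q%:R * p * h ^+ 2) <= t.
  rewrite /t ler_pM2l// /s ler_wpM2r ?exprn_ge0 ?(ltW h0)//.
  by rewrite ler_pM// ltW.
have P3 : w / eta ^+ 2 * (theta * (q%:R * K) * (theta * (q%:R * p * h ^+ 2))) <= 2^-1 * (2/100 * t).
  by apply: ler_pM; [nneg|nneg| |exact: ler_pM].
have P6 : w / eta ^+ 2 * (eps * t) <= 2^-1 * (100^-1 * t).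
  by apply: ler_pM; [nneg|nneg| |exact: ler_wpM2r].
(* The seven products are those of [P1] to [P7]. Of the margin [173/100 - 7/10 - 5/7 > 31/100] of
   [t], [P3] takes 4/49 and [P6] takes 1/50, which leaves more than 1/5. The terms carrying [del]
   have total coefficient below 1. *)
have -> : i%:R * (theta * (h ^+ 4 * q%:R * (K * del)) +
      (theta / (2 * (7 / 10 * s)) + theta ^+ 2 * (q%:R * K) ^+ 2 / c) *
      (q%:R * Tr + (h ^+ 4) ^+ 2 * q%:R ^+ 2 * (K ^+ 2 * del)) +
      4 * theta ^+ 2 * (q%:R * v + (h ^+ 4) ^+ 2 * q%:R ^+ 2 * (K ^+ 2 * del))) =
    theta * K * X + 10/7 * (w / eta ^+ 2 * t)
    + 400/49 * (w / eta ^+ 2 * (theta * (q%:R * K) * (theta * (q%:R * p * h ^+ 2))))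
    + 5/7 * (theta * K * (K / s) * X')
    + 100/49 * ((theta * (q%:R * K)) ^+ 2 * (K / s) ^+ 2 * X')
    + 4 * (w / eta ^+ 2 * (eps * t)) + 4 * ((theta * K) ^+ 2 * X').
  rewrite /c /X /X' /w /t /Tr /v /K /theta /s; field.
  by rewrite ?gt_eqF.
have d3 : eta ^+ 3 * del <= eta ^+ 6 * del by rewrite ler_wpM2r// mono.
have d5 : eta ^+ 5 * del <= eta ^+ 6 * del by rewrite ler_wpM2r// mono.
have d0 : 0 <= eta ^+ 3 * del by rewrite mulr_ge0// exprn_ge0// ltW.
have d50 : 0 <= eta ^+ 5 * del by rewrite mulr_ge0// exprn_ge0// ltW.
rewrite [theta * (173/100 * s)](_ : _ = 173/100 * t); last by rewrite /t; ring.
rewrite [theta * (7/10 * s)](_ : _ = 7/10 * t); last by rewrite /t; ring.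
lra.
Qed.

End exponent.

Lemma exprn_expR_le (R : realType) (j : nat) (l x : R) : 0 < l -> 0 <= x ->
  x ^+ j * expR (- (l * x)) <= (j%:R / l) ^+ j.
Proof.
move=> l0 x0; case: j => [|j]; first by rewrite !expr0 mul1r -expR0 ler_expR; nra.
have jl : 0 < l / j.+1%:R by rewrite divr_gt0.
rewrite expRN ler_pdivrMr ?expR_gt0//.
have -> : expR (l * x) = expR (l / j.+1%:R * x) ^+ j.+1.
  by rewrite -expRM_natl; congr expR; rewrite mulrA [_ * (l / _)]mulrC divfK ?pnatr_eq0.
rewrite -exprMn ler_pXn2r ?nnegrE ?mulr_ge0 ?expR_ge0 ?invr_ge0 ?(ltW l0)//.
rewrite -ler_pdivrMl ?divr_gt0// invf_div.
by apply: le_trans (expR_ge1Dx _); rewrite lerDr.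
Qed.

Lemma exprn_geometric_le (R : realType) (j : nat) (g : R) : 0 < g -> g < 1 ->
  exists2 B : R, 0 <= B & forall q : nat, q%:R ^+ j * g ^+ q <= B.
Proof.
move=> g0 g1; have l0 : 0 < - ln g by rewrite oppr_gt0 ln_lt0// g0.
exists ((j%:R / (- ln g)) ^+ j).
  by apply: exprn_ge0; apply: divr_ge0 => //; exact: ltW.
move=> q; have -> : g ^+ q = expR (- (- ln g * q%:R)).
  by rewrite mulNr opprK mulrC expRM_natl lnK.
exact: exprn_expR_le.
Qed.

Lemma block_count_mul_le n q : (q <= n)%N -> (block_count n q * q <= 2 * n)%N.
Proof.
move=> qn; rewrite /block_count mulSn mul2n -[n.*2]addnn leq_add//.
by rewrite (leq_trans _ (leq_trunc_div n q.*2))// leq_mul2l -addnn leq_addr orbT.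
Qed.

(** * Choice of the parameters, uniformly in the stationary law *)

Section excess_constant.
Variables (R : realType) (psi1 psi2 nn Rc gamma V0 : R).
Hypotheses (psi10 : 0 < psi1) (psi20 : 0 < psi2) (nn0 : 0 <= nn) (Rc0 : 0 < Rc).
Hypotheses (gamma0 : 0 < gamma) (gamma1 : gamma < 1) (V01 : 1 <= V0).

(** With [M] the stationary mean of [V], [k5 * M] is [C_lambda * psi2]. *)
Let k5 := 2 * Rc * psi2 / (1 - gamma).
Let p := Num.sqrt psi1.
Let k1 := p * nn + 2 * Num.sqrt (8 * nn * Rc * p ^+ 3) / (1 - Num.sqrt gamma) + 1.
Let k2 := Num.sqrt (psi1 + k5).
(** The first bound makes the operator norm term a small part of the exponent; the second keeps
    [theta * K] below 2/100. *)
Let eps := Num.min 100^-1 (100^-1 * k1 / (p * k2)).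

Let g10 : 0 < 1 - gamma. Proof. by rewrite subr_gt0. Qed.
Let sg10 : 0 < 1 - Num.sqrt gamma.
Proof. by rewrite subr_gt0 -sqrtr1 ltr_sqrt. Qed.
Let k50 : 0 < k5. Proof. by rewrite divr_gt0// !mulr_gt0. Qed.
Let p0 : 0 < p. Proof. by rewrite sqrtr_gt0. Qed.
Let k10 : 0 < k1.
Proof. by rewrite ltr_wpDl//; nneg. Qed.
Let k20 : 0 < k2. Proof. by rewrite sqrtr_gt0 addr_gt0. Qed.
Let eps0 : 0 < eps.
Proof. by rewrite lt_min invr_gt0 ltr0n/= divr_gt0// mulr_gt0// invr_gt0. Qed.
Let eps1 : eps <= 100^-1. Proof. by rewrite ge_min lexx. Qed.
Let eps2 : eps * p * k2 <= 100^-1 * k1.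
Proof.
by rewrite -mulrA -ler_pdivlMr ?mulr_gt0// ge_min lexx orbT.
Qed.

Let fourth_root (n : nat) : (0 < n)%N ->
  exists q, [/\ (0 < q)%N, (q ^ 4 <= n)%N & (n <= 16 * q ^ 4)%N].
Proof.
move=> n0; have ex : exists q, (q ^ 4 <= n)%N by exists 1%N.
have bd q : (q ^ 4 <= n)%N -> (q <= n)%N.
  by apply: leq_trans; case: q => // q; rewrite -{1}(expn1 q.+1) leq_pexp2l.
have [q qn qmax] := ex_maxnP ex bd.
have q0 : (0 < q)%N by rewrite qmax.
exists q; split => //.
have : ~~ (q.+1 ^ 4 <= n)%N by apply/negP => /qmax; rewrite ltnn.
rewrite -ltnNge => /ltnW /leq_trans; apply.
have -> : (16 * q ^ 4 = (2 * q) ^ 4)%N by rewrite expnMn.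
rewrite leq_exp2r// mul2n -addnn -addn1 leq_add2l//.
Qed.

Let k6 := eps * k5 / k1.
Let k60 : 0 < k6. Proof. by rewrite divr_gt0// mulr_gt0. Qed.

(** A statement about numbers only: parameters exist for which the bound of [class_excess], times
    [4 / n^2] for the two classes, is at most [Cst / (n D^2)], uniformly in [n], [D] and [M].
    Neither the chain nor its stationary law occurs, so [Cst] depends on the allowed quantities
    alone. *)
Definition excess_bound (Cst : R) := forall (n D : nat) (M : R),
  (0 < D)%N -> (D ^ 2 <= n)%N -> 1 <= M -> 3 * k5 * M <= psi1 * n%:R ->
  let A := psi1 + k5 * M in let K := 2 * Num.sqrt (psi1 * D%:R) in
  exists (q : nat) (L v c theta a : R),
  [/\ (0 < q)%N, 0 < L, 0 < c, 0 < theta & 0 <= a] /\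
  [/\ Num.sqrt (psi1 * D%:R) * nn + 2 * Num.sqrt (8 * nn * Rc * M * Num.sqrt (psi1 * D%:R) ^+ 3) /
       (1 - Num.sqrt gamma) <= v,
     theta * (q%:R * K + (q%:R * K) ^+ 2 / (2 * Num.sqrt c)) <= 2^-1,
     a ^+ 2 <= 3 * n%:R * A * D%:R &
     4 / n%:R ^+ 2 * ((2 * a / theta + 4 / theta ^+ 2) * expR (theta * Num.sqrt c + 2^-1
     + (n %/ q.*2)%:R * block_rate D K (Rc * L * gamma ^+ q) q (2 * A * D%:R) v K c theta - theta * a)
    + ((block_count n q)%:R * (q%:R * K)) ^+ 2 *
      ((block_count n q)%:R * ((M + Rc * V0) / L))) <= Cst / (n%:R * D%:R ^+ 2)].

Lemma excess_constant : exists2 Cst : R, 0 <= Cst & excess_bound Cst.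
Proof.
(* By [n <= 16 * q ^ 4], the factor [n ^ 8] met in front of [gamma ^+ q] becomes [q ^ 32]. *)
have [B B0 hB] := exprn_geometric_le 32 gamma0 gamma1.
pose k3 := Rc * (psi1 / (3 * k5) + Rc * V0) * (16 ^+ 8 * B).
pose C1 := 4 * (k2 ^+ 2 / k6 ^+ 12 * (346/100 * 55 ^+ 11 + 4 * 50 ^+ 10) * expR (2^-1 + k3)).
exists (C1 + 128 * psi1).
  have e0 := expR_ge0 (2^-1 + k3).
  by rewrite /C1; nneg.
move=> n D M D0 Dn M1 Mn A K.
have n0 : (0 < n)%N by rewrite (leq_trans _ Dn)// expn_gt0 D0.
have [q [q0 qn nq]] := fourth_root n0.
pose eta := Num.sqrt (n%:R : R); pose al := Num.sqrt A; pose m := Num.sqrt M.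
pose h := Num.sqrt (Num.sqrt (D%:R : R)).
have M0 : 0 < M by rewrite (lt_le_trans _ M1).
have V00 : 0 < V0 by rewrite (lt_le_trans _ V01).
have A0 : 0 < A by rewrite addr_gt0// mulr_gt0.
have etaE : eta ^+ 2 = n%:R by rewrite sqr_sqrtr.
have alE : al ^+ 2 = A by rewrite sqr_sqrtr// ltW.
have mE : m ^+ 2 = M by rewrite sqr_sqrtr// ltW.
have hE : h ^+ 4 = D%:R by rewrite (exprM h 2 2) !sqr_sqrtr ?sqrtr_ge0.
have pE : p ^+ 2 = psi1 by rewrite sqr_sqrtr// ltW.
have m1 : 1 <= m by rewrite -sqrtr1 ler_sqrt// ltW.
have h1 : 1 <= h by rewrite -[leLHS]sqrtr1 ler_wsqrtr// -[leLHS]sqrtr1 ler_wsqrtr// ler1n.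
have p_al : p <= al by rewrite ler_sqrt ?(ltW A0)// lerDl mulr_ge0// ltW.
have al_k2 : al <= k2 * m.
  rewrite -sqrtrM; last by nneg.
  by apply: ler_wsqrtr; rewrite /A mulrDl lerD2r ler_peMr// ltW.
have h_eta : h ^+ 4 <= eta.
  by rewrite hE -[leLHS]ger0_norm// -sqrtr_sqr ler_wsqrtr// -natrX ler_nat.
have q_eta : q%:R ^+ 2 <= eta.
  by rewrite -[leLHS]ger0_norm ?exprn_ge0// -sqrtr_sqr -exprM -natrX ler_wsqrtr// ler_nat.
have h0 : 0 < h by rewrite (lt_le_trans _ h1).
have m0 : 0 < m by rewrite (lt_le_trans _ m1).
have al0 : 0 < al by rewrite sqrtr_gt0.
have eta0 : 0 < eta by rewrite sqrtr_gt0 ltr0n.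
have iq : 2 * (n %/ q.*2)%:R * q%:R <= eta ^+ 2.
  rewrite etaE -!natrM ler_nat -mulnA mulnC -mulnA -[(_ * 2)%N]mulnC mul2n; exact: leq_trunc_div.
have KE : K = 2 * p * h ^+ 2.
  by rewrite /K sqrtrM ?(ltW psi10)// sqr_sqrtr ?sqrtr_ge0// mulrA.
(* By [good_set_mass] a block is then discarded with probability at most [n ^ (-4)], which pays for
   the crude bound of the excess. The size of [L] is harmless: it multiplies [gamma ^+ q] with [q]
   of order [n ^ (1/4)]. *)
pose L := (M + Rc * V0) * n%:R ^+ 4.
have MV0 : 0 < M + Rc * V0 by rewrite addr_gt0// mulr_gt0// (lt_le_trans _ V01).
have nR : 0 < n%:R :> R by rewrite ltr0n.
have L0 : 0 < L by rewrite mulr_gt0// exprn_gt0.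
have del0 : 0 <= Rc * L * gamma ^+ q by nneg.
pose s := eta * al * h ^+ 2.
have s0 : 0 < s by rewrite !mulr_gt0// exprn_gt0.
pose theta := eps * al / (eta * k1 * h * m).
have th0 : 0 < theta by rewrite divr_gt0// !mulr_gt0.
exists q, L, (k1 * h ^+ 3 * m), ((7/10 * s) ^+ 2), theta, (173/100 * s).
split.
  split => //; first by rewrite exprn_gt0// mulr_gt0.
  by nneg.
have smallP := theta_smallP p0 p_al al_k2 m1 h1 h_eta q0 q_eta k10 eps0 eps2.
have expP := exponent_le p0 p_al al_k2 m1 h1 h_eta q0 q_eta k10 eps0 eps1 eps2 iq del0 (esym hE).
have sqD : Num.sqrt (psi1 * D%:R) = p * h ^+ 2.
  by rewrite sqrtrM ?(ltW psi10)// sqr_sqrtr ?sqrtr_ge0.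
have hpow a b : (a <= b)%N -> h ^+ a <= h ^+ b by move=> ab; rewrite ler_weXn2l.
split.
- rewrite sqD (_ : 8 * nn * Rc * M * _ = (8 * nn * Rc * p ^+ 3) * (h ^+ 3 * m) ^+ 2); last first.
    by rewrite -mE; ring.
  rewrite sqrtrM; last by nneg.
  rewrite sqrtr_sqr ger0_norm; last by nneg.
  have hm : h ^+ 2 <= h ^+ 3 * m.
    by apply: le_trans (hpow 2 3 isT) _; rewrite ler_peMr// exprn_ge0// ltW.
  have pn0 : 0 <= p * nn by nneg.
  have := ler_wpM2l pn0 hm.
  have : 0 <= h ^+ 3 * m by nneg.
  pose W := 2 * Num.sqrt (8 * nn * Rc * p ^+ 3) / (1 - Num.sqrt gamma).
  rewrite (_ : 2 * (Num.sqrt (8 * nn * Rc * p ^+ 3) * (h ^+ 3 * m)) / (1 - Num.sqrt gamma) =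
    W * (h ^+ 3 * m)) /k1 -/W; last by rewrite /W; ring.
  lra.
- by rewrite KE; exact: smallP.
- rewrite -hE -alE -etaE /s.
  have s20 := sqr_ge0 (eta * al * h ^+ 2).
  rewrite [leRHS](_ : _ = 3 * (eta * al * h ^+ 2) ^+ 2); last by ring.
  by rewrite exprMn; lra.
(* This is [theta * s]. Because [A >= k5 * M], it is at least [k6 * h * m]: the exponent grows with
   the dimension and with [M]. *)
pose E := eps * al ^+ 2 * h / (k1 * m).
have E0 : 0 < E by rewrite !mulr_gt0 ?exprn_gt0 ?invr_gt0 ?mulr_gt0.
have hmE : h * m <= E / k6.
  rewrite ler_pdivlMr// /E /k6 ler_pdivlMr ?mulr_gt0//.
  rewrite (_ : _ * (k1 * m) = eps * h * (k5 * m ^+ 2)); last by field; rewrite gt_eqF.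
  rewrite (_ : eps * al ^+ 2 * h = eps * h * al ^+ 2); last by ring.
  by rewrite ler_pM2l ?mulr_gt0// mE alE lerDr ltW.
(* [eta ^+ 6] gives [n ^ 3] and [L] gives [n ^ 4]; the factor [M] of [L] costs one more [n] through
   [Mn]. *)
have del3 : eta ^+ 6 * (Rc * L * gamma ^+ q) <= k3.
  rewrite (exprM eta 2 3) etaE /L.
  rewrite (_ : _ * (Rc * _ * _) = Rc * (M + Rc * V0) * (n%:R ^+ 7 * gamma ^+ q)); last by ring.
  apply: (@le_trans _ _ (Rc * (psi1 / (3 * k5) + Rc * V0) * (n%:R ^+ 8 * gamma ^+ q))).
    rewrite (exprS _ 7) -[n%:R * _ * _]mulrA [leRHS]mulrA.
    apply: ler_wpM2r; first by nneg.
    rewrite -mulrA ler_pM2l// mulrDl lerD//.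
      have k53 : 0 < 3 * k5 by rewrite mulr_gt0.
      by rewrite mulrAC ler_pdivlMr// [leLHS]mulrC.
    by rewrite ler_peMr ?ler1n//; nneg.
  apply: ler_wpM2l; first by nneg.
  apply: (@le_trans _ _ ((16 * q%:R ^+ 4) ^+ 8 * gamma ^+ q)).
    apply: ler_wpM2r; first by nneg.
    by rewrite ler_pXn2r ?nnegrE ?mulr_ge0 ?exprn_ge0// -natrX -natrM ler_nat.
  rewrite exprMn -exprM -mulrA; apply: ler_wpM2l; first by nneg.
  exact: hB.
rewrite [2 * A * _](_ : _ = 2 * al ^+ 2 * h ^+ 4); last by rewrite alE hE.
rewrite KE; set ex := expR _.
have exle : ex <= expR (- (5^-1 * E)) * expR (2^-1 + k3).
  rewrite -expRD ler_expR; apply: le_trans expP _; rewrite -/E; lra.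
set F := _ + 4 / theta ^+ 2; set G := _ ^+ 2 * (_ * _).
have FE : h ^+ 8 * F = n%:R * (346/100 * (al ^+ 2 * h ^+ 12 / E) + 4 * (al ^+ 2 * h ^+ 12 / E ^+ 2)).
  by rewrite /F /E /theta /s -etaE; field; rewrite ?gt_eqF.
(* Powers of [h] and of [m] are traded together for powers of [E], with [m ^ 2 <= m ^ 12]. What
   remains is a power of [E] against [exp (- E / 5)], hence bounded uniformly in [D] and [M]. *)
have ADE j : al ^+ 2 * h ^+ 12 / E ^+ j <= k2 ^+ 2 / k6 ^+ 12 * (E ^+ 12 / E ^+ j).
  rewrite [leRHS]mulrA; apply: ler_wpM2r; first by nneg.
  apply: (@le_trans _ _ (k2 ^+ 2 * (h * m) ^+ 12)).
    have -> : (h * m) ^+ 12 = m ^+ 12 * h ^+ 12 by rewrite exprMn mulrC.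
    rewrite mulrA.
    apply: ler_wpM2r; first by nneg.
    apply: (@le_trans _ _ ((k2 * m) ^+ 2)); first by rewrite ler_pXn2r ?nnegrE ?mulr_ge0// ltW.
    by rewrite exprMn ler_pM2l ?exprn_gt0// ler_weXn2l.
  rewrite -mulrA; apply: ler_wpM2l; first by nneg.
  rewrite [leRHS]mulrC -expr_div_n.
  by rewrite ler_pXn2r ?nnegrE//; nneg.
have e11 : E ^+ 12 / E ^+ 1 * expR (- (5^-1 * E)) <= 55 ^+ 11.
  have -> : E ^+ 12 / E ^+ 1 = E ^+ 11 by field; rewrite gt_eqF.
  have -> : 55 = 11%:R / 5^-1 :> R by rewrite invrK -natrM.
  by apply: exprn_expR_le; rewrite ?invr_gt0// ltW.
have e10 : E ^+ 12 / E ^+ 2 * expR (- (5^-1 * E)) <= 50 ^+ 10.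
  have -> : E ^+ 12 / E ^+ 2 = E ^+ 10 by field; rewrite gt_eqF.
  have -> : 50 = 10%:R / 5^-1 :> R by rewrite invrK -natrM.
  by apply: exprn_expR_le; rewrite ?invr_gt0// ltW.
have kk0 : 0 <= k2 ^+ 2 / k6 ^+ 12 by nneg.
have eE0 : 0 <= expR (- (5^-1 * E)) by exact: expR_ge0.
have F1 : h ^+ 8 * F * ex <= n%:R * (k2 ^+ 2 / k6 ^+ 12 * (346/100 * 55 ^+ 11 + 4 * 50 ^+ 10)
    * expR (2^-1 + k3)).
  rewrite FE.
  set AE1 := al ^+ 2 * h ^+ 12 / E; set AE2 := al ^+ 2 * h ^+ 12 / E ^+ 2.
  have AE10 : 0 <= AE1 by rewrite /AE1; nneg.
  have AE20 : 0 <= AE2 by rewrite /AE2; nneg.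
  have in0 : 0 <= n%:R * (346/100 * AE1 + 4 * AE2) by nneg.
  apply: le_trans (ler_wpM2l in0 exle) _.
  set ee := expR _ in e11 e10 eE0 *; set xx := expR _.
  have a1 : AE1 * ee <= k2 ^+ 2 / k6 ^+ 12 * 55 ^+ 11.
    apply: le_trans (ler_wpM2r eE0 (ADE 1)) _.
    by rewrite -[leLHS]mulrA; exact: (ler_wpM2l kk0).
  have a2 : AE2 * ee <= k2 ^+ 2 / k6 ^+ 12 * 50 ^+ 10.
    apply: le_trans (ler_wpM2r eE0 (ADE 2)) _.
    by rewrite -[leLHS]mulrA; exact: (ler_wpM2l kk0).
  have xx0 : 0 <= xx by exact: expR_ge0.
  rewrite [leLHS](_ : _ = n%:R * ((346/100 * (AE1 * ee) + 4 * (AE2 * ee)) * xx)); last by ring.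
  apply: ler_wpM2l => //; apply: ler_wpM2r => //.
  apply: (@le_trans _ _ (346/100 * (k2 ^+ 2 / k6 ^+ 12 * 55 ^+ 11)
    + 4 * (k2 ^+ 2 / k6 ^+ 12 * 50 ^+ 10))).
    have c1 : 0 <= 346/100 :> R by nneg.
    have c2 : 0 <= 4 :> R by nneg.
    exact: lerD (ler_wpM2l c1 a1) (ler_wpM2l c2 a2).
  by rewrite le_eqVlt; apply/orP; left; apply/eqP; ring.
have n1 : 1 <= n%:R :> R by rewrite ler1n.
have q_n : (q <= n)%N.
  by apply: leq_trans qn; rewrite -{1}(expn1 q) leq_pexp2l.
have Nq : (block_count n q)%:R * q%:R <= 2 * n%:R :> R.
  by rewrite -!natrM ler_nat block_count_mul_le.
have NN : (block_count n q)%:R <= 2 * n%:R :> R.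
  by apply: le_trans Nq; rewrite ler_peMr// ler1n.
have G1 : h ^+ 8 * G <= n%:R * (32 * p ^+ 2).
  rewrite /G /L (_ : (M + Rc * V0) / _ = (n%:R ^+ 4)^-1); last first.
    by field; rewrite ?gt_eqF.
  set N := (block_count n q)%:R in Nq NN *.
  have N0 : 0 <= N by exact: ler0n.
  rewrite [leLHS](_ : _ = (N * q%:R) ^+ 2 * N * h ^+ 12 * (4 * p ^+ 2 / n%:R ^+ 4)); last by ring.
  rewrite [leRHS](_ : _ = (2 * n%:R) ^+ 2 * (2 * n%:R) * n%:R ^+ 2 * (4 * p ^+ 2 / n%:R ^+ 4)); last first.
    by field; rewrite ?gt_eqF.
  apply: ler_wpM2r; first by nneg.
  apply: ler_pM; [nneg|nneg| |].
    by apply: ler_pM; [nneg|nneg| |] => //; rewrite ler_pXn2r ?nnegrE// mulr_ge0.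
  rewrite -etaE -exprM (exprM h 4 3) (@le_trans _ _ (eta ^+ 3))//.
    by rewrite ler_pXn2r ?nnegrE ?exprn_ge0// ltW.
  by rewrite ler_weXn2l// (le_trans _ h_eta)// exprn_ege1.
rewrite -hE ler_pdivlMr; last by rewrite mulr_gt0// !exprn_gt0.
rewrite [leLHS](_ : _ = 4 / n%:R * (h ^+ 8 * F * ex) + 4 / n%:R * (h ^+ 8 * G)); last first.
  by field; rewrite ?gt_eqF.
have n4 : 0 <= 4 / n%:R :> R by nneg.
apply: le_trans (lerD (ler_wpM2l n4 F1) (ler_wpM2l n4 G1)) _.
rewrite -pE le_eqVlt; apply/orP; left; apply/eqP; rewrite /C1; field.
by rewrite ?gt_eqF.
Qed.

End excess_constant.

Lemma geo_sum_le (R : realFieldType) (g : R) (N : nat) : 0 <= g -> g < 1 ->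
  \sum_(1 <= i < N.+1) g ^+ i <= (1 - g)^-1.
Proof.
move=> g0 g1; have g10 : 0 < 1 - g by rewrite subr_gt0.
rewrite -[leRHS]mul1r ler_pdivlMr// mulrC.
apply: (@le_trans _ _ ((1 - g) * \sum_(i < N.+1) g ^+ i)).
  by rewrite ler_pM2l// -(big_mkord xpredT (fun i => g ^+ i)) [leRHS]big_ltn// lerDr.
by rewrite -(opprB g 1) mulNr -subrX1 opprB lerBlDr lerDl exprn_ge0.
Qed.

Lemma bmeas_max0 d (X : measurableType d) (R : realType) (f : X -> R) :
  bmeas f -> bmeas (fun x => Num.max 0 (f x)).
Proof.
move=> bf; rewrite [X in bmeas X](_ : _ = fun x => 2^-1 * (f x + `|f x|)).
  by apply: bmeasZ; apply: bmeasD => //; exact: bmeas_norm.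
apply/funext => x; case: (leP 0 (f x)) => u0; first by rewrite ger0_norm//; lra.
by rewrite ltr0_norm//; lra.
Qed.

Section model_excess.
Context (R : realType) (PP Q : R.-pker R ~> R) (rho : probability (R * R)%type R).
Variables (V : R -> R) (gamma Rc : R).
Hypotheses (Rc0 : 0 < Rc) (gamma0 : 0 < gamma) (gamma1 : gamma < 1).
Hypothesis mV : measurable_fun setT V.
Hypothesis V1 : forall z, 0 <= z -> 1 <= V z.
Hypothesis ergo : exponentially_ergodic PP Q rho V gamma Rc.
Hypothesis rho_supp : rho (Rplus R `*` Rplus R) = 1%E.
Hypothesis iV : rho.-integrable setT (fun x => (V x.2)%:E).
Let M := \int[rho]_x V x.2.

Context (z0 : R) (d : measure_display) (T : measurableType d) (P : probability T R).
Variables (Y Z : nat -> {RV P >-> R}).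
Hypothesis chain : jump_chain PP Q z0 Y Z.
Hypothesis z0_ge0 : 0 <= z0.

Variables (D : nat) (f : 'I_D -> R -> R) (A : 'I_D -> R) (psi1 psi2 nn : R).
Hypothesis bf : forall l, bmeas (f l).
Hypothesis D0 : (0 < D)%N.
Hypotheses (psi10 : 0 < psi1) (psi20 : 0 < psi2) (nn0 : 0 <= nn).
Hypothesis f_sq : forall y, \sum_l f l y ^+ 2 <= psi1 * D%:R.
Hypothesis A0 : forall l, 0 < A l.
Hypothesis fA : forall l y, `|f l y| <= A l.
Hypothesis f_A : forall y, \sum_l A l * `|f l y| <= psi2 * D%:R.
Hypothesis f_L1 : forall u : 'I_D -> R, \sum_l u l ^+ 2 <= 1 ->
  \int[rho]_x `|\sum_l u l * f l x.1| <= nn.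

Let K := 2 * Num.sqrt (psi1 * D%:R).
Let K0 : 0 < K. Proof. by rewrite mulr_gt0// sqrtr_gt0 mulr_gt0// ltr0n. Qed.
Let M1 : 1 <= M. Proof. exact: V_mean_ge1. Qed.
Let M0 : 0 <= M. Proof. exact: le_trans ler01 M1. Qed.
Let Xc k l w := centered rho f l (Y k w).

Let centered_le l y : `|centered rho f l y| <= K.
Proof.
rewrite -(@ler_pXn2r _ 2) ?nnegrE ?(ltW K0)// real_normK ?num_real//.
apply: le_trans (centered_sq rho bf psi10 f_sq y).
by rewrite (bigD1 l)//= lerDl sumr_ge0// => i _; exact: sqr_ge0.
Qed.

Let wtT i := if i is 0 then psi1 * D%:R else 2 * (psi2 * D%:R) * (Rc * gamma ^+ i) * M.
Let wtV i := if i is 0 then Num.sqrt (psi1 * D%:R) * nn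
  else Num.sqrt (8 * nn * Rc * M * Num.sqrt (psi1 * D%:R) ^+ 3) * Num.sqrt gamma ^+ i.

(** The abstract recursion applied to one class of blocks: consecutive blocks are [q] indices apart,
    so the mixing error is [Rc * L * gamma ^+ q], and [Tr] and [v] bound geometric sums of
    covariances over the lags. *)
Lemma class_excess (n q e : nat) (L Tr v c theta a : R) : (0 < q)%N -> 0 < L ->
  psi1 * D%:R + 4 * (psi2 * D%:R) * Rc * M / (1 - gamma) <= Tr ->
  Num.sqrt (psi1 * D%:R) * nn + 2 * Num.sqrt (8 * nn * Rc * M * Num.sqrt (psi1 * D%:R) ^+ 3) /
    (1 - Num.sqrt gamma) <= v ->
  0 < c -> 0 < theta -> 0 <= a ->
  theta * (q%:R * K + (q%:R * K) ^+ 2 / (2 * Num.sqrt c)) <= 2^-1 ->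
  \int[P]_w Num.max 0 (\sum_l (\sum_(0 <= i < block_count n q)
     \sum_(block_start q e i <= k < block_stop n q e i) Xc k l w) ^+ 2 - a ^+ 2) <=
  (2 * a / theta + 4 / theta ^+ 2) * expR (theta * Num.sqrt c + 2^-1
     + (n %/ q.*2)%:R * block_rate D K (Rc * L * gamma ^+ q) q Tr v K c theta - theta * a)
  + ((block_count n q)%:R * (q%:R * K)) ^+ 2 * ((block_count n q)%:R * ((M + Rc * V z0) / L)).
Proof.
move=> q0 L0 hTr hv c0 th0 a0 small.
have gq i : (q <= i)%N -> Rc * L * gamma ^+ i <= Rc * L * gamma ^+ q.
  by move=> qi; rewrite ler_wpM2l ?ler_wiXn2l// ?ltW// mulr_gt0.
have bX k l : (0 < k)%N -> @bmeas _ (TH Y Z k k) R (Xc k l).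
  move=> k0; apply: (bmeas_comp (bmeas_centered rho bf l)).
  by apply: history_Y; rewrite k0 leqnn.
have V0 : 1 <= V z0 by exact: V1.
have del0 : 0 <= Rc * L * gamma ^+ q by rewrite mulr_ge0 ?exprn_ge0 ?ltW// mulr_gt0.
have sqg1 : Num.sqrt gamma < 1 by rewrite -sqrtr1 ltr_sqrt.
apply: (@partial_sum_excess R d T P (fun k => history_gen Y Z k k) _ _ D Xc
  (good_set V Z L) bX K (Rc * L * gamma ^+ q) q
  (fun i l l' => stat_cov PP Q rho i (centered rho f l) (centered rho f l'))
  (ltW K0) del0 q0 _ _ Tr v K c theta wtT wtV _ _ _ _ _ _ K0 _ c0 (ltW th0) small
  (block_start q e) (block_stop n q e) (block_time q e)) => //.
- by move=> k; exact: history_measurable.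
- by move=> j k jk; exact: history_mono.
- move=> j k F jqk bF Fg l.
  have := chain_mixing1 Rc0 gamma0 V1 ergo chain bF Fg (i := k - j) _ K0 (bmeas_centered rho bf l) (centered_le l).
  rewrite subnKC ?(leq_trans (leq_addr q j))//.
  rewrite Rintegral_centered// mulr0 subr0 => /(_ _)/le_trans; apply.
    by rewrite subn_gt0 (leq_trans _ jqk)// -addn1 leq_add2l.
  rewrite ler_wpM2r ?Rintegral_ge0// ler_pM2l// gq//.
  by rewrite leq_subRL// (leq_trans (leq_addr q j)).
- move=> j k i F jqk bF Fg l l'.
  have := chain_mixing2 Rc0 gamma0 V1 ergo chain bF Fg (i := k - j) i _ K0
    (bmeas_centered rho bf l) (bmeas_centered rho bf l') (centered_le l) (centered_le l').
  rewrite subnKC ?(leq_trans (leq_addr q j))// => /(_ _)/le_trans; apply.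
    by rewrite subn_gt0 (leq_trans _ jqk)// -addn1 leq_add2l.
  rewrite ler_wpM2r ?Rintegral_ge0// ler_pM2l ?exprn_gt0// gq//.
  by rewrite leq_subRL// (leq_trans (leq_addr q j)).
- by case=> [|i]; rewrite /wtT; nneg.
- by case=> [|i]; rewrite /wtV; nneg.
- move=> N; apply: le_trans hTr; rewrite lerD2l.
  rewrite (eq_big_nat _ _ (F2 := fun i => 2 * (psi2 * D%:R) * Rc * M * gamma ^+ i)); last first.
    by case=> // i _; rewrite /wtT; ring.
  rewrite -mulr_sumr mulrA [2 * _](_ : _ = 4 * (psi2 * D%:R) * Rc * M); last by ring.
  by apply: ler_wpM2l; [nneg|apply: geo_sum_le => //; exact: ltW].
- move=> N; apply: le_trans hv; rewrite lerD2l.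
  rewrite (eq_big_nat _ _ (F2 := fun i => Num.sqrt (8 * nn * Rc * M
    * Num.sqrt (psi1 * D%:R) ^+ 3) * Num.sqrt gamma ^+ i)); last by case.
  rewrite -mulr_sumr mulrA.
  by apply: ler_wpM2l; [nneg|exact: geo_sum_le].
- by move=> i; exact: stat_cov_trace.
- by move=> i u; exact: stat_cov_weak.
- by move=> k w _; exact: centered_sq.
- by move=> i; exact: block_stop_le.
- by move=> i; exact: block_stop_time.
- by move=> i; exact: block_time_start.
- by move=> i; exact: block_time_mono.
- by move=> i; exact: good_set_measurable.
- move=> w; rewrite /partial_sum -/(block_count n q) -[block_count n q in leRHS]subn0.
  apply: sum_vector_sq => i _.
  apply: le_trans (sum_vector_sq (b := K) _) _.
    by move=> k _; exact: centered_sq.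
  rewrite ler_pXn2r ?nnegrE ?mulr_ge0 ?(ltW K0)//.
  by rewrite ler_pM2r// ler_nat leq_subLR block_stop_le.
- move=> i; apply: (good_set_mass Rc0 gamma0 gamma1 mV V1 ergo rho_supp iV chain z0_ge0 L0); exact: block_time_gt0.
Qed.

Lemma model_excess (Cst : R) (n : nat) : 0 <= Cst ->
  excess_bound psi1 psi2 nn Rc gamma (V z0) Cst -> (D ^ 2 <= n)%N ->
  \int[P]_w Num.max 0 (\sum_l (n%:R^-1 * \sum_(1 <= k < n.+1) Xc k l w) ^+ 2
    - 12 * (psi1 + 2 * Rc * psi2 / (1 - gamma) * M) * D%:R / n%:R) <= Cst / (n%:R * D%:R ^+ 2).
Proof.
set k5 := 2 * Rc * psi2 / (1 - gamma); set A' := psi1 + k5 * M.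
move=> Cst0 bound Dn.
have n0 : (0 < n)%N by rewrite (leq_trans _ Dn)// expn_gt0 D0.
have nR : 0 < n%:R :> R by rewrite ltr0n.
have DR : 0 < D%:R :> R by rewrite ltr0n.
have g10 : 0 < 1 - gamma by rewrite subr_gt0.
have sqE w : \sum_l (n%:R^-1 * \sum_(1 <= k < n.+1) Xc k l w) ^+ 2 =
    (n%:R ^+ 2)^-1 * \sum_l (\sum_(1 <= k < n.+1) Xc k l w) ^+ 2.
  by rewrite mulr_sumr; apply: eq_bigr => l _; rewrite exprMn exprVn.
(* If [psi1 * n < 3 * k5 * M], the threshold [12 A' D / n] exceeds [4 psi1 D], an upper bound of the
   deviation at every point, and the excess vanishes. Otherwise [M] is at most of order [n], as
   [excess_bound] requires. *)
have [Mn|nM] := leP (3 * k5 * M) (psi1 * n%:R); last first.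
  rewrite (_ : (fun w => _) = cst 0); last first.
    apply/funext => w /=; apply/max_idPl; rewrite subr_le0 sqE.
    apply: (@le_trans _ _ (K ^+ 2)).
      rewrite ler_pdivrMl ?exprn_gt0//.
      apply: le_trans (sum_vector_sq (b := K) _) _.
        by move=> k _; exact: centered_sq.
      by rewrite subn1 exprMn.
    rewrite /K exprMn sqr_sqrtr ?mulr_ge0 ?(ltW psi10)//.
    rewrite ler_pdivlMr// /A'.
    have := ler_wpM2r (ltW DR) (ltW nM).
    have : 0 <= psi1 * D%:R by rewrite mulr_ge0// ltW.
    by lra.
  by rewrite Rintegral_cst// mul0r divr_ge0 ?mulr_ge0 ?exprn_ge0.
have [q [L [v [c [theta [a [[q0 L0 c0 th0 a0] [hv small ha hC]]]]]]]] :=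
  bound n D M D0 Dn M1 Mn.
apply: le_trans hC.
have hTr : psi1 * D%:R + 4 * (psi2 * D%:R) * Rc * M / (1 - gamma) <= 2 * (psi1 + k5 * M) * D%:R.
  have -> : 4 * (psi2 * D%:R) * Rc * M / (1 - gamma) = 2 * (k5 * M) * D%:R by rewrite /k5; ring.
  have : 0 <= psi1 * D%:R by rewrite mulr_ge0// ltW.
  by lra.
pose S e l w := \sum_(0 <= i < block_count n q)
     \sum_(block_start q e i <= k < block_stop n q e i) Xc k l w.
have bXc k l : bmeas (Xc k l) by exact: (bmeas_comp (bmeas_centered rho bf l)).
have bS e : @bmeas _ T R (fun w => \sum_l S e l w ^+ 2).
  apply: bmeas_sum => l; under eq_fun do rewrite expr2.
  by apply: bmeasM; apply: bmeas_sum => i; exact: bmeas_sum.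
have bmax e : @bmeas _ T R (fun w => Num.max 0 (\sum_l S e l w ^+ 2 - a ^+ 2)).
  by apply: bmeas_max0; exact: bmeasB.
have cls e := class_excess n e q0 L0 hTr hv c0 th0 a0 small.
set Bd := (X in 4 / _ * X).
apply: (@le_trans _ _ (\int[P]_w (2 / n%:R ^+ 2 * (Num.max 0 (\sum_l S 0 l w ^+ 2 - a ^+ 2)
    + Num.max 0 (\sum_l S 1 l w ^+ 2 - a ^+ 2))))).
  apply: le_bRintegral => //.
  - apply: bmeas_max0; apply: bmeasB => //; apply: bmeas_sum => l.
    under eq_fun do rewrite expr2.
    by apply: bmeasM; apply: bmeasZ; exact: bmeas_sum.
  - by apply: bmeasZ; apply: bmeasD.
  move=> w; rewrite ge_max; apply/andP; split.
    by rewrite mulr_ge0 ?divr_ge0 ?exprn_ge0// addr_ge0// le_max lexx.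
  have -> : 12 * A' * D%:R / n%:R = (n%:R ^+ 2)^-1 * (12 * n%:R * A' * D%:R).
    by field; rewrite gt_eqF.
  rewrite sqE -mulrBr [2 / _]mulrC -[leRHS]mulrA ler_pM2l ?invr_gt0 ?exprn_gt0//.
  (* By [|x + y|^2 <= 2 |x|^2 + 2 |y|^2], the threshold [12 n A' D] is shared as
     [2 (3 n A' D + 3 n A' D)], and [a ^+ 2 <= 3 n A' D]. *)
  apply: (@le_trans _ _ (2 * ((\sum_l S 0 l w ^+ 2 - a ^+ 2) + (\sum_l S 1 l w ^+ 2 - a ^+ 2)))).
    suff : \sum_l (\sum_(1 <= k < n.+1) Xc k l w) ^+ 2 <=
        2 * (\sum_l S 0 l w ^+ 2 + \sum_l S 1 l w ^+ 2).
      by move: ha; rewrite -/A'; lra.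
    rewrite mulrDr !mulr_sumr -big_split/=; apply: ler_sum => l _.
    rewrite (block_partition _ q0) -/(S 0 l w) -/(S 1 l w).
    by have := sqr_ge0 (S 0 l w - S 1 l w); rewrite sqrrB sqrrD; lra.
  by rewrite ler_pM2l// lerD// le_max lexx orbT.
rewrite bRintegralZ//; last by apply: bmeasD.
rewrite bRintegralD// (_ : 4 / _ * Bd = 2 / n%:R ^+ 2 * (Bd + Bd)); last by ring.
rewrite ler_wpM2l ?divr_ge0 ?exprn_ge0//; apply: lerD.
  exact: (cls 0%N).
exact: (cls 1%N).
Qed.

End model_excess.

(** * The stationary density *)

Section stationary_density_bound.
Context (R : realType) (phi : R -> R -> R) (lam : R -> R) (PP Q : R.-pker R ~> R).
Variables (i1 i2 : R).
Hypotheses (i1_gt0 : 0 < i1) (i12 : i1 <= i2).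
Hypothesis pdmp : pdmp_conditions phi lam Q.
Hypothesis PPE : prejump_kernel phi lam PP.
Hypothesis lamI : forall x : R, 0 <= x -> x <= i1 ->
  (\int[lebesgue_measure]_(y in `[0%R, i1])
     (lam y * flow_inv' phi x y)%:E < +oo)%E.
Hypothesis lam_bounded : has_ubound (lam @` `[i1, i2]).
Local Notation leb := (@lebesgue_measure R).

Lemma prejump_kernel_bound : exists2 C : R, 0 < C &
  forall (z : R) (B : set R), 0 <= z -> measurable B -> B `<=` `[i1, i2] ->
  (PP z B <= C%:E * leb B)%E.
Proof.
have [flow [mlam lam0 _] _] := pdmp.
have [h [mh h0 hb hE]] := flow_inv_density flow.
have [C1 hC1] := hb _ _ i1_gt0 i12.
have [C2 hC2] := lam_bounded.
have C1_ge0 : 0 <= C1.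
  by apply: le_trans (hC1 i1 _); rewrite ?h0// lexx.
have C2_ge0 : 0 <= C2.
  apply: (le_trans (lam0 i1 (ltW i1_gt0))); apply: hC2; exists i1 => //=.
  by rewrite in_itv/= lexx.
have C0 : 0 < C2 * C1 + 1 by rewrite ltr_wpDl// mulr_ge0.
exists (C2 * C1 + 1) => // z B z0 mB BI.
apply: (prejump_kernel_le_density i1_gt0 mlam lam0 PPE lamI mh h0 hE (ltW C0) _ C0 z0 mB BI).
move=> u /[dup] /andP[iu ui] iui; have u0 : 0 < u by rewrite (lt_le_trans i1_gt0).
rewrite ler_wpDr// ler_pM//; [exact/lam0/ltW|exact: h0| |exact: hC1].
by apply: hC2; exists u => //=; rewrite in_itv/= iu.
Qed.

Lemma prejump_kernel_Rplus (z : R) : 0 <= z -> PP z (Rplus R) = 1%E.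
Proof.
move=> z0; apply/eqP; rewrite eq_le; apply/andP; split.
  by rewrite -(@prob_kernel _ _ _ _ _ PP z); apply: le_measure; rewrite ?inE//; exact: measurable_itv.
apply: (@le_trans _ _ (PP z `]z, +oo[%classic)).
  by rewrite PPE// set_itv1 integral_set1 oppe0 expeR0.
apply: le_measure; rewrite ?inE; [exact: measurable_itv|exact: measurable_itv|].
by move=> u; rewrite /Rplus/= !in_itv/= !andbT => /ltW; exact: le_trans.
Qed.

Section chain.
Context (z0 : R) (d : measure_display) (T : measurableType d) (P : probability T R).
Variables (Y Z : nat -> {RV P >-> R}).
Hypothesis chain : jump_chain PP Q z0 Y Z.
Hypothesis z0_ge0 : 0 <= z0.

Let histT k j : history Y Z k j setT.
Proof. exact: (@measurableT _ (TH Y Z k j)). Qed.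

Let kernel1 (K : R.-pker R ~> R) (U W : {RV P >-> R}) (B : set R) : measurable B ->
  P (W @^-1` B) = (\int[P]_w K (U w) B)%E ->
  {ae P, forall w, K (U w) B = 1%E} -> {ae P, forall w, W w \in B}.
Proof.
move=> mB PWB K1; have mW : measurable (W @^-1` B) by exact: measurable_funPTI.
exists (~` (W @^-1` B)); split; first exact: measurableC.
  rewrite [LHS](probability_setC P mW) PWB.
  rewrite (ae_eq_integral (cst 1%E))//.
  - by rewrite integral_cst// mul1e [X in (_ - X)%E](probability_setT P) subee.
  - exact: (measurableT_comp (measurable_kernel K _ mB)).
  - by apply: filterS K1 => w.
by move=> w /= nB WB; apply: nB; rewrite inE.
Qed.

(** The kernels are constrained at nonnegative points only, so positivity is propagated along the
    chain before any bound on [PP] can be used. *)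
Lemma chain_Z_ge0 k : {ae P, forall w, 0 <= Z k w}.
Proof.
elim: k => [|k ih]; first by apply: nearW => w; rewrite (chain_start chain).
have mp : measurable (Rplus R) by exact: measurable_itv.
have Yge0 : {ae P, forall w, Y k.+1 w \in Rplus R}.
  apply: (kernel1 (K := PP) (U := Z k)) => //.
    by have := chain_prejump chain (@histT k k) mp; rewrite setTI.
  by apply: filterS ih => w; exact: prejump_kernel_Rplus.
have Zge0 : {ae P, forall w, Z k.+1 w \in Rplus R}.
  apply: (kernel1 (K := Q) (U := Y k.+1)) => //.
    by have := chain_postjump chain (@histT k k.+1) mp; rewrite setTI.
  move: Yge0; apply: filterS => w; rewrite inE /Rplus/= in_itv/= andbT => Y0.
  have [_ _ /(_ _ Y0) Q1] := pdmp.
  apply/eqP; rewrite eq_le; apply/andP; split.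
    by rewrite -(@prob_kernel _ _ _ _ _ Q (Y k.+1 w)); apply: le_measure; rewrite ?inE.
  rewrite -Q1; apply: le_measure; rewrite ?inE//; exact: measurableD.
by move: Zge0; apply: filterS => w; rewrite inE /Rplus/= in_itv/= andbT.
Qed.

(** This gives a meaning to the values of L2 representatives at the observations, although the chain
    starts from a point and not from its stationary law. *)
Lemma chain_Y_null k (N : set R) : measurable N -> N `<=` `[i1, i2] -> leb N = 0%E ->
  (0 < k)%N -> {ae P, forall w, Y k w \notin N}.
Proof.
move=> mN NI N0; case: k => // k _.
have [C C0 hC] := prejump_kernel_bound.
have mYN : measurable (Y k.+1 @^-1` N) by exact: measurable_funPTI.
exists (Y k.+1 @^-1` N); split => //; last first.
  by move=> w /= /negP; rewrite negbK inE.
have := chain_prejump chain (@histT k k) mN; rewrite setTI => ->.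
rewrite (ae_eq_integral (cst 0%E))//.
- by rewrite integral_cst// mul0e.
- exact: (measurableT_comp (measurable_kernel PP _ mN)).
- apply: filterS (chain_Z_ge0 k) => w Z0 _; apply/eqP; rewrite eq_le measure_ge0 andbT.
  by have := hC _ _ Z0 mN NI; rewrite N0 mule0.
Qed.

End chain.
End stationary_density_bound.

Section stationary_measure.
Context (R : realType) (PP Q : R.-pker R ~> R).
Variables (rho : probability (R * R)%type R) (bnu mu : probability R R).
Hypothesis stat : stationary_laws PP Q rho bnu mu.

Let mu_pushforward (B : set R) : measurable B -> mu B = rho (snd @^-1` B).
Proof.
move=> mB; rewrite (rho_snd stat mB); congr (rho _).
by apply/seteqP; split => -[y z] //= [].
Qed.

Section V.
Variables (V : R -> R) (gamma Rc : R).
Hypothesis mV : measurable_fun setT V.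
Hypothesis V1 : forall z, 0 <= z -> 1 <= V z.
Hypothesis ergo : exponentially_ergodic PP Q rho V gamma Rc.

(** Ergodicity applied to [|V|] itself bounds the distance between a one-step mean and the
    stationary mean by a real number. Were the latter [+oo], the difference would be [-oo] for every
    value of the former, by the convention for [+oo - +oo]. *)
Lemma V_integrable : rho.-integrable setT (fun x => (V x.2)%:E).
Proof.
have mV2 : measurable_fun setT (fun x : R * R => V x.2) by exact: measurableT_comp.
have mn : measurable_fun setT (fun x : R * R => `|V x.2|) by exact: measurableT_comp.
have nV (w : R * R) : 0 <= w.1 -> 0 <= w.2 -> `| `|V w.2| | <= V w.2.
  by move=> _ w2; rewrite normr_id ger0_norm// (le_trans _ (V1 w2)).
have := ergo (lexx 0) (ltn0Sn 0) mn nV.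
move=> /le_lt_trans => /(_ _ (ltry _)) h.
apply/integrableP; split; first exact/measurable_EFinP.
rewrite ltey; apply: (contraTneq _ h) => e; rewrite e.
by case: (integral _ _ _) => [r| |].
Qed.

Lemma Rintegral_mu : \int[mu]_z V z = \int[rho]_x V x.2.
Proof.
congr fine; have iV := V_integrable.
rewrite (@eq_measure_integral _ _ _ _ (pushforward rho (snd : R * R -> R))).
  by rewrite integral_pushforward//; exact/measurable_EFinP.
by move=> B mB _; exact: mu_pushforward.
Qed.

Lemma mu_V_integrable : mu.-integrable setT (EFin \o V).
Proof.
have iV := V_integrable.
apply/integrableP; split; first exact/measurable_EFinP.
rewrite (@eq_measure_integral _ _ _ _ (pushforward rho (snd : R * R -> R))).
  rewrite ge0_integral_pushforward//; last first.
    by apply/measurableT_comp => //; exact/measurable_EFinP.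
  by case/integrableP: iV.
by move=> B mB _; exact: mu_pushforward.
Qed.

Lemma C_lambdaE : C_lambda mu V gamma Rc = 2 * Rc / (1 - gamma) * \int[rho]_x V x.2.
Proof.
rewrite /C_lambda /G_lambda Rintegral_mu; set M := \int[rho]_x V x.2.
have iM : mu.-integrable setT (EFin \o cst M) by exact: bmeas_integrable.
have iVM : mu.-integrable setT (EFin \o (fun z => V z + M)).
  by have := integrableD measurableT mu_V_integrable iM.
rewrite RintegralZl// RintegralD//; last exact: mu_V_integrable.
by rewrite (bRintegral_cst mu) Rintegral_mu -/M; ring.
Qed.

End V.

Variables (i1 i2 C : R) (nu : R -> R).
Hypothesis i12 : i1 <= i2.
Hypothesis C0 : 0 < C.
Hypothesis PPC : forall (z : R) (B : set R), 0 <= z -> measurable B -> B `<=` `[i1, i2] ->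
  (PP z B <= C%:E * @lebesgue_measure R B)%E.
Hypothesis dens : stationary_density i1 i2 bnu nu.
Local Notation leb := (@lebesgue_measure R).

Lemma jump_law1_fst z B : measurable B -> jump_law PP Q 1 z (B `*` setT) = PP z B.
Proof.
move=> mB; have bB : bmeas (\1_B : R -> R) by exact: bmeas_indic.
have mBT : measurable (B `*` [set: R]) by exact: measurableX.
transitivity (\int[jump_law PP Q 1 z]_w (\1_(B `*` [set: R]) w)%:E)%E.
  by rewrite (integral_indic _ measurableT mBT) setIT.
transitivity (\int[PP z]_w (\1_B w)%:E)%E; last by rewrite integral_indic// setIT.
rewrite -!bRintegral_EFin//; [|exact: pkernel_lty|exact: jump_law_lty|exact: bmeas_indic].
congr EFin; rewrite -[RHS](_ : \int[jump_law PP Q 1 z]_w (\1_B w.1 * cst 1 w.2) = _).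
  apply: eq_Rintegral => -[y u] _; rewrite /= mulr1 !indicE; congr (nat_of_bool _)%:R.
  by apply/idP/idP; rewrite !inE/= => // -[].
have Q1 y : \int[Q y]_u cst (1 : R) u = 1 by rewrite (Rintegral_cst _ measurableT) prob_kernel mulr1.
rewrite bRintegral_jump_law//.
under eq_Rintegral do under eq_Rintegral do rewrite Q1 mulr1.
rewrite /Rintegral integral_dirac//=.
  by rewrite indicE in_setT mul1r.
by apply/measurable_EFinP; case: (bmeas_pkint PP bB).
Qed.

Lemma stationary_le B : measurable B -> B `<=` `[i1, i2] -> (bnu B <= C%:E * leb B)%E.
Proof.
move=> mB BI; rewrite (rho_fst stat mB) (rho_invariant stat); last exact: measurableX.
have [->|fin] := eqVneq (leb B) +oo%E; first by rewrite gt0_muley// leey.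
have lB : leb B \is a fin_num by rewrite ge0_fin_numE// ltey.
have -> : (C%:E * leb B = \int[rho]_w (cst (C%:E * leb B) w))%E.
  rewrite integral_cst// -[LHS]mule1; congr (_ * _)%E.
  exact/esym/probability_setT.
apply: ae_ge0_le_integral => //.
- apply: (measurableT_comp (f := fun z => jump_law PP Q 1 z (B `*` setT))) => //.
  under eq_fun do rewrite jump_law1_fst//.
  exact: measurable_kernel.
- by move=> w _; rewrite /= mule_ge0// lee_fin ltW.
have mp : measurable (Rplus R `*` Rplus R) by apply: measurableX; exact: measurable_itv.
exists (~` (Rplus R `*` Rplus R)); split; first exact: measurableC.
  by rewrite [LHS](probability_setC rho mp) (rho_support stat) subee.
move=> -[y z] /= zn; apply: contra_not zn => -[_].
rewrite /Rplus/= in_itv/= andbT => z0 _.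
by rewrite jump_law1_fst//; exact: PPC.
Qed.

Lemma stationary_density_le : {ae leb, forall x, nu x <= C}.
Proof.
have [mnu nu0 nuI nuE] := dens.
pose B := [set x | C < nu x].
have mB : measurable B.
  rewrite (_ : B = nu @^-1` `]C, +oo[%classic).
    by rewrite -[X in measurable X]setTI; exact: mnu.
  by apply/seteqP; split => x /=; rewrite in_itv/= andbT.
have BI : B `<=` `[i1, i2].
  move=> x Cx /=; apply/negPn/negP => xI.
  by move: Cx; rewrite /B/= nuI// ltNge (ltW C0).
have lBfin : leb B \is a fin_num.
  rewrite ge0_fin_numE//; apply: (@le_lt_trans _ _ (leb `[i1, i2]%classic)).
    by apply: le_measure; rewrite ?inE.
  by rewrite lebesgue_measure_itv/=; case: ifP => _; rewrite -?EFinB ltry.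
have mnuC : measurable_fun B (fun x => (nu x - C)%:E).
  by apply/measurable_EFinP; apply: measurable_funB => //; exact: measurable_funTS.
have nuC0 x : B x -> (0 <= (nu x - C)%:E)%E by move=> /ltW; rewrite lee_fin subr_ge0.
have e : (\int[leb]_(x in B) (nu x)%:E =
    \int[leb]_(x in B) (nu x - C)%:E + \int[leb]_(x in B) C%:E)%E.
  rewrite -ge0_integralD//; last by move=> x _; rewrite lee_fin ltW.
  by apply: eq_integral => x _; rewrite -EFinD subrK.
have int0 : (\int[leb]_(x in B) `|(nu x - C)%:E| = 0)%E.
  transitivity (\int[leb]_(x in B) (nu x - C)%:E)%E.
    by apply: eq_integral => x; rewrite inE => Bx; rewrite gee0_abs// nuC0.
  apply/eqP; rewrite eq_le integral_ge0// andbT.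
  have := stationary_le mB BI; rewrite (nuE _ mB BI) e integral_cst//.
  by rewrite -{2}[(C%:E * leb B)%E]add0e leeD2rE// fin_numM.
move/(ae_eq_integral_abs leb mB mnuC) : int0.
apply: filterS => x h; rewrite leNgt; apply/negP => Cx.
by have := h Cx; case=> /eqP; rewrite subr_eq0 gt_eqF.
Qed.

Lemma ge0_integral_stationary (g : R -> \bar R) : measurable_fun setT g ->
  (forall x, (0 <= g x)%E) -> (forall x, x \notin `[i1, i2] -> g x = 0%E) ->
  (\int[rho]_w g w.1 = \int[leb_itv i1 i2]_x ((nu x)%:E * g x))%E.
Proof.
move=> mg g0 gI; have [mnu nu0 nuI nuE] := dens.
have mIT : measurable (`[i1, i2]%classic `*` [set: R]) by exact: measurableX.
transitivity (\int[pushforward (mrestr rho mIT) (fst : R * R -> R)]_y g y)%E.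
  rewrite ge0_integral_pushforward// preimage_setT.
  rewrite ge0_integral_mrestr//; [|exact: measurableT_comp|by move=> y /=].
  rewrite [RHS]integral_mkcond; apply: eq_integral => -[y z] _; rewrite patchE.
  case: (boolP (_ \in _)) => // yI; apply: gI; apply: contra yI => yI.
  by rewrite inE.
have H := (@ge0_integral_density _ (measurableTypeR R) R (leb_itv i1 i2) _ _
  (fun x : R => x) (pushforward (mrestr rho mIT) (fst : R * R -> R)) nu g).
refine (H measurable_fst _ mnu nu0 _ mg g0) => // A mA.
rewrite ge0_integral_mrestr//; last 2 first.
- by apply/measurable_EFinP; apply: measurable_funM.
- by move=> y; rewrite lee_fin mulr_ge0// indicE.
transitivity (bnu (A `&` `[i1, i2]%classic)).
  rewrite (rho_fst stat); last exact: measurableI.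
  rewrite /pushforward /mrestr; congr (rho _).
  by apply/seteqP; split => -[y z] /=; [move=> [? []]|move=> [[]]].
rewrite nuE//; last exact: measurableI.
rewrite [LHS]integral_mkcond [RHS]integral_mkcond; apply: eq_integral => x _.
rewrite !patchE indicE in_setI; case: (x \in `[i1, i2]%classic); rewrite ?andbT ?andbF//.
by case: (x \in A); rewrite /= ?mule1 ?mule0.
Qed.

Lemma Rintegral_stationary (g : R -> R) : bmeas g ->
  (forall x, x \notin `[i1, i2] -> g x = 0) ->
  \int[rho]_w g w.1 = \int[leb_itv i1 i2]_x (nu x * g x).
Proof.
move=> bg gI; have [mnu nu0 nuI nuE] := dens.
have bg1 : bmeas (fun w : R * R => g w.1) by exact: bmeas_fst.
have part (h : R -> R) : measurable_fun setT h -> (forall x, x \notin `[i1, i2] -> h x = 0) ->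
    (\int[rho]_w (Num.max (h w.1) 0)%:E =
     \int[leb_itv i1 i2]_x (Num.max (nu x * h x) 0)%:E)%E.
  move=> mh hI; rewrite (ge0_integral_stationary (g := fun x => (Num.max (h x) 0)%:E)).
  - apply: eq_integral => x _; rewrite -EFinM; congr EFin.
    by rewrite maxr_pMr// mulr0.
  - by apply/measurable_EFinP; exact: measurable_maxr.
  - by move=> x; rewrite lee_fin le_max lexx orbT.
  - by move=> x xI; rewrite hI// maxxx.
rewrite /Rintegral [in LHS]integralE [in RHS]integralE; congr (fine (_ - _)).
- under eq_integral do rewrite funeposE -EFin_max.
  under [in RHS]eq_integral do rewrite funeposE -EFin_max.
  by apply: part => //; case: bg.
- under eq_integral do rewrite funenegE -EFinN -EFin_max.
  under [in RHS]eq_integral do rewrite funenegE -EFinN -EFin_max -mulrN.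
  apply: (part (fun x => - g x)) => [|x xI]; last by rewrite gI// oppr0.
  by apply: measurableT_comp => //; case: bg.
Qed.

End stationary_measure.

(** * Projections in L2 *)

Lemma Lnormoo_ae d (X : measurableType d) (R : realType) (m : {measure set X -> \bar R})
    (g : X -> \bar R) :
  {ae m, forall x, (`|g x| <= 'N[m]_+oo[g])%E}.
Proof.
(* For a measure of total mass 0, as happens when [i1 = i2], the norm is 0 by convention and every
   property holds almost everywhere. *)
rewrite unlock; case: ifPn => [_|]; first exact: ess_sup_ge.
rewrite -leNgt => m0; exists setT; split => //.
by apply/eqP; rewrite eq_le m0 measure_ge0.
Qed.

Lemma ae_sub d (X : measurableType d) (R : realType) (m : {measure set X -> \bar R})
    (P Q : X -> Prop) :
  (forall x, P x -> Q x) -> {ae m, forall x, P x} -> {ae m, forall x, Q x}.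
Proof. by move=> PQ; exact: filterS. Qed.

Lemma ae_forall_fin d (X : measurableType d) (R : realType) (m : {measure set X -> \bar R})
    (I : finType) (P : I -> X -> Prop) :
  (forall i, {ae m, forall x, P i x}) -> {ae m, forall x, forall i, P i x}.
Proof. by move=> h; apply: filter_forall. Qed.

Lemma ae_forall_count d (X : measurableType d) (R : realType) (m : {measure set X -> \bar R})
    (I : countType) (P : I -> X -> Prop) :
  (forall i, {ae m, forall x, P i x}) -> {ae m, forall x, forall i, P i x}.
Proof.
move=> h; have : {ae m, forall x, forall k, if unpickle k is Some i then P i x else True}.
  by apply: ae_foralln => k; case: (unpickle k) => [i|]; [exact: h|exact: nearW].
by apply: filterS => x + i => /(_ (pickle i)); rewrite pickleK.
Qed.

(* It suffices to test the bound [|<u, y>| <= sqrt c |u|] on integer vectors [u]: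
   take [u] close to a large multiple of [y]. *)
Lemma sum_sq_le_of_int (R : realType) (I : finType) (y : I -> R) (c : R) : 0 <= c ->
  (forall u : {ffun I -> int}, (\sum_l (u l)%:~R * y l) ^+ 2 <= c * \sum_l (u l)%:~R ^+ 2) ->
  \sum_l y l ^+ 2 <= c.
Proof.
move=> c0 h; set B := \sum_l _; rewrite leNgt; apply/negP => cB.
have B0 : 0 < B by exact: le_lt_trans cB.
pose S1 := \sum_l `|y l|; pose D : R := #|I|%:R.
have S10 : 0 <= S1 by exact: sumr_ge0.
have key (k : R) : 0 <= k -> k * (k * (B * (B - c))) <= k * (2 * S1 * (B + c)) + c * D.
  move=> k0; pose u : {ffun I -> int} := [ffun l => Num.floor (k * y l)].
  pose r l := k * y l - (u l)%:~R.
  have r01 l : 0 <= r l <= 1.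
    rewrite /r ffunE subr_ge0 floor_le.
    by rewrite lerBlDl; have := floorD1_gt (k * y l); rewrite intrD => /ltW.
  have uE l : (u l)%:~R = k * y l - r l by rewrite /r; ring.
  have Rle : `|\sum_l r l * y l| <= S1.
    apply: le_trans (ler_norm_sum _ _ _) _; apply: ler_sum => l _.
    rewrite normrM ler_piMl// ger0_norm; by case/andP: (r01 l).
  have := h u; under eq_bigr do rewrite uE mulrBl -mulrA -expr2.
  rewrite sumrB -mulr_sumr -/B => h1.
  have h2 : \sum_l (u l)%:~R ^+ 2 <= k ^+ 2 * B + 2 * k * S1 + D.
    rewrite /D -sum1_card natr_sum [2 * k * S1]mulr_sumr [k ^+ 2 * B]mulr_sumr -!big_split/=.
    apply: ler_sum => l _; rewrite uE sqrrB exprMn.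
    have /andP[r0 r1] := r01 l.
    have : r l ^+ 2 <= 1 by rewrite expr_le1.
    have : - (k * y l * r l) <= k * `|y l|.
      rewrite -mulrA -mulrN ler_wpM2l//; apply: le_trans (ler_norm _) _.
      by rewrite normrN normrM ler_piMr// ger0_norm.
    by rewrite mulr2n; lra.
  have h3 := ler_wpM2l c0 h2.
  have h4 : k * B * (\sum_l r l * y l) <= k * B * S1.
    by rewrite ler_wpM2l ?mulr_ge0 ?(ltW B0)// (le_trans (ler_norm _)).
  have := sqr_ge0 (\sum_l r l * y l).
  move: h1 h3 h4; rewrite sqrrB mulr2n; lra.
have t0 : 0 < B * (B - c) by rewrite mulr_gt0// subr_gt0.
set t := B * (B - c) in key t0; set s := 2 * S1 * (B + c) in key.
have s0 : 0 <= s by rewrite !mulr_ge0// addr_ge0// ltW.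
have D0 : 0 <= D by [].
have := key ((s + c * D + 1) / t + 1).
set k := _ + 1; have k1 : 1 <= k by rewrite lerDr; nneg.
have k0 : 0 <= k by exact: le_trans ler01 k1.
have kt : s + c * D + 1 <= k * t by rewrite mulrDl divfK ?gt_eqF// mul1r lerDl ltW.
move=> /(_ k0); apply/negP; rewrite -ltNge.
apply: (@lt_le_trans _ _ (k * (s + c * D + 1))); last by rewrite ler_wpM2l.
have : c * D <= k * (c * D) by rewrite ler_peMl// mulr_ge0.
by rewrite !mulrDr; lra.
Qed.

Section L2.
Context (R : realType) (i1 i2 : R).
Local Notation m := (leb_itv i1 i2).
Local Notation L2 := (L2 i1 i2).
Local Notation norm2 := (norm2 i1 i2).
Local Notation inner := (inner i1 i2).
Implicit Types f g h : R -> R.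

Lemma leb_itv_lty : (m setT < +oo)%E.
Proof.
rewrite /leb_itv/= /mrestr setTI lebesgue_measure_itv/=.
by case: ifP => _; rewrite -?EFinB ltry.
Qed.

Lemma L2_Lfun f : L2 f -> f \in Lfun m 2%:E.
Proof.
move=> [mf _ nf]; rewrite inE; apply/andP; split; rewrite inE//=.
Qed.

Lemma L2_mul f g : L2 f -> L2 g -> m.-integrable setT (EFin \o (fun x => f x * g x)).
Proof.
by move=> /L2_Lfun Lf /L2_Lfun Lg; apply/Lfun1_integrable; exact: (Lfun2_mul_Lfun1 Lf Lg).
Qed.

Let norm2_sqr f : (norm2 f `^ 2 = \int[m]_x (f x ^+ 2)%:E)%E.
Proof.
rewrite powR_Lnorm ?pnatr_eq0//; apply: eq_integral => x _.
by rewrite /= powR_mulrn// real_normK ?num_real.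
Qed.

Lemma L2P f : measurable_fun setT f -> (forall x, x \notin `[i1, i2] -> f x = 0) ->
  (\int[m]_x (f x ^+ 2)%:E < +oo)%E -> L2 f.
Proof.
by move=> mf fI f2; split => //; apply: (@lty_poweRy _ _ 2); rewrite ?norm2_sqr.
Qed.

Lemma L2D f g : L2 f -> L2 g -> L2 (fun x => f x + g x).
Proof.
move=> Lf Lg; have L1 := L2_mul Lf Lf; have L1' := L2_mul Lg Lg.
move: Lf Lg => [mf fI _] [mg gI _]; apply: L2P.
- exact: measurable_funD.
- by move=> x xI; rewrite fI// gI// addr0.
have i2f := integrableZl measurableT 2 L1; have i2g := integrableZl measurableT 2 L1'.
have /integrableP[_] := integrableD measurableT i2f i2g.
apply: le_lt_trans; apply: ge0_le_integral => //.
- by move=> x _; rewrite lee_fin sqr_ge0.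
- by apply/measurable_EFinP; apply: measurable_funX; exact: measurable_funD.
- apply: measurableT_comp => //.
  by have /integrableP[] := integrableD measurableT i2f i2g.
- move=> x _; apply: le_trans (lee_abs _).
  rewrite /= -!EFinM -EFinD lee_fin.
  by have := sqr_ge0 (f x - g x); rewrite sqrrB sqrrD; lra.
Qed.

Lemma L2Z c f : L2 f -> L2 (fun x => c * f x).
Proof.
move=> Lf; have L1 := L2_mul Lf Lf; move: Lf => [mf fI _]; apply: L2P.
- exact: measurable_funM.
- by move=> x xI; rewrite fI// mulr0.
have /integrableP[_] := integrableZl measurableT (c ^+ 2) L1.
congr (_ < _)%E; apply: eq_integral => x _.
by rewrite /= exprMn [_ ^+ 2 in LHS]expr2 -?expr2 ger0_norm// mulr_ge0 ?sqr_ge0.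
Qed.

Lemma L2_norm f : L2 f -> L2 (fun x => `|f x|).
Proof.
move=> [mf fI nf]; split => //; first exact: measurableT_comp.
- by move=> x xI; rewrite fI// normr0.
rewrite /Defs.norm2 (_ : EFin \o _ = abse \o (EFin \o f)) ?Lnorm_abse//.
Qed.

Lemma L20 : L2 (fun=> 0).
Proof.
split => //; rewrite /Defs.norm2 (_ : EFin \o _ = cst 0%E)//.
by rewrite Lnorm0// eqe.
Qed.

Lemma L2_sum (I : Type) (r : seq I) (c : I -> R) (b : I -> R -> R) :
  (forall l, L2 (b l)) -> L2 (fun x => \sum_(l <- r) c l * b l x).
Proof.
move=> Lb; elim: r => [|l r ih].
  by under eq_fun do rewrite big_nil; exact: L20.
by under eq_fun do rewrite big_cons; apply: L2D => //; exact: L2Z.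
Qed.

Lemma L2_bounded f C : measurable_fun setT f -> (forall x, x \notin `[i1, i2] -> f x = 0) ->
  {ae m, forall x, `|f x| <= C} -> L2 f.
Proof.
move=> mf fI fC; apply: L2P => //.
apply: (@le_lt_trans _ _ (\int[m]_x (cst (C ^+ 2)%:E x))%E).
  apply: ae_ge0_le_integral => //.
  - by move=> x _; rewrite lee_fin sqr_ge0.
  - by apply/measurable_EFinP; exact: measurable_funX.
  - by move=> x _; rewrite lee_fin sqr_ge0.
  apply: ae_sub fC => x fxC _; rewrite lee_fin.
  rewrite -real_normK ?num_real// ler_pXn2r ?nnegrE//.
  exact: le_trans fxC.
by rewrite integral_cst//; apply: lte_mul_pinfty; rewrite ?lee_fin ?sqr_ge0 ?leb_itv_lty.
Qed.

Lemma norm2_inner f : L2 f -> fine (norm2 f) ^+ 2 = inner f f.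
Proof.
move=> Lf; have [mf fI nf] := Lf.
have nfin : norm2 f \is a fin_num by rewrite ge0_fin_numE// Lnorm_ge0.
apply: EFin_inj; rewrite -powR_mulrn ?fine_ge0 ?Lnorm_ge0// -poweR_EFin fineK// norm2_sqr.
rewrite /Defs.inner fineK; last first.
  exact: integrable_fin_num (L2_mul Lf Lf).
by apply: eq_integral => x _; rewrite expr2.
Qed.

Lemma innerC f g : inner f g = inner g f.
Proof. by apply: eq_Rintegral => x _; rewrite mulrC. Qed.

Lemma innerDl f g h : L2 f -> L2 g -> L2 h ->
  inner (fun x => f x + g x) h = inner f h + inner g h.
Proof.
move=> Lf Lg Lh; rewrite /Defs.inner -RintegralD//; [|exact: L2_mul|exact: L2_mul].
by apply: eq_Rintegral => x _; rewrite mulrDl.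
Qed.

Lemma innerZl c f g : L2 f -> L2 g -> inner (fun x => c * f x) g = c * inner f g.
Proof.
move=> Lf Lg; rewrite /Defs.inner -RintegralZl//; last exact: L2_mul.
by apply: eq_Rintegral => x _; rewrite mulrA.
Qed.

Lemma inner0l f : inner (fun=> 0) f = 0.
Proof.
rewrite /Defs.inner; under eq_Rintegral do rewrite mul0r.
by rewrite Rintegral_cst// mul0r.
Qed.

Lemma inner_suml (I : Type) (r : seq I) (c : I -> R) (b : I -> R -> R) g :
  (forall l, L2 (b l)) -> L2 g ->
  inner (fun x => \sum_(l <- r) c l * b l x) g = \sum_(l <- r) c l * inner (b l) g.
Proof.
move=> Lb Lg; elim: r => [|l r ih].
  by under eq_fun do rewrite big_nil; rewrite inner0l big_nil.
under eq_fun do rewrite big_cons; rewrite big_cons innerDl//.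
- by rewrite innerZl// ih.
- exact: L2Z.
- exact: L2_sum.
Qed.

Lemma inner_ae f f' g : L2 f -> L2 f' -> L2 g -> {ae m, forall x, f x = f' x} ->
  inner f g = inner f' g.
Proof.
move=> [mf _ _] [mf' _ _] [mg _ _] ff'; congr fine; apply: ae_eq_integral => //.
- by apply/measurable_EFinP; exact: measurable_funM.
- by apply/measurable_EFinP; exact: measurable_funM.
by apply: ae_sub ff' => x e _ /=; rewrite e.
Qed.

Lemma inner_ge0 f : 0 <= inner f f.
Proof. by apply: Rintegral_ge0 => x _; rewrite -expr2 sqr_ge0. Qed.

Lemma inner_sqrD f g c : L2 f -> L2 g ->
  inner (fun x => f x + c * g x) (fun x => f x + c * g x) =
  inner f f + 2 * c * inner f g + c ^+ 2 * inner g g.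
Proof.
move=> Lf Lg; have Lcg := L2Z c Lg; have Ls := L2D Lf Lcg.
rewrite innerDl// innerZl// ![inner _ (fun x => f x + c * g x)]innerC.
by rewrite !innerDl// !innerZl// [inner g f]innerC; ring.
Qed.

Lemma inner_norm_le f g (a : R) : L2 f -> L2 g -> 0 <= a -> inner f f = a ^+ 2 ->
  inner g g <= 1 -> inner f (fun x => `|g x|) <= a.
Proof.
move=> Lf Lg a0 fa g1; have Lng := L2_norm Lg.
have gg : inner (fun x => `|g x|) (fun x => `|g x|) = inner g g.
  by apply: eq_Rintegral => x _; rewrite -!expr2 real_normK ?num_real.
apply/ler_addgt0Pr => e e0; have ae : 0 < a + e by rewrite ltr_wpDl.
have := inner_ge0 (fun x => f x + - (a + e) * `|g x|).
rewrite inner_sqrD// gg fa; set y := inner f _; set k := a + e => h.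
have k2 : k ^+ 2 * inner g g <= k ^+ 2 by rewrite ler_piMr ?sqr_ge0.
have ak : a ^+ 2 <= k ^+ 2 by rewrite ler_pXn2r ?nnegrE ?(ltW ae)// lerDl ltW.
rewrite sqrrN in h.
rewrite -(ler_pM2l ae) -/k -expr2; lra.
Qed.

Section basis.
Variables (S : set (R -> R)) (N : nat) (b : 'I_N -> R -> R) (psi1 psi2 : R).
Hypothesis subS : L2_subspace i1 i2 S.
Hypothesis psi10 : 0 < psi1.
Hypothesis Soo : forall s, S s ->
  (normoo i1 i2 s ^+ 2 <= (psi1 * N%:R)%:E * norm2 s ^+ 2)%E.
Hypothesis bS : orthonormal_basis i1 i2 S b.
Hypothesis boo : ('N[m]_+oo[(fun x =>
  \sum_(l < N) normoo i1 i2 (b l) * `|b l x|%:E)%E] <= (psi2 * N%:R)%:E)%E.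

Let SL2 f : S f -> L2 f. Proof. by case: subS => h _ _ _ /h. Qed.

Let bL2 l : L2 (b l). Proof. by apply: SL2; case: bS. Qed.

Lemma subspace_sum (c : 'I_N -> R) : S (fun x => \sum_l c l * b l x).
Proof.
have [_ S0 SD _] := subS; have [Sb _ _] := bS.
elim: (index_enum _) => [|l r ih]; first by under eq_fun do rewrite big_nil.
by under eq_fun do rewrite big_cons; exact: SD.
Qed.

Lemma inner_basis (c : 'I_N -> R) l : inner (fun x => \sum_l c l * b l x) (b l) = c l.
Proof.
rewrite inner_suml// (bigD1 l)//= big1 ?addr0; first by case: bS => _ -> _; rewrite eqxx mulr1.
by move=> l' l'l; case: bS => _ -> _; rewrite (negbTE l'l) mulr0.
Qed.

Lemma inner_basis2 (c c' : 'I_N -> R) :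
  inner (fun x => \sum_l c l * b l x) (fun x => \sum_l c' l * b l x) = \sum_l c l * c' l.
Proof.
rewrite inner_suml//; last exact: L2_sum.
by apply: eq_bigr => l _; rewrite innerC inner_basis.
Qed.

Lemma basis_expansion f : S f ->
  {ae m, forall x, f x = \sum_l inner f (b l) * b l x}.
Proof.
move=> Sf; have [_ _ /(_ f Sf)[c fc]] := bS.
suff e l : inner f (b l) = c l by apply: ae_sub fc => x ->; apply: eq_bigr => l _; rewrite e.
by rewrite -[RHS]inner_basis; apply: inner_ae => //; [exact: SL2|exact: L2_sum].
Qed.

Definition amplitude l := fine (normoo i1 i2 (b l)).

Let normoo_sqr f : S f ->
  (normoo i1 i2 f * normoo i1 i2 f <= (psi1 * N%:R * inner f f)%:E)%E.
Proof.
move=> Sf; have [_ _ nf] := SL2 Sf.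
have nfin : norm2 f \is a fin_num by rewrite ge0_fin_numE// Lnorm_ge0.
by have := Soo Sf; rewrite -(fineK nfin) -EFin_expe -EFinM norm2_inner// ?expe2//; exact: SL2.
Qed.

Lemma subspace_ae_bound f : S f ->
  {ae m, forall x, f x ^+ 2 <= psi1 * N%:R * inner f f}.
Proof.
move=> Sf; apply: ae_sub (Lnormoo_ae m (EFin \o f)) => x fx.
rewrite -lee_fin; apply: le_trans (normoo_sqr Sf).
by rewrite -real_normK ?num_real// expr2 EFinM lee_pmul// lee_fin.
Qed.

Let normoo_fin f : S f -> normoo i1 i2 f \is a fin_num.
Proof.
move=> Sf; rewrite ge0_fin_numE ?Lnorm_ge0// ltey; apply/eqP => h.
by have := normoo_sqr Sf; rewrite h mulyy leye_eq.
Qed.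

Lemma amplitude_gt0 l : 0 < amplitude l.
Proof.
have [Sb on _] := bS; have nf := normoo_fin (Sb l).
rewrite lt_neqAle fine_ge0 ?Lnorm_ge0// andbT eq_sym; apply/eqP => a0.
suff : inner (b l) (b l) = 0 by rewrite on eqxx => /eqP; rewrite oner_eq0.
rewrite -(inner0l (b l)); apply: inner_ae => //; first exact: L20.
apply: ae_sub (Lnormoo_ae m (EFin \o b l)) => x.
rewrite -[X in (_ <= X)%E](fineK nf) -/(amplitude l) a0 lee_fin.
by rewrite normr_le0 => /eqP.
Qed.

Lemma basis_ae_amplitude : {ae m, forall x, forall l, `|b l x| <= amplitude l}.
Proof.
have [Sb _ _] := bS; apply: ae_forall_fin => l.
apply: ae_sub (Lnormoo_ae m (EFin \o b l)) => x.
by rewrite -[X in (_ <= X)%E](fineK (normoo_fin (Sb l))) lee_fin.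
Qed.

Lemma basis_ae_localized :
  {ae m, forall x, \sum_l amplitude l * `|b l x| <= psi2 * N%:R}.
Proof.
have [Sb _ _] := bS.
apply: ae_sub (Lnormoo_ae m (fun x => \sum_l normoo i1 i2 (b l) * `|b l x|%:E)%E) => x h.
rewrite -lee_fin; apply: le_trans boo; apply: le_trans h.
rewrite -sumEFin (le_trans _ (lee_abs _))//; apply: lee_sum => l _.
by rewrite EFinM fineK// normoo_fin.
Qed.

(** The sup norm condition bounds each combination off a null set that depends on its coefficients.
    Integer coefficients are countably many, so one null set serves them all, and they suffice. *)
Lemma basis_ae_sq : {ae m, forall x, \sum_l b l x ^+ 2 <= psi1 * N%:R}.
Proof.
have h (u : {ffun 'I_N -> int}) : {ae m, forall x,
    (\sum_l (u l)%:~R * b l x) ^+ 2 <= psi1 * N%:R * \sum_l (u l)%:~R ^+ 2}.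
  apply: ae_sub (subspace_ae_bound (subspace_sum (fun l => (u l)%:~R))) => x.
  rewrite inner_basis2; congr (_ <= _ * _).
apply: ae_sub (ae_forall_count h) => x {}h.
by apply: (sum_sq_le_of_int _ h); rewrite mulr_ge0// ltW.
Qed.

End basis.
End L2.

(** * The oracle inequality *)

Lemma sum_sqD (R : comPzRingType) (I : finType) (f g : I -> R) (c : R) :
  \sum_i (f i + c * g i) ^+ 2 = \sum_i f i ^+ 2 + 2 * c * \sum_i f i * g i + c ^+ 2 * \sum_i g i ^+ 2.
Proof.
by rewrite !mulr_sumr -!big_split/=; apply: eq_bigr => i _; ring.
Qed.

(** Minimality gives [|u - a|^2 <= |w - a|^2 + p - p' + 2 <u - w, ah - a>]. By Young's inequality
    the last term is at most [|u - a|^2 / 2 + |w - a|^2 / 2 + 4 |ah - a|^2]; absorbing the first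
    part and doubling gives 3, 2 and 8. *)
Lemma oracle_vector (R : realFieldType) (I : finType) (a ah u w : I -> R) (e p p' : R) : 0 <= e ->
  \sum_i u i ^+ 2 = \sum_i u i * ah i ->
  - \sum_i u i ^+ 2 + p' <= \sum_i w i ^+ 2 - 2 * \sum_i w i * ah i + p ->
  e + \sum_i (u i - a i) ^+ 2 <= 3 * (e + \sum_i (w i - a i) ^+ 2) + 2 * p - 2 * p'
    + 8 * \sum_i (ah i - a i) ^+ 2.
Proof.
move=> e0 uE argmin.
have key : \sum_i 2 * ((u i - w i) * (ah i - a i)) <=
    \sum_i (2^-1 * (u i - a i) ^+ 2 + 2^-1 * (w i - a i) ^+ 2 + 4 * (ah i - a i) ^+ 2).
  apply: ler_sum => i _.
  have := sqr_ge0 (2^-1 * (u i - w i) - 2 * (ah i - a i)).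
  have := sqr_ge0 (u i + w i - 2 * a i).
  by rewrite !expr2; lra.
rewrite !big_split/= -!mulr_sumr in key.
have E (f g : I -> R) : \sum_i (f i - g i) ^+ 2 =
    \sum_i f i ^+ 2 - 2 * \sum_i f i * g i + \sum_i g i ^+ 2.
  by have := sum_sqD f g (-1); under eq_bigr do rewrite mulN1r; move=> ->; rewrite sqrrN expr1n; ring.
have cross : \sum_i (u i - w i) * (ah i - a i) = \sum_i u i * ah i - \sum_i u i * a i
    - \sum_i w i * ah i + \sum_i w i * a i.
  by rewrite -!sumrB -big_split/=; apply: eq_bigr => i _; ring.
have : 0 <= \sum_i (w i - a i) ^+ 2 by apply: sumr_ge0 => i _; exact: sqr_ge0.
rewrite cross in key; move: key; rewrite !E; lra.
Qed.

(** A square matrix with orthonormal rows also has orthonormal columns, by [mulmx1C]. *)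
Lemma orthonormal_rows_isometry (R : comNzRingType) (p q : nat) (C : 'I_p -> 'I_q -> R) (z : 'I_q -> R) :
  p = q -> (forall l k, \sum_j C l j * C k j = (l == k)%:R) ->
  \sum_l (\sum_j C l j * z j) ^+ 2 = \sum_j z j ^+ 2.
Proof.
move=> pq; case: _ / pq C z => C z CC.
pose M := \matrix_(l, j) C l j; pose v := \col_j z j.
have MM : M *m M^T = 1%:M.
  apply/matrixP => l k; rewrite !mxE -CC; apply: eq_bigr => j _; by rewrite !mxE.
have /mulmx1C MM' := MM.
have sq N (x : 'cV[R]_N) : \sum_l x l 0 ^+ 2 = (x^T *m x) 0 0.
  by rewrite mxE; apply: eq_bigr => l _; rewrite !mxE expr2.
transitivity (\sum_l (M *m v) l 0 ^+ 2).
  by apply: eq_bigr => l _; rewrite mxE; congr (_ ^+ 2); apply: eq_bigr => j _; rewrite !mxE.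
rewrite sq trmx_mul mulmxA -[_ *m M^T *m M]mulmxA MM' mulmx1 -sq.
by apply: eq_bigr => j _; rewrite mxE.
Qed.

Section oracle.
Context (R : realType) (i1 i2 : R).
Variables (S : nat -> set (R -> R)) (D : nat -> nat) (b : forall m, 'I_(D m) -> R -> R).
Arguments b : clear implicits.
Hypothesis subS : forall m, L2_subspace i1 i2 (S m).
Hypothesis incS : forall m m', (m <= m')%N -> S m `<=` S m'.
Hypothesis bS : forall m, orthonormal_basis i1 i2 (S m) (b m).
Variables (nu : R -> R) (nu_ : nat -> R -> R).
Hypothesis Lnu : L2 i1 i2 nu.
Hypothesis proj : forall m, orthogonal_projection i1 i2 (S m) nu (nu_ m).
Local Notation inner := (inner i1 i2).

Definition basis_change m M l l' := inner (b m l) (b M l').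
Arguments basis_change : clear implicits.
Local Notation C := basis_change.

(** The change of basis is an equality in L2; the empirical coefficients need it at the observed
    points themselves. *)
Definition compatible x := forall m M l, (m <= M)%N ->
  b m l x = \sum_l' C m M l l' * b M l' x.

Let SL2 m f : S m f -> L2 i1 i2 f. Proof. by case: (subS m) => h _ _ _ /h. Qed.
Let Sb m l : S m (b m l). Proof. by case: (bS m). Qed.
Arguments Sb : clear implicits.
Let Lb m l : L2 i1 i2 (b m l). Proof. exact: SL2 (Sb m l). Qed.
Arguments Lb : clear implicits.

Lemma compatible_ae : {ae leb_itv i1 i2, forall x, compatible x}.
Proof.
apply: ae_forall_count => m; apply: ae_forall_count => M; apply: ae_forall_fin => l.
have [mM|mM] := boolP (m <= M)%N; last first.
  by apply: (@ae_sub _ _ _ _ (fun=> True)) => //; exact: aeW.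
apply: ae_sub (basis_expansion (subS M) (bS M) (incS mM (Sb m l))) => x -> _.
by [].
Qed.

Variables (n : nat) (y : nat -> R).
Hypothesis n0 : (0 < n)%N.
Hypothesis y_compatible : forall k, (1 <= k <= n)%N -> compatible (y k).

Definition true_coef m l := inner nu (b m l).
Definition emp_coef m (l : 'I_(D m)) := n%:R^-1 * \sum_(1 <= k < n.+1) b m l (y k).
Arguments true_coef : clear implicits.
Arguments emp_coef : clear implicits.
Local Notation a := true_coef.
Local Notation ah := emp_coef.
Definition deviation m := \sum_l (ah m l - a m l) ^+ 2.

Let true_coef_change m M l : (m <= M)%N -> a m l = \sum_l' C m M l l' * a M l'.
Proof.
move=> mM; rewrite /true_coef innerC.
rewrite (inner_ae _ _ _ (basis_expansion (subS M) (bS M) (incS mM (Sb m l))))//; last exact: L2_sum.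
rewrite inner_suml//; apply: eq_bigr => l' _; by rewrite [inner (b M l') nu]innerC.
Qed.

Let emp_coef_change m M l : (m <= M)%N -> ah m l = \sum_l' C m M l l' * ah M l'.
Proof.
move=> mM; rewrite /emp_coef.
under [RHS]eq_bigr do rewrite mulrCA; rewrite -mulr_sumr; congr (_ * _).
under [RHS]eq_bigr do rewrite mulr_sumr; rewrite exchange_big/=.
rewrite [LHS]big_nat [RHS]big_nat; apply: eq_bigr => k hk.
exact: y_compatible.
Qed.

Let change_orthonormal m M l k : (m <= M)%N ->
  \sum_j C m M l j * C m M k j = (l == k)%:R.
Proof.
move=> mM; have [_ on _] := bS m; rewrite -on.
rewrite (inner_ae _ _ _ (basis_expansion (subS M) (bS M) (incS mM (Sb m l))))//; last exact: L2_sum.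
rewrite inner_suml//; apply: eq_bigr => l' _; by rewrite [inner (b M l') _]innerC.
Qed.

Lemma deviation_same_dim m M : (m <= M)%N -> D m = D M -> deviation m = deviation M.
Proof.
move=> mM e; rewrite /deviation.
rewrite -(orthonormal_rows_isometry _ e (fun l k => change_orthonormal l k mM)).
apply: eq_bigr => l _; congr (_ ^+ 2).
rewrite (emp_coef_change _ mM) (true_coef_change _ mM) -sumrB.
by apply: eq_bigr => j _; rewrite mulrBr.
Qed.

(** Coordinates in the larger model of an element of [S m], so that the projection and the selected
    estimator are compared in one Euclidean space. *)
Let embed m M (x : 'I_(D m) -> R) j := \sum_l x l * C m M l j.

Arguments embed {m} M x j.

Let lift_dot m M (x c : 'I_(D m) -> R) (c' : 'I_(D M) -> R) :
  (forall l, c l = \sum_j C m M l j * c' j) ->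
  \sum_j embed M x j * c' j = \sum_l x l * c l.
Proof.
move=> cE; under [RHS]eq_bigr do rewrite cE mulr_sumr; rewrite exchange_big/=.
apply: eq_bigr => j _; rewrite /embed mulr_suml; apply: eq_bigr => l _; by rewrite mulrA.
Qed.

Let lift_sqr m M (x : 'I_(D m) -> R) : (m <= M)%N ->
  \sum_j embed M x j ^+ 2 = \sum_l x l ^+ 2.
Proof.
move=> mM; under eq_bigr do rewrite expr2; under [RHS]eq_bigr do rewrite expr2.
apply: lift_dot => l; rewrite /embed.
under eq_bigr do rewrite mulr_sumr; rewrite exchange_big/=.
under eq_bigr => k _.
  under eq_bigr do rewrite mulrCA.
  rewrite -mulr_sumr change_orthonormal//; over.
rewrite (bigD1 l)//= eqxx mulr1 big1 ?addr0// => k kl.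
by rewrite eq_sym (negbTE kl) mulr0.
Qed.

Let nu_hatE m : nu_hat b n y m = fun x => \sum_l ah m l * b m l x.
Proof. by []. Qed.

Lemma dist_coef m (c : 'I_(D m) -> R) :
  fine (norm2 i1 i2 (fun x => nu x - \sum_l c l * b m l x)) ^+ 2 =
  inner nu nu - 2 * \sum_l c l * a m l + \sum_l c l ^+ 2.
Proof.
have Ls : L2 i1 i2 (fun x => \sum_l c l * b m l x) by exact: L2_sum.
have -> : (fun x => nu x - \sum_l c l * b m l x) = fun x => nu x + (-1) * (\sum_l c l * b m l x).
  by apply/funext => x; rewrite mulN1r.
rewrite norm2_inner; last by apply: L2D => //; exact: L2Z.
rewrite inner_sqrD// (inner_basis2 (subS m) (bS m)) innerC inner_suml//.
rewrite sqrrN expr1n mul1r mulrN1 mulNr; congr (_ - 2 * _ + _).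
by apply: eq_bigr => l _; rewrite /true_coef [inner nu _]innerC.
Qed.

Let contrast_nu_hat m : contrast i1 i2 n y (nu_hat b n y m) = - \sum_l ah m l ^+ 2.
Proof.
rewrite /contrast norm2_inner; last exact: L2_sum.
rewrite nu_hatE (inner_basis2 (subS m) (bS m)).
rewrite exchange_big/=.
have -> : 2 / n%:R * \sum_(j < D m) \sum_(1 <= i < n.+1) ah m j * b m j (y i) =
    2 * \sum_l ah m l ^+ 2.
  rewrite -mulrA; congr (_ * _); rewrite mulr_sumr; apply: eq_bigr => l _.
  by rewrite -mulr_sumr mulrCA expr2.
under eq_bigr do rewrite -expr2; ring.
Qed.

Let dist_projection m : fine (norm2 i1 i2 (fun x => nu_ m x - nu x)) ^+ 2 =
  inner nu nu - \sum_l a m l ^+ 2.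
Proof.
have [Snm orth] := proj m; have Lnm := SL2 Snm.
have LB : L2 i1 i2 (fun x => nu x - nu_ m x).
  have := L2D Lnu (L2Z (-1) Lnm).
  by congr (L2 _ _ _); apply/funext => x; rewrite mulN1r.
have innerB h : L2 i1 i2 h -> inner (fun x => nu x - nu_ m x) h = inner nu h - inner (nu_ m) h.
  move=> Lh; have -> : (fun x => nu x - nu_ m x) = fun x => nu x + (-1) * nu_ m x.
    by apply/funext => x; rewrite mulN1r.
  by rewrite innerDl// ?innerZl// ?mulN1r//; exact: L2Z.
have coefE l : inner (nu_ m) (b m l) = a m l.
  by have := orth _ (Sb m l); rewrite innerB// => /eqP; rewrite subr_eq0 => /eqP <-.
have e1 : inner nu (nu_ m) = inner (nu_ m) (nu_ m).
  by have := orth _ Snm; rewrite innerB// => /eqP; rewrite subr_eq0 => /eqP.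
have e2 : inner (nu_ m) (nu_ m) = \sum_l a m l ^+ 2.
  rewrite (inner_ae _ _ _ (basis_expansion (subS m) (bS m) Snm))//; last exact: L2_sum.
  rewrite inner_suml//; apply: eq_bigr => l _.
  by rewrite [inner (b m l) _]innerC coefE expr2.
have -> : (fun x => nu_ m x - nu x) = fun x => nu_ m x + (-1) * nu x.
  by apply/funext => x; rewrite mulN1r.
rewrite norm2_inner; last by apply: L2D => //; exact: L2Z.
by rewrite inner_sqrD// innerC e1 e2; ring.
Qed.

Variables (sigma sigma' : R).
Local Notation pen := (pen D n sigma sigma').

Lemma oracle_pointwise m mhat : is_argmin i1 i2 b n sigma sigma' y mhat -> collection D n m ->
  exists2 M, M = m \/ M = mhat &
    fine (norm2 i1 i2 (fun x => nu x - nu_hat b n y mhat x)) ^+ 2 <=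
    3 * fine (norm2 i1 i2 (fun x => nu_ m x - nu x)) ^+ 2 + 2 * pen m - 2 * pen mhat
    + 8 * deviation M.
Proof.
move=> [_ /[apply] argmin]; exists (maxn m mhat).
  by rewrite /maxn; case: ifP; [right|left].
set M := maxn _ _; have mM : (m <= M)%N by exact: leq_maxl.
have hM : (mhat <= M)%N by exact: leq_maxr.
pose e := inner nu nu - \sum_l a M l ^+ 2.
have e0 : 0 <= e.
  have := dist_coef (a M); rewrite (eq_bigr (fun l => a M l ^+ 2)) => [|l _]; last by rewrite expr2.
  by move=> h; have := sqr_ge0 (fine (norm2 i1 i2 (fun x => nu x - \sum_l a M l * b M l x)));
    rewrite h /e; lra.
pose u := embed M (ah mhat); pose w := embed M (a m).
have ua : \sum_j u j * a M j = \sum_l ah mhat l * a mhat l.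
  by apply: lift_dot => l; exact: true_coef_change.
have uah : \sum_j u j * ah M j = \sum_l ah mhat l * ah mhat l.
  by apply: lift_dot => l; exact: emp_coef_change.
have wa : \sum_j w j * a M j = \sum_l a m l * a m l.
  by apply: lift_dot => l; exact: true_coef_change.
have wah : \sum_j w j * ah M j = \sum_l a m l * ah m l.
  by apply: lift_dot => l; exact: emp_coef_change.
have u2 : \sum_j u j ^+ 2 = \sum_l ah mhat l ^+ 2 by exact: lift_sqr.
have w2 : \sum_j w j ^+ 2 = \sum_l a m l ^+ 2 by exact: lift_sqr.
have sqE m' (c : 'I_(D m') -> R) : \sum_l c l * c l = \sum_l c l ^+ 2.
  by apply: eq_bigr => l _; rewrite expr2.
have E (f g : 'I_(D M) -> R) : \sum_i (f i - g i) ^+ 2 =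
    \sum_i f i ^+ 2 - 2 * \sum_i f i * g i + \sum_i g i ^+ 2.
  by have := sum_sqD f g (-1); under eq_bigr do rewrite mulN1r; move=> ->; rewrite sqrrN expr1n; ring.
have -> : fine (norm2 i1 i2 (fun x => nu x - nu_hat b n y mhat x)) ^+ 2 =
    e + \sum_i (u i - a M i) ^+ 2.
  by rewrite dist_coef E u2 ua /e; ring.
have -> : fine (norm2 i1 i2 (fun x => nu_ m x - nu x)) ^+ 2 = e + \sum_i (w i - a M i) ^+ 2.
  by rewrite dist_projection E w2 wa sqE /e; ring.
apply: oracle_vector => //; first by rewrite u2 uah sqE.
move: argmin; rewrite !contrast_nu_hat u2 w2 wah.
(* [argmin] compares with the estimator on [S m], which minimizes the contrast there; this square is
   the amount by which the contrast of the projection is larger. *)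
have : 0 <= \sum_l (ah m l - a m l) ^+ 2 by apply: sumr_ge0 => l _; exact: sqr_ge0.
have -> : \sum_l (ah m l - a m l) ^+ 2 = \sum_l ah m l ^+ 2 - 2 * \sum_l a m l * ah m l + \sum_l a m l ^+ 2.
  rewrite mulr_sumr -sumrB -big_split/=; apply: eq_bigr => l _; ring.
lra.
Qed.

End oracle.

Section null_sets.
Context (R : realType) (i1 i2 : R).
Local Notation leb := (@lebesgue_measure R).

Lemma ae_leb_itv (P : R -> Prop) : {ae leb, forall x, P x} -> {ae leb_itv i1 i2, forall x, P x}.
Proof.
move=> [N [mN N0 PN]]; exists N; split => //.
rewrite /leb_itv/= /mrestr; apply/eqP; rewrite eq_le measure_ge0 andbT -[leRHS]N0.
by apply: le_measure; rewrite ?inE//; exact: measurableI.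
Qed.

Lemma ae_leb_itv_null (P : R -> Prop) : {ae leb_itv i1 i2, forall x, P x} ->
  exists N : set R, [/\ measurable N, N `<=` `[i1, i2], leb N = 0%E &
    forall x, x \in `[i1, i2] -> x \notin N -> P x].
Proof.
move=> [N [mN N0 PN]]; exists (N `&` `[i1, i2]%classic); split => //.
- by apply: measurableI.
move=> x xI xN; apply: contrapT => Px; move/negP: xN; apply.
by rewrite inE; split => //; exact: PN.
Qed.

End null_sets.
Arguments ae_leb_itv {R} i1 i2 {P} _.

Lemma measurable_select d (T : measurableType d) (R : realType) (g : nat -> T -> R) (h : T -> nat) :
  (forall m, measurable_fun setT (g m)) -> measurable_fun setT h ->
  measurable_fun setT (fun w => g (h w) w).
Proof.
move=> mg mh _ B mB; rewrite setTI.
rewrite (_ : _ @^-1` B = \bigcup_m (h @^-1` [set m] `&` g m @^-1` B)).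
  apply: bigcup_measurable => m _; apply: measurableI; rewrite -[X in measurable X]setTI.
    exact: mh.
  exact: mg.
by apply/seteqP; split => w /= => [Bw|[m _ [<-]]//]; exists (h w).
Qed.

Lemma sum_inv_sq_le2 (R : realFieldType) (N : nat) :
  \sum_(1 <= i < N.+1) (i%:R ^+ 2)^-1 <= 2 :> R.
Proof.
case: N => [|N]; first by rewrite big_geq.
suff h : \sum_(1 <= i < N.+2) (i%:R ^+ 2)^-1 <= 2 - N.+1%:R^-1 :> R.
  by apply: le_trans h _; rewrite gerBl invr_ge0.
elim: N => [|N ih]; first by rewrite big_nat1 expr1n invr1 (_ : 2 - 1 = 1 :> R) ?lexx//; ring.
rewrite big_nat_recr//=; apply: le_trans (lerD ih (lexx _)) _.
have n1 : 0 < N.+1%:R :> R by rewrite ltr0n.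
rewrite -[N.+2%:R]natr1; set x : R := N.+1%:R in n1 *.
have x1 : 0 < x + 1 by rewrite addr_gt0.
rewrite -addrA lerD2l [leLHS]addrC lerBlDr [leRHS]addrC.
have -> : x^-1 - (x + 1)^-1 = (x * (x + 1))^-1 by field; rewrite ?gt_eqF.
by rewrite lef_pV2 ?posrE ?exprn_gt0 ?mulr_gt0// expr2 ler_pM2r// lerDl.
Qed.

Section assembly.
Context (R : realType) (i1 i2 : R) (phi : R -> R -> R) (lam : R -> R).
Variables (Q PP : R.-pker R ~> R) (rho : probability (R * R)%type R) (bnu mu : probability R R).
Variables (V : R -> R) (gamma Rc : R) (nu : R -> R).
Variables (S : nat -> set (R -> R)) (D : nat -> nat) (b : forall m : nat, 'I_(D m) -> R -> R).
Arguments b : clear implicits.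
Variables (psi1 psi2 : R) (r : nat) (Cm : R) (nu_ : nat -> R -> R).
Context (z0 : R) (d : measure_display) (T : measurableType d) (P : probability T R).
Variables (Y Z : nat -> {RV P >-> R}) (n : nat).
Hypotheses (i1_gt0 : 0 < i1) (i12 : i1 <= i2).
Hypothesis pdmp : pdmp_conditions phi lam Q.
Hypothesis PPE : prejump_kernel phi lam PP.
Hypothesis erg : ergodicity_conditions i1 i2 phi lam PP Q rho bnu mu V gamma Rc.
Hypothesis dens : stationary_density i1 i2 bnu nu.
Hypothesis model : model_conditions i1 i2 S b psi1 psi2 r Cm.
Hypothesis proj : forall m : nat, orthogonal_projection i1 i2 (S m) nu (nu_ m).
Hypothesis z0_ge0 : 0 <= z0.
Hypothesis chain : jump_chain PP Q z0 Y Z.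
Hypothesis n0 : (0 < n)%N.

Let stat : stationary_laws PP Q rho bnu mu. Proof. by case: erg. Qed.
Let subS m : L2_subspace i1 i2 (S m). Proof. by case: model. Qed.
Let bS m : orthonormal_basis i1 i2 (S m) (b m). Proof. by case: model. Qed.
Let psi10 : 0 < psi1. Proof. by case: model. Qed.
Let psi20 : 0 < psi2. Proof. by case: model. Qed.
Let Lb m l : L2 i1 i2 (b m l).
Proof. by case: (subS m) => h _ _ _; apply: h; case: (bS m). Qed.
Arguments Lb : clear implicits.

Lemma stationary_L2 : L2 i1 i2 nu.
Proof.
have [C C0 PPC] := prejump_kernel_bound i1_gt0 i12 pdmp PPE
  (rate_integral_lty erg) (rate_bounded erg).
have [mnu nu0 nuI _] := dens.
apply: (L2_bounded (C := C)) => //.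
have h := ae_leb_itv i1 i2 (stationary_density_le stat C0 PPC dens).
apply: ae_sub h => x.
by rewrite ger0_norm.
Qed.

(** All the pointwise properties of the bases used at the observations, for all models at once:
    countably many conditions, each valid almost everywhere. *)
Definition regular x := compatible i1 i2 b x /\ forall m,
  [/\ forall l, `|b m l x| <= amplitude i1 i2 (b m) l,
      \sum_l amplitude i1 i2 (b m) l * `|b m l x| <= psi2 * (D m)%:R &
      \sum_l b m l x ^+ 2 <= psi1 * (D m)%:R].

Lemma regular_ae : {ae leb_itv i1 i2, forall x, regular x}.
Proof.
have oo m s : S m s -> (normoo i1 i2 s ^+ 2 <= (psi1 * (D m)%:R)%:E * norm2 i1 i2 s ^+ 2)%E.
  by case: model => _ _ _ h _ _ _ _ _; exact: h.
have boo m : ('N[leb_itv i1 i2]_+oo[(fun x =>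
    \sum_(l < D m) normoo i1 i2 (b m l) * `|b m l x|%:E)%E] <= (psi2 * (D m)%:R)%:E)%E.
  by case: model.
have inc : forall m m', (m <= m')%N -> S m `<=` S m' by case: model.
have h1 := compatible_ae subS inc bS.
have h2 := ae_forall_count (fun m => basis_ae_amplitude (subS m) (@oo m) (bS m)).
have h3 := ae_forall_count (fun m => basis_ae_localized (subS m) (@oo m) (bS m) (boo m)).
have h4 := ae_forall_count (fun m => basis_ae_sq (subS m) psi10 (@oo m) (bS m)).
have [N1 [mN1 N10 PN1]] := h1; have [N2 [mN2 N20 PN2]] := h2.
have [N3 [mN3 N30 PN3]] := h3; have [N4 [mN4 N40 PN4]] := h4.
exists ((N1 `|` N2) `|` (N3 `|` N4)); split.
- by do 2 apply: measurableU => //.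
- by rewrite !measureU0//; exact: measurableU.
move=> x /= nx; apply: contrapT => /not_orP[/not_orP[n1 n2] /not_orP[n3 n4]]; apply: nx.
split; first by apply: contrapT => h; apply: n1; exact: PN1.
have g2 : ~ ~ _ := fun h => n2 (PN2 x h); have g3 : ~ ~ _ := fun h => n3 (PN3 x h).
have g4 : ~ ~ _ := fun h => n4 (PN4 x h).
by move=> m; split; [move/contrapT: g2; exact|move/contrapT: g3; exact|move/contrapT: g4; exact].
Qed.

Section off_null_set.
Variable N : set R.
Hypotheses (mN : measurable N) (NI : N `<=` `[i1, i2]) (N0 : @lebesgue_measure R N = 0%E).
Hypothesis regN : forall x, x \in `[i1, i2] -> x \notin N -> regular x.

Let b0 m l x : x \notin `[i1, i2] -> b m l x = 0.
Proof. by move=> xI; have [_ h _] := Lb m l; exact: h. Qed.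

(** Setting the basis to 0 on the null set turns almost sure bounds into bounds at every point, as
    the concentration argument requires, and changes neither the integrals nor, almost surely, the
    values at the observations. *)
Let f m l x := b m l x * \1_(~` N) x.
Arguments f : clear implicits.

Let fE m l x : x \notin N -> f m l x = b m l x.
Proof. by move=> xN; rewrite /f indicE in_setC xN mulr1. Qed.

Let f0 m l x : x \notin `[i1, i2] -> f m l x = 0.
Proof. by move=> xI; rewrite /f b0// mul0r. Qed.

Let amp m l : 0 < amplitude i1 i2 (b m) l.
Proof.
apply: (amplitude_gt0 (subS m) _ (bS m)) => s.
by case: model => _ _ _ h _ _ _ _ _; exact: h.
Qed.

Let f_regular m x : [/\ forall l, `|f m l x| <= amplitude i1 i2 (b m) l,
      \sum_l amplitude i1 i2 (b m) l * `|f m l x| <= psi2 * (D m)%:R &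
      \sum_l f m l x ^+ 2 <= psi1 * (D m)%:R].
Proof.
have [xN|xN] := boolP (x \in N); last have [xI|xI] := boolP (x \in `[i1, i2]).
- have z l : f m l x = 0 by rewrite /f indicE in_setC xN mulr0.
  split=> [l||]; first by rewrite z normr0 ltW.
    by rewrite big1 => [|l _]; rewrite ?z ?normr0 ?mulr0// mulr_ge0// ltW.
  by rewrite big1 => [|l _]; rewrite ?z ?expr0n// mulr_ge0// ltW.
- have [_ /(_ m)[h1 h2 h3]] := regN xI xN.
  split=> [l||]; first by rewrite fE.
    by under eq_bigr do rewrite fE//.
  by under eq_bigr do rewrite fE//.
- have z l : f m l x = 0 by exact: f0.
  split=> [l||]; first by rewrite z normr0 ltW.
    by rewrite big1 => [|l _]; rewrite ?z ?normr0 ?mulr0// mulr_ge0// ltW.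
  by rewrite big1 => [|l _]; rewrite ?z ?expr0n// mulr_ge0// ltW.
Qed.

Let f_compatible x : x \notin N -> compatible i1 i2 b x.
Proof.
move=> xN; have [xI|xI] := boolP (x \in `[i1, i2]); first by have [] := regN xI xN.
by move=> m M l _; rewrite b0// big1// => l' _; rewrite b0// mulr0.
Qed.

Let bf m l : bmeas (f m l).
Proof.
split; last by exists (amplitude i1 i2 (b m) l) => x; case: (f_regular m x).
have [mb _ _] := Lb m l; apply: measurable_funM => //.
by apply: measurable_indic; exact: measurableC.
Qed.
Arguments bf : clear implicits.

Let Lf m l : L2 i1 i2 (f m l).
Proof.
apply: (L2_bounded (C := amplitude i1 i2 (b m) l)).
- by case: (bf m l).
- exact: f0.
- by apply: aeW => x; case: (f_regular m x).
Qed.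
Arguments Lf : clear implicits.

Let f_ae m l : {ae leb_itv i1 i2, forall x, f m l x = b m l x}.
Proof.
apply: ae_leb_itv; exists N; split => // x /= fb.
by apply: contrapT => xN; apply: fb; rewrite fE//; apply/negP; rewrite inE.
Qed.
Arguments f_ae : clear implicits.

Let stationary_f m l : \int[rho]_x f m l x.1 = true_coef i1 i2 b nu l.
Proof.
rewrite (Rintegral_stationary stat dens (bf m l)); last by move=> x; exact: f0.
rewrite -[LHS]/(inner i1 i2 nu (f m l)) innerC (inner_ae _ _ _ (f_ae m l))//.
- by rewrite innerC.
- exact: stationary_L2.
Qed.
Arguments stationary_f : clear implicits.

Let f_L1 m (u : 'I_(D m) -> R) : \sum_l u l ^+ 2 <= 1 ->
  \int[rho]_x `|\sum_l u l * f m l x.1| <= fine (norm2 i1 i2 nu).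
Proof.
move=> u1; pose s x := \sum_l u l * f m l x.
have bs : bmeas s by apply: bmeas_sum => l; exact: bmeasZ.
have Ls : L2 i1 i2 s by exact: L2_sum.
have Lnu := stationary_L2.
rewrite (Rintegral_stationary stat dens (g := fun x => `|s x|)); last 2 first.
- exact: bmeas_norm.
- by move=> x xI; rewrite /s big1 ?normr0// => l _; rewrite f0// mulr0.
rewrite -[leLHS]/(inner i1 i2 nu (fun x => `|s x|)); apply: inner_norm_le => //.
- by rewrite fine_ge0// Lnorm_ge0.
- by rewrite norm2_inner.
have sb : {ae leb_itv i1 i2, forall x, s x = \sum_l u l * b m l x}.
  have h0 := ae_forall_fin (f_ae m).
  apply: ae_sub h0 => x h.
  by apply: eq_bigr => l _; rewrite h.
have Lsb : L2 i1 i2 (fun x => \sum_l u l * b m l x) by exact: L2_sum.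
rewrite (inner_ae _ _ _ sb)// innerC (inner_ae _ _ _ sb)//.
rewrite (inner_basis2 (subS m) (bS m)); apply: le_trans u1.
by rewrite le_eqVlt; apply/orP; left; apply/eqP; apply: eq_bigr => l _; rewrite expr2.
Qed.

Let X m w := \sum_l (n%:R^-1 * \sum_(1 <= k < n.+1) centered rho (f m) l (Y k w)) ^+ 2.

Let X_deviation m w : (forall k, (0 < k)%N -> Y k w \notin N) ->
  X m w = deviation i1 i2 b nu n (fun k => Y k w) m.
Proof.
move=> YN; apply: eq_bigr => l _; congr (_ ^+ 2); rewrite /centered sumrB mulrBr.
congr (_ - _); last first.
  rewrite sumr_const_nat subn1 stationary_f -[true_coef _ _ _ _ _ *+ _]mulr_natl mulrA mulVf ?mul1r//.
  by rewrite pnatr_eq0 -lt0n.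
rewrite /emp_coef; congr (_ * _); rewrite !big_nat; apply: eq_bigr => k /andP[k0 _].
by rewrite fE// YN.
Qed.

Let A := psi1 + 2 * Rc * psi2 / (1 - gamma) * \int[rho]_x V x.2.

Let iV : rho.-integrable setT (fun x => (V x.2)%:E).
Proof.
have [_ _ _ _ _ mV V1 _ _ _ ergo] := erg.
exact: V_integrable mV V1 ergo.
Qed.

Let X_excess (Cst : R) m : 0 <= Cst ->
  excess_bound psi1 psi2 (fine (norm2 i1 i2 nu)) Rc gamma (V z0) Cst ->
  (0 < D m)%N -> (D m ^ 2 <= n)%N ->
  \int[P]_w Num.max 0 (X m w - 12 * A * (D m)%:R / n%:R) <= Cst / (n%:R * (D m)%:R ^+ 2).
Proof.
move=> Cst0 hC D0 Dn; have [_ _ _ _ _ mV V1 g0 g1 R0 ergo] := erg.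
apply: (@model_excess R PP Q rho V gamma Rc R0 g0 g1 mV V1 ergo (rho_support stat) iV
  z0 d T P Y Z chain z0_ge0 (D m) (f m) (amplitude i1 i2 (b m)) psi1 psi2
  (fine (norm2 i1 i2 nu))) => //.
- by rewrite fine_ge0// Lnorm_ge0.
- by move=> x; case: (f_regular m x).
- by move=> l x; case: (f_regular m x).
- by move=> x; case: (f_regular m x).
- by move=> u; exact: f_L1.
Qed.

(* The deviation only depends on the dimension: one model per dimension is enough. *)
Let rep (k : nat) : nat :=
  if pselect (exists m, D m == k) is left ex then ex_minn ex else 0%N.

Let repP M : (rep (D M) <= M)%N /\ D (rep (D M)) = D M.
Proof.
rewrite /rep; case: pselect => [ex|]; last by case; exists M.
by case: ex_minnP => k /eqP -> kmin; split => //; exact: kmin.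
Qed.

(** The sum dominates the excess of whichever model is selected. The test on [rep] discards the
    dimensions that no model has, where [rep] takes its default value. *)
Let W w := \sum_(1 <= k < n.+1 | (k ^ 2 <= n)%N && (D (rep k) == k))
  Num.max 0 (X (rep k) w - 12 * A * k%:R / n%:R).

Let bX m : @bmeas _ T R (X m).
Proof.
apply: bmeas_sum => l; under eq_fun do rewrite expr2.
have bc k : @bmeas _ T R (fun w => centered rho (f m) l (Y k w)).
  exact: (bmeas_comp (bmeas_centered rho (bf m) l)).
by apply: bmeasM; apply: bmeasZ; exact: bmeas_sum.
Qed.

Let bmaxX m c : @bmeas _ T R (fun w => Num.max 0 (X m w - c)).
Proof. by apply: bmeas_max0; exact: bmeasB. Qed.

Let bW : @bmeas _ T R W.
Proof.
rewrite /W; under eq_fun do rewrite -big_filter.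
exact: bmeas_sum.
Qed.

Let W_mean (Cst : R) : 0 <= Cst ->
  excess_bound psi1 psi2 (fine (norm2 i1 i2 nu)) Rc gamma (V z0) Cst ->
  \int[P]_w W w <= 2 * Cst / n%:R.
Proof.
move=> Cst0 hC; rewrite /W; under eq_Rintegral do rewrite -big_filter.
rewrite bRintegral_sum// big_filter.
apply: (@le_trans _ _ (\sum_(1 <= k < n.+1) Cst / n%:R * (k%:R ^+ 2)^-1)); last first.
  rewrite -mulr_sumr [leRHS](_ : _ = Cst / n%:R * 2); last by ring.
  by rewrite ler_wpM2l ?divr_ge0// sum_inv_sq_le2.
rewrite big_mkcond/= big_nat [leRHS]big_nat; apply: ler_sum => k /andP[k0 _].
case: ifP => [/andP[kn /eqP Dk]|_]; last by rewrite mulr_ge0 ?divr_ge0 ?invr_ge0 ?exprn_ge0.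
have := X_excess (m := rep k) Cst0 hC; rewrite Dk => /(_ k0 kn)/le_trans; apply.
by rewrite invfM mulrA.
Qed.

Let A0 : 0 <= A.
Proof.
have [_ _ _ _ _ mV V1 _ g1 R0 _] := erg.
have M1 := V_mean_ge1 mV V1 (rho_support stat) iV.
apply: addr_ge0; first exact: ltW.
apply: mulr_ge0; last exact: le_trans ler01 M1.
by rewrite divr_ge0 ?subr_ge0 ?(ltW g1)// !mulr_ge0// ltW.
Qed.

Let dev_le M w : (forall k, (0 < k)%N -> Y k w \notin N) -> (D M ^ 2 <= n)%N ->
  deviation i1 i2 b nu n (fun k => Y k w) M <= W w + 12 * A * (D M)%:R / n%:R.
Proof.
move=> YN DMn; have inc : forall m m', (m <= m')%N -> S m `<=` S m' by case: model.
have W0 (k : nat) : 0 <= Num.max 0 (X (rep k) w - 12 * A * k%:R / n%:R).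
  by rewrite le_max lexx.
have WW : 0 <= W w by exact: sumr_ge0.
have [DM0|DM0] := posnP (D M).
  rewrite /deviation big1 => [|i _]; last by have := ltn_ord i; rewrite [X in (_ < X)%N]DM0.
  by rewrite addr_ge0// divr_ge0// !mulr_ge0.
have [repM Drep] := repP M.
have yc k : (1 <= k <= n)%N -> compatible i1 i2 b (Y k w).
  by case/andP => k0 _; apply: f_compatible; exact: YN.
rewrite -(deviation_same_dim subS inc bS stationary_L2 yc repM Drep) -X_deviation//.
rewrite -lerBlDr; apply: (@le_trans _ _ (Num.max 0 (X (rep (D M)) w - 12 * A * (D M)%:R / n%:R))).
  by rewrite le_max lexx orbT.
rewrite /W big_mkcond (bigD1_seq (D M))/=; last 2 first.
- rewrite mem_index_iota DM0 ltnS (leq_trans _ DMn)//.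
  by rewrite -{1}(expn1 (D M)) leq_pexp2l.
- exact: iota_uniq.
rewrite DMn Drep eqxx/= lerDl sumr_ge0// => k _.
by case: ifP.
Qed.

Variables (Cst cl sigma sigma' : R) (mhat : T -> nat) (m : nat).
Hypothesis Cst0 : 0 <= Cst.
Hypothesis hC : excess_bound psi1 psi2 (fine (norm2 i1 i2 nu)) Rc gamma (V z0) Cst.
Hypothesis hsigma : 48 * (psi1 + C_lambda mu V gamma Rc * psi2) <= sigma.
Hypothesis hsigma' : 48 * cl * psi1 <= sigma'.
Hypothesis mmhat : measurable_fun setT mhat.
Hypothesis argmin : forall w : T, is_argmin i1 i2 b n sigma sigma' (fun k => Y k w) (mhat w).
Hypothesis colm : collection D n m.

(** The constant [cl] may be negative, and so may [sigma']; the absolute value bounds what the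
    penalty loses in that case. *)
Let kap := `|cl| * psi1 / n%:R.

(** As [8 * 12 = 2 * 48], two penalties cover eight times the threshold [12 A D / n], up to
    [96 * kap]. *)
Let pen_ge m' : 48 * A * (D m')%:R / n%:R - 48 * kap <= pen D n sigma sigma' m'.
Proof.
have [_ _ _ _ _ mV V1 _ _ _ ergo] := erg.
have sA : 48 * A <= sigma.
  move: hsigma; rewrite (C_lambdaE stat mV V1 ergo) /A.
  by congr (_ <= _); ring.
rewrite /pen /kap; apply: lerD.
  by rewrite ler_wpM2r ?invr_ge0// ler_wpM2r.
rewrite mulrA -mulNr ler_wpM2r ?invr_ge0//; apply: le_trans hsigma'.
by rewrite mulrA -mulNr ler_wpM2r ?(ltW psi10)// -mulrN ler_wpM2l// lerNl -normrN ler_norm.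
Qed.

Lemma oracle_expectation : ('E_P[fun w : T =>
     (fine (norm2 i1 i2
       (fun x => nu x - nu_hat b n (fun k => Y k w) (mhat w) x)) ^+ 2)%R] <=
  (3 * fine (norm2 i1 i2 (fun x => nu_ m x - nu x)%R) ^+ 2 + 4 * pen D n sigma sigma' m
   + (16 * Cst + 192 * `|cl| * psi1) / n%:R)%:E)%E.
Proof.
have inc : forall m m', (m <= m')%N -> S m `<=` S m' by case: model.
have lamI := rate_integral_lty erg; have lamB := rate_bounded erg.
have Lnu := stationary_L2.
set B := 3 * _ + _; set F := fun w => _.
have kap0 : 0 <= kap by rewrite divr_ge0// mulr_ge0// ltW.
have b0' := sqr_ge0 (fine (norm2 i1 i2 (fun x => nu_ m x - nu x))).
have AD0 m' : 0 <= 48 * A * (D m')%:R / n%:R by rewrite divr_ge0// !mulr_ge0.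
have B0 : 0 <= B + 192 * kap by rewrite /B; have := pen_ge m; have := AD0 m; lra.
have Yae : {ae P, forall w, forall k, (0 < k)%N -> Y k w \notin N}.
  apply: ae_foralln => k; case: k => [|k]; first by apply: aeW.
  have h := chain_Y_null i1_gt0 i12 pdmp PPE lamI lamB chain z0_ge0 mN NI N0 (ltn0Sn k).
  by apply: ae_sub h => w.
have FW w : (forall k, (0 < k)%N -> Y k w \notin N) -> F w <= B + 192 * kap + 8 * W w.
  move=> YN.
  have yc k : (1 <= k <= n)%N -> compatible i1 i2 b (Y k w).
    by case/andP => k0 _; apply: f_compatible; exact: YN.
  have [M MM h] := oracle_pointwise subS inc bS Lnu proj yc (argmin w) colm.
  rewrite /F; apply: le_trans h _; rewrite /B.
  have [ch _] := argmin w.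
  have := pen_ge m; have := pen_ge (mhat w); have := AD0 m; have := AD0 (mhat w).
  (* For [M = m] the threshold costs [2 pen m + 96 kap], and [- 2 pen mhat] at most [96 kap]. For
     [M = mhat] it is cancelled by [- 2 pen mhat] up to [96 kap], and
     [2 pen m <= 4 pen m + 96 kap]. *)
  by case: MM => ->; [have := dev_le YN colm|have := dev_le YN ch]; lra.
have mF : measurable_fun setT F.
  (* For a fixed model the distance is a polynomial in the empirical coefficients, hence measurable;
     the selected one is glued over the countably many values of [mhat]. *)
  pose g m' w := inner i1 i2 nu nu - 2 * \sum_(l < D m') (emp_coef b n (fun k => Y k w) l) * true_coef i1 i2 b nu l
    + \sum_(l < D m') (emp_coef b n (fun k => Y k w) l) ^+ 2.
  rewrite (_ : F = fun w => g (mhat w) w); last first.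
    by apply/funext => w; rewrite /F /g -(dist_coef subS bS Lnu).
  apply: measurable_select => // m'.
  have me l : measurable_fun setT (fun w => emp_coef b n (fun k => Y k w) (l : 'I_(D m'))).
    apply: measurable_funM => //; apply: measurable_sum => k.
    by apply: measurableT_comp => //; have [] := Lb m' l.
  apply: measurable_funD.
    apply: measurable_funB => //; apply: measurable_funM => //.
    by apply: measurable_sum => l; exact: measurable_funM.
  by apply: measurable_sum => l; exact: measurable_funX.
have W0 w : 0 <= W w by apply: sumr_ge0 => k _; rewrite le_max lexx.
have bB : @bmeas _ T R (fun w => B + 192 * kap + 8 * W w).
  by apply: bmeasD => //; exact: bmeasZ.
rewrite unlock; apply: (@le_trans _ _ (\int[P]_w (B + 192 * kap + 8 * W w)%:E)%E).
  apply: ae_ge0_le_integral => //.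
  - by move=> w _; rewrite lee_fin sqr_ge0.
  - exact/measurable_EFinP.
  - by move=> w _; rewrite lee_fin addr_ge0// mulr_ge0.
  - by apply/measurable_EFinP; case: bB.
  by apply: ae_sub Yae => w YN _; rewrite lee_fin FW.
rewrite -bRintegral_EFin// lee_fin bRintegralD//; last exact: bmeasZ.
rewrite bRintegral_cst bRintegralZ//.
have := W_mean Cst0 hC.
have -> : (16 * Cst + 192 * `|cl| * psi1) / n%:R = 8 * (2 * Cst / n%:R) + 192 * kap.
  by rewrite /kap; ring.
rewrite /B; lra.
Qed.

End off_null_set.
End assembly.

Theorem theorem7 (R : realType)
    (* c_lambda, as a function of gamma, R, V_lambda and z_0 *)
    (c_lambda : R -> R -> (R -> R) -> R -> R) :
  (* c', as a function of V_lambda, R, gamma, the norm of nu, psi_1, psi_2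
     and z_0 *)
  exists c' : (R -> R) -> R -> R -> R -> R -> R -> R -> R,
  forall (i1 i2 : R) (phi : R -> R -> R) (lam : R -> R)
    (Q PP : R.-pker R ~> R)
    (rho : probability (R * R)%type R) (bnu mu : probability R R)
    (V : R -> R) (gamma Rc : R) (nu : R -> R)
    (S : nat -> set (R -> R)) (D : nat -> nat)
    (b : forall m : nat, 'I_(D m) -> R -> R)
    (psi1 psi2 : R) (r : nat) (C : R) (nu_ : nat -> R -> R)
    (z0 : R) (d : measure_display) (T : measurableType d)
    (P : probability T R) (Y Z : nat -> {RV P >-> R})
    (sigma sigma' : R) (n : nat) (mhat : T -> nat),
  0 < i1 -> i1 <= i2 ->
  pdmp_conditions phi lam Q ->
  prejump_kernel phi lam PP ->
  ergodicity_conditions i1 i2 phi lam PP Q rho bnu mu V gamma Rc ->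
  stationary_density i1 i2 bnu nu ->
  model_conditions i1 i2 S b psi1 psi2 r C ->
  (forall m : nat, orthogonal_projection i1 i2 (S m) nu (nu_ m)) ->
  0 <= z0 ->
  jump_chain PP Q z0 Y Z ->
  variance_bound rho mu V gamma Rc (c_lambda gamma Rc V z0) P Y Z ->
  48 * (psi1 + C_lambda mu V gamma Rc * psi2) <= sigma ->
  48 * c_lambda gamma Rc V z0 * psi1 <= sigma' ->
  (0 < n)%N ->
  measurable_fun setT mhat ->
  (forall w : T, is_argmin i1 i2 b n sigma sigma' (fun k => Y k w) (mhat w)) ->
  ('E_P[fun w : T =>
     (fine (norm2 i1 i2
       (fun x => nu x - nu_hat b n (fun k => Y k w) (mhat w) x)) ^+ 2)%R]
   <= ereal_inf [set (3 * fine (norm2 i1 i2 (fun x => nu_ m x - nu x)%R) ^+ 2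
                      + 4 * pen D n sigma sigma' m)%:E
                 | m in collection D n]
      + (c' V Rc gamma (fine (norm2 i1 i2 nu)) psi1 psi2 z0 / n%:R)%:E)%E.
Proof.
(* [c'] is a function fixed before the process is given, so a value satisfying the numerical bound
   is selected from its arguments alone; [excess_constant] provides one when the hypotheses hold. *)
pose Cst (V : R -> R) (Rc gamma nn psi1 psi2 z0 : R) : R :=
  xget 0 [set c | 0 <= c /\ excess_bound psi1 psi2 nn Rc gamma (V z0) c].
exists (fun V Rc gamma nn psi1 psi2 z0 => 16 * Cst V Rc gamma nn psi1 psi2 z0
  + 192 * `|c_lambda gamma Rc V z0| * psi1).
move=> i1 i2 phi lam Q PP rho bnu mu V gamma Rc nu S D b psi1 psi2 r C nu_ z0 d T P Y Z
  sigma sigma' n mhat i1_gt0 i12 pdmp PPE erg dens model proj z0_ge0 chain _ hsigma hsigma'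
  n0 mmhat argmin.
have [_ _ _ _ _ _ V1 g0 g1 R0 _] := erg.
have [_ _ psi10 _ psi20 _ _ _ _] := model.
have [Cst0 hC] : 0 <= Cst V Rc gamma (fine (norm2 i1 i2 nu)) psi1 psi2 z0 /\
    excess_bound psi1 psi2 (fine (norm2 i1 i2 nu)) Rc gamma (V z0)
      (Cst V Rc gamma (fine (norm2 i1 i2 nu)) psi1 psi2 z0).
  apply: (@xgetPex _ 0 [set c | 0 <= c /\ excess_bound psi1 psi2 _ Rc gamma (V z0) c]).
  have nn0 : 0 <= fine (norm2 i1 i2 nu) by rewrite fine_ge0// Lnorm_ge0.
  have [c c0 hc] := excess_constant psi10 psi20 nn0 R0 g0 g1 (V1 _ z0_ge0).
  by exists c.
have [N [mN NI N0 regN]] := ae_leb_itv_null (regular_ae model).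
rewrite -leeBlDr//; apply: le_ereal_inf_tmp => _ [m colm <-]; rewrite leeBlDr// -EFinD.
exact: (oracle_expectation i1_gt0 i12 pdmp PPE erg dens model proj z0_ge0 chain n0 mN NI N0 regN
  Cst0 hC hsigma hsigma' mmhat argmin colm).
Qed.
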